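(* Let $n\ge2$. There are constants $C_1,C_2,C_3,C_4>0$ (depending only on $n$, in particular independent of $\varepsilon$ and $A$) such that for every hypersquare $A\subset\mathbb{R}^{n-1}$ and every $\varepsilon>0$ with $\varepsilon<\min\{\mathcal{H}^{n-1}(A)^{\frac2{n-1}},\mathcal{H}^{n-1}(A)^{-C_3},C_4\}$ we have $$C_1\,\mathcal{H}^{n-1}(A)\,\varepsilon|\log\varepsilon|\le\Delta\mathcal{M}^{\varepsilon,A}\le C_2\,\mathcal{H}^{n-1}(A)\,\varepsilon|\log\varepsilon|.$$
   Context: Let $I=[0,1]$, let $\mathcal{H}^{r}$ denote the $r$-dimensional Hausdorff measure, and let $A\subset\mathbb{R}^{n-1}$ be a hypersquare (an $(n-1)$-dimensional cube of positive side length). Set $\mu_0=\mathcal{H}^{n-1}\llcorner(A\times\{0\})$ and $\mu_1=\mathcal{H}^{n-1}\llcorner(A\times\{1\})$, measures on $\mathbb{R}^n$. A reference space $(\Gamma,\mathcal{B}(\Gamma),P_\Gamma)$ is a complete separable uncountable metric space with its Borel $\sigma$-algebra and a positive finite atomless Borel measure $P_\Gamma$, here of total mass $\mathcal{H}^{n-1}(A)$; all such spaces of equal mass are isomorphic, so the choice is immaterial (e.g. $[0,1]$ with a multiple of Lebesgue measure). An irrigation pattern is a measurable map $\chi:\Gamma\times I\to\mathbb{R}^n$ such that $\chi_p=\chi(p,\cdot)$ is absolutely continuous on $I$ for almost all $p\in\Gamma$. Its irrigating and irrigated measures $\mu_+^\chi,\mu_-^\chi$ are the pushforwards of $P_\Gamma$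 under $p\mapsto\chi(p,0)$ and $p\mapsto\chi(p,1)$. For $x\in\mathbb{R}^n$ let $m_\chi(x)=P_\Gamma(\{q\in\Gamma: x\in\chi_q(I)\})$. Branched transport energy: for $0\le\varepsilon\le1$ let $s_\varepsilon^\chi(x)=m_\chi(x)^{-\varepsilon}$ if $m_\chi(x)>0$ and $s_\varepsilon^\chi(x)=\infty$ if $m_\chi(x)=0$, and set $$\mathcal{M}^{\varepsilon,A}[\chi]=\int_{\Gamma\times I}s_\varepsilon^\chi(\chi_p(t))\,|\dot\chi_p(t)|\,\mathrm{d}P_\Gamma(p)\,\mathrm{d}t$$ if $\mu_+^\chi=\mu_0$ and $\mu_-^\chi=\mu_1$, and $\mathcal{M}^{\varepsilon,A}[\chi]=\infty$ otherwise. Let $\mathcal{M}^{*,A}=\inf_\chi\mathcal{M}^{0,A}[\chi]$, which equals $\mathcal{H}^{n-1}(A)$. The excess energy is $\Delta\mathcal{M}^{\varepsilon,A}=\min_\chi\mathcal{M}^{\varepsilon,A}[\chi]-\mathcal{M}^{*,A}$ (minimisers exist for $\varepsilon>0$). *)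

(* Defs.v *)
From HB Require Import structures.
From mathcomp Require Import all_boot all_order all_algebra.
From mathcomp Require Import all_classical all_reals all_analysis.
Import Order.TTheory GRing.Theory Num.Theory.
Import numFieldNormedType.Exports.

Set Implicit Arguments.
Unset Strict Implicit.
Unset Printing Implicit Defensive.

Local Open Scope classical_set_scope.
Local Open Scope ring_scope.

#[short(type="completeMetricType")]
HB.structure Definition CompleteMetric (R : realType) :=
  {T of Metric R T & Complete T}.

Notation borel T := (g_sigma_algebraType (@open T)).

Section hausdorff_measure.
Context {R : realType}.

(* The library norm on matrices is the max norm; lengths and diameters here
   are Euclidean. *)
Definition enorm m (x : 'rV[R]_m) : R := Num.sqrt (\sum_i x 0 i ^+ 2).

(* Lebesgue volume pi^(r/2) / Gamma(r/2 + 1) of the r-dimensional Euclidean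
   unit ball, from omega_(r+2) = 2 pi / (r + 2) * omega_r. *)
Fixpoint unit_ball_volume (r : nat) : R :=
  match r with
  | 0 => 1
  | 1 => 2
  | (r'.+1 as s).+1 => 2 * pi / s.+1%:R * unit_ball_volume r'
  end.

Local Open Scope ereal_scope.

Definition diam m (U : set 'rV[R]_m) : \bar R :=
  ereal_sup [set (enorm (x.1 - x.2))%:E | x in U `*` U].

(* The empty set contributes 0 also for r = 0 (its diam is -oo). *)
Definition hausdorff_weight (r : nat) m (U : set 'rV[R]_m) : \bar R :=
  if U == set0 then 0 else (unit_ball_volume r / 2 ^+ r)%:E * diam U ^+ r.

Definition hausdorff_premeasure (r : nat) (delta : R) m (E : set 'rV[R]_m) :
    \bar R :=
  ereal_inf [set \sum_(i <oo) hausdorff_weight r (U i) | U in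
    [set U : (set 'rV[R]_m)^nat |
      E `<=` \bigcup_i U i /\ forall i, diam (U i) <= delta%:E]].

(* r-dimensional Hausdorff (outer) measure, normalised so as to agree with
   Lebesgue measure on R^r. *)
Definition hausdorff (r : nat) m (E : set 'rV[R]_m) : \bar R :=
  ereal_sup [set hausdorff_premeasure r delta E | delta in `]0%R, +oo[].

End hausdorff_measure.

Section geometry.
Context {R : realType}.

(* Closed cubes of positive side length in arbitrary position (not necessarily
   parallel to the axes). *)
Definition hypersquare d (A : set 'rV[R]_d) : Prop :=
  exists (a : 'rV[R]_d) (Q : 'M[R]_d) (l : R),
    [/\ 0 < l, Q *m Q^T = 1%:M &
        A = [set a + u *m Q | u in
              [set u : 'rV[R]_d | forall i, 0 <= u 0 i <= l]]].

Definition at_height d (A : set 'rV[R]_d) (c : R) : set 'rV[R]_(d + 1) :=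
  [set row_mx v (const_mx c) | v in A].

Definition absolutely_continuous_path m (f : R -> 'rV[R]_m) : Prop :=
  forall e : R, 0 < e -> exists2 delta : R, 0 < delta &
    forall (k : nat) (a b : 'I_k -> R),
      (forall i, [/\ 0 <= a i, a i <= b i & b i <= 1]) ->
      trivIset [set: 'I_k] (fun i => [set` `]a i, b i[]) ->
      \sum_i (b i - a i) < delta ->
      \sum_i enorm (f (b i) - f (a i)) < e.

End geometry.

Section irrigation.
Context {R : realType}.

Local Open Scope ereal_scope.

Definition atomless d (T : measurableType d) (P : set T -> \bar R) : Prop :=
  forall B, measurable B -> 0 < P B ->
    exists C, [/\ measurable C, C `<=` B, 0 < P C & P C < P B].

Definition reference_space (T : completeMetricType R)
    (P : {finite_measure set (borel T) -> \bar R}) (mass : \bar R) : Prop :=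
  [/\ exists2 D : set T, countable D & dense D,
      ~ countable [set: T],
      atomless P,
      P setT = mass &
      0 < mass].

Context {T : completeMetricType R}.
Variable P : {finite_measure set (borel T) -> \bar R}.

Definition space_time : set (borel T * measurableTypeR R) :=
  [set: borel T] `*` `[0%R, 1%R].

(* A pattern Gamma x [0, 1] -> R^m is encoded as a function on Gamma x R, of
   which only the values at times in [0, 1] are constrained and used (the values
   outside affect derivatives only at the endpoint times, a null set). *)
Definition irrigation_pattern m (chi : borel T -> R -> 'rV[R]_m) : Prop :=
  measurable_fun space_time (fun z => chi z.1 z.2 : borel 'rV[R]_m) /\
  {ae P, forall p, absolutely_continuous_path (chi p)}.

Definition irrigating m (chi : borel T -> R -> 'rV[R]_m) :
    set (borel 'rV[R]_m) -> \bar R :=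
  pushforward P (fun p => chi p 0%R : borel 'rV[R]_m).

Definition irrigated m (chi : borel T -> R -> 'rV[R]_m) :
    set (borel 'rV[R]_m) -> \bar R :=
  pushforward P (fun p => chi p 1%R : borel 'rV[R]_m).

(* {q | x \in chi_q([0, 1])} is in general only measurable for the completion
   of P, whose value is given by the outer measure P^*. *)
Definition multiplicity m (chi : borel T -> R -> 'rV[R]_m) (x : 'rV[R]_m) :
    \bar R :=
  (P^*)%mu [set q | (chi q @` `[0%R, 1%R]) x].

Definition cost_density m (eps : R) (chi : borel T -> R -> 'rV[R]_m)
    (x : 'rV[R]_m) : \bar R :=
  if 0 < multiplicity chi x then multiplicity chi x `^ (- eps) else +oo.

Context {d : nat} (A : set 'rV[R]_d).

Definition admissible (chi : borel T -> R -> 'rV[R]_(d + 1)) : Prop :=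
  forall B : set (borel 'rV[R]_(d + 1)), measurable B ->
    irrigating chi B = hausdorff d (B `&` at_height A 0) /\
    irrigated chi B = hausdorff d (B `&` at_height A 1).

(* The product is 0 where the speed is 0, also if cost_density is +oo there. *)
Definition energy (eps : R) (chi : borel T -> R -> 'rV[R]_(d + 1)) : \bar R :=
  if `[< admissible chi >] then
    \int[P \x @lebesgue_measure R]_(z in space_time)
      (cost_density eps chi (chi z.1 z.2) * (enorm (derive1 (chi z.1) z.2))%:E)
  else +oo.

(* For eps > 0 this infimum is attained, i.e. it is the minimal energy. *)
Definition min_energy (eps : R) : \bar R :=
  ereal_inf [set energy eps chi | chi in @irrigation_pattern (d + 1)].

Definition excess_energy (eps : R) : \bar R := min_energy eps - min_energy 0.

End irrigation.

(* Main.v *)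
Require Import Defs.
From HB Require Import structures.
From mathcomp Require Import all_boot all_order all_algebra.
From mathcomp Require Import all_classical all_reals all_analysis.
From mathcomp Require Import measurable_realfun ring lra.
Import Order.TTheory GRing.Theory Num.Theory.
Import numFieldNormedType.Exports.
Set Implicit Arguments.
Unset Strict Implicit.
Unset Printing Implicit Defensive.
Local Open Scope classical_set_scope.
Local Open Scope ring_scope.

(** Write d = n - 1, let M be the area of A and q = eps^(1/8). At eps = 0 the
    energy is at least the total length of all paths. Each path climbs from
    height 0 to height 1, so that the minimum is M, approached by almost vertical
    patterns ([min_energy0_ge], [min_energy0_le]).

    The lower bound says that a nearly optimal pattern cannot branch much. A path
    that moves sideways by r from its starting point has length at least
    1 + r^2 / 3 ([length_ge_detour]). If the energy exceeds M by less than
    M eps |log eps| / 8, then only a mass of order q^2 can make detours of size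
    r = q^2. Any other path through a point x starts within distance r of x, on a
    part of A of measure at most (2 r)^d c_d, where c_d is the measure of the
    unit cube. Hence the multiplicity is at most K q^2 everywhere, with a
    constant K ([multiplicity_le]), and a unit of length costs at least
    (K q^2)^(-eps) >= 1 + eps |log eps| / 8. Multiplied by the total length,
    which is at least M, this is the bound ([lower_bound_energy]).

    The upper bound comes from a symmetric tree ([branching_path]). The cube is
    divided dyadically until its side w = l / 2^k is at most sqrt eps. At
    distance s from the top and the bottom face, all particles whose endpoints
    share a dyadic cube of side about w s travel together. Slopes are of order w at most,
    which lengthens paths by a factor 1 + O(eps). The bundles at mid height have
    mass at least M / 2^(k d) >= q^(4 d + 1), so their cost is
    1 + O(eps |log eps|). Near the ends the bundles thin out, which
    contributes a factor s^(-d eps), with integral 1 + O(eps)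
    ([min_energy_le_branching]).

    Three tools carry this. An absolutely continuous path is at least as long
    as its chords ([path_length_ge]): its projection on the chord is the integral
    of its derivative, by Radon-Nikodym for the Stieltjes measures of the two
    monotone parts. The speed of the paths is measurable jointly in particle and
    time ([measurable_path_speed]), so that Tonelli applies. The space of
    particles is mapped onto the cube with the Hausdorff measure as its image
    ([uniform_map_distribution]), through coin tosses that exist on any atomless
    space. Of the Hausdorff measure this needs only subadditivity, the behaviour
    under Lipschitz maps, and that the unit cube has finite positive measure,
    which follows from the existence of a reference space. *)

(** * The Euclidean norm *)

Section euclidean_norm.
Context {R : realType}.

Lemma enorm_ge0 m (x : 'rV[R]_m) : 0 <= enorm x.
Proof. exact: sqrtr_ge0. Qed.

Lemma sqr_enorm m (x : 'rV[R]_m) : enorm x ^+ 2 = \sum_i x 0 i ^+ 2.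
Proof. by rewrite sqr_sqrtr// sumr_ge0// => i _; exact: sqr_ge0. Qed.

Lemma enorm0 m : enorm (0 : 'rV[R]_m) = 0.
Proof. by rewrite /enorm big1 ?sqrtr0// => i _; rewrite mxE expr0n. Qed.

Lemma enormZ m (c : R) (x : 'rV[R]_m) : enorm (c *: x) = `|c| * enorm x.
Proof.
apply/eqP; rewrite -(@eqrXn2 _ 2)// ?mulr_ge0 ?enorm_ge0//; apply/eqP.
rewrite exprMn !sqr_enorm real_normK ?num_real// mulr_sumr.
by apply: eq_bigr => i _; rewrite mxE exprMn.
Qed.

Lemma enormN m (x : 'rV[R]_m) : enorm (- x) = enorm x.
Proof. by rewrite -scaleN1r enormZ normrN1 mul1r. Qed.

Lemma enormB m (x y : 'rV[R]_m) : enorm (x - y) = enorm (y - x).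
Proof. by rewrite -enormN opprB. Qed.

Lemma coord_le_enorm m (x : 'rV[R]_m) i : `|x 0 i| <= enorm x.
Proof.
rewrite -(@ler_pXn2r _ 2)// ?nnegrE ?enorm_ge0// sqr_enorm real_normK ?num_real//.
by rewrite (bigD1 i)//= lerDl sumr_ge0// => j _; exact: sqr_ge0.
Qed.

Lemma enorm_eq0 m (x : 'rV[R]_m) : enorm x = 0 -> x = 0.
Proof.
move=> x0; apply/rowP => i; rewrite mxE; apply/eqP.
by rewrite -normr_le0 -x0 coord_le_enorm.
Qed.

Lemma dot_le_enorm m (x y : 'rV[R]_m) :
  \sum_i x 0 i * y 0 i <= enorm x * enorm y.
Proof.
have [/enorm_eq0 ->|x0] := eqVneq (enorm x) 0.
  by rewrite enorm0 mul0r big1// => i _; rewrite mxE mul0r.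
have xgt0 : 0 < enorm x by rewrite lt0r x0 enorm_ge0.
have [/enorm_eq0 ->|y0] := eqVneq (enorm y) 0.
  by rewrite enorm0 mulr0 big1// => i _; rewrite mxE mulr0.
have ygt0 : 0 < enorm y by rewrite lt0r y0 enorm_ge0.
have : 0 <= \sum_i (enorm y * x 0 i - enorm x * y 0 i) ^+ 2.
  by apply: sumr_ge0 => i _; exact: sqr_ge0.
have -> : \sum_i (enorm y * x 0 i - enorm x * y 0 i) ^+ 2 =
    2 * enorm x * enorm y * (enorm x * enorm y - \sum_i x 0 i * y 0 i).
  transitivity (\sum_i (enorm y ^+ 2 * x 0 i ^+ 2 + enorm x ^+ 2 * y 0 i ^+ 2
      - 2 * enorm x * enorm y * (x 0 i * y 0 i))).
    by apply: eq_bigr => i _; ring.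
  by rewrite sumrB big_split/= -!mulr_sumr -!sqr_enorm; ring.
by rewrite pmulr_rge0 ?mulr_gt0// subr_ge0.
Qed.

Lemma sqr_enorm_row_mx m p (u : 'rV[R]_m) (v : 'rV[R]_p) :
  enorm (row_mx u v) ^+ 2 = enorm u ^+ 2 + enorm v ^+ 2.
Proof.
rewrite !sqr_enorm big_split_ord/=; congr (_ + _).
  by apply: eq_bigr => i _; rewrite row_mxEl.
by apply: eq_bigr => i _; rewrite row_mxEr.
Qed.

Lemma enorm_isometry m (Q : 'M[R]_m) (u : 'rV[R]_m) :
  Q *m Q^T = 1%:M -> enorm (u *m Q) = enorm u.
Proof.
move=> QQ; have dotE (x : 'rV[R]_m) : \sum_i x 0 i ^+ 2 = (x *m x^T) 0 0.
  by rewrite mxE; apply: eq_bigr => i _; rewrite mxE expr2.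
by rewrite /enorm !dotE trmx_mul mulmxA -(mulmxA u) QQ mulmx1.
Qed.

End euclidean_norm.

(** * Absolutely continuous functions and their derivatives *)

Section absolutely_continuous_functions.
Context {R : realType}.
Implicit Types f : R -> R.

(** Separated from [absolutely_continuous_fun] because the same delta serves for
    the increments of f and for its variation. *)
Definition ac_modulus f (e delta : R) :=
  forall (k : nat) (a b : 'I_k -> R),
    (forall i, [/\ 0 <= a i, a i <= b i & b i <= 1]) ->
    trivIset [set: 'I_k] (fun i => [set` `]a i, b i[]) ->
    \sum_i (b i - a i) < delta -> \sum_i `|f (b i) - f (a i)| < e.

Definition absolutely_continuous_fun f :=
  forall e, 0 < e -> exists2 delta, 0 < delta & ac_modulus f e delta.

Lemma ac_modulus_finType f e delta (I : finType) (a b : I -> R) :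
  ac_modulus f e delta ->
  (forall i, [/\ 0 <= a i, a i <= b i & b i <= 1]) ->
  trivIset [set: I] (fun i => [set` `]a i, b i[]) ->
  \sum_i (b i - a i) < delta -> \sum_i `|f (b i) - f (a i)| < e.
Proof.
move=> fed ab01 tab sab.
rewrite (reindex (@enum_val I predT)) /=; last first.
  by apply: onW_bij; exact: enum_val_bij.
apply: (fed _ (a \o enum_val) (b \o enum_val)) => //.
- by move=> i; exact: ab01.
- move=> i j _ _ ij; apply: (@enum_val_inj I predT).
  exact: (tab (enum_val i) (enum_val j)).
- rewrite (reindex (@enum_val I predT)) /= in sab => //.
  by apply: onW_bij; exact: enum_val_bij.
Qed.

(** Cutting each interval of a disjoint family into pieces gives a disjoint
    family of the same total length, to which the same delta applies. *)
Lemma ac_modulus_partitions f e delta (I : finType) (a b : I -> R)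
    (s : I -> seq R) :
  ac_modulus f e delta ->
  (forall i, [/\ 0 <= a i, a i <= b i & b i <= 1]) ->
  trivIset [set: I] (fun i => [set` `]a i, b i[]) ->
  \sum_i (b i - a i) < delta ->
  (forall i, itv_partition (a i) (b i) (s i)) ->
  \sum_i variation (a i) (b i) f (s i) < e.
Proof.
move=> fed ab01 tab sab ps.
pose J := {i : I & 'I_(size (s i))}.
pose x (i : I) (j : nat) := nth (b i) (a i :: s i) j.
have xS i j k : (j <= k)%N -> (k <= size (s i))%N -> x i j <= x i k.
  move=> jk ks; rewrite /x.
  have [sa _] := ps i.
  have sle : sorted <=%R (a i :: s i).
    by apply: (@sub_path _ <%R) sa => u v /ltW.
  by apply: (le_sorted_leq_nth (b i) sle) => //; rewrite inE /= ltnS (leq_trans jk).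
have x0 i : x i 0%N = a i by [].
have xe i : x i (size (s i)) = b i.
  by have [_ /eqP <-] := ps i; rewrite /x nth_last /= -nth_last /= nth_last.
pose A (p : J) := x (tag p) (tagged p).
pose B (p : J) := x (tag p) (tagged p).+1.
have bnd (p : J) : [/\ a (tag p) <= A p, A p <= B p & B p <= b (tag p)].
  case: p => i j; rewrite /A /B /=; split.
  - by rewrite -x0; apply: xS => //; exact: ltnW.
  - exact: xS.
  - by rewrite -xe; apply: xS.
have -> : \sum_i variation (a i) (b i) f (s i) =
    \sum_(p : J) `|f (B p) - f (A p)|.
  rewrite (eq_bigr (fun i => \sum_(j < size (s i)) `|f (x i j.+1) - f (x i j)|)).
    by rewrite (sig_big_dep (fun=> true) (fun _ _ => true)
      (fun i (j : 'I_(size (s i))) => `|f (x i j.+1) - f (x i j)|)).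
  by move=> i _; rewrite /variation big_mkord.
apply: (ac_modulus_finType fed) => //.
- move=> p; have [aA AB Bb] := bnd p; have [a0 _ b1] := ab01 (tag p).
  by split; [exact: le_trans aA|exact: AB|exact: le_trans b1].
- move=> [i j] [i' j'] _ _ [z [/=]]; rewrite /A /B /= !in_itv /=.
  move=> /andP[z1 z2] /andP[z3 z4].
  have ii' : i = i'.
    apply: tab => //; exists z; split; rewrite /= in_itv /=.
    + have [/= h1 _ h2] := bnd (Tagged (fun i => 'I_(size (s i))) j).
      by rewrite (le_lt_trans h1)//= (lt_le_trans z2).
    + have [/= h1 _ h2] := bnd (Tagged (fun i => 'I_(size (s i))) j').
      by rewrite (le_lt_trans h1)//= (lt_le_trans z4).
  case: i' / ii' j' z3 z4 => j' z3 z4.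
  congr existT; apply/val_inj/eqP; rewrite eqn_leq; apply/andP; split.
    rewrite leqNgt; apply/negP => jj'.
    have := lt_trans z1 z4; rewrite ltNge => /negP; apply.
    by apply: xS => //; exact: ltnW.
  rewrite leqNgt; apply/negP => jj'.
  have := lt_trans z3 z2; rewrite ltNge => /negP; apply.
  by apply: xS => //; exact: ltnW.
- suff -> : \sum_(p : J) (B p - A p) = \sum_i (b i - a i) by [].
  rewrite -(sig_big_dep (fun=> true) (fun _ _ => true)
      (fun i (j : 'I_(size (s i))) => (x i j.+1) - (x i j))) /=.
  apply: eq_bigr => i _.
  by rewrite -(big_mkord xpredT (fun j => x i j.+1 - x i j)) telescope_sumr// xe x0.
Qed.

(** Passing to the supremum over partitions in all intervals at once weakens the
    strict bound to a weak one. This makes the variation function of f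
    absolutely continuous. *)
Lemma ac_modulus_total_variation f e delta (I : finType) (a b : I -> R) :
  ac_modulus f e delta ->
  (forall i, [/\ 0 <= a i, a i <= b i & b i <= 1]) ->
  trivIset [set: I] (fun i => [set` `]a i, b i[]) ->
  \sum_i (b i - a i) < delta ->
  (\sum_i total_variation (a i) (b i) f <= e%:E)%E.
Proof.
move=> fed ab01 tab sab.
have sP (i : I) : exists s, itv_partition (a i) (b i) s.
  have [_ + _] := ab01 i; rewrite le_eqVlt => /predU1P[->|ab].
    by exists [::].
  by exists [:: b i]; exact: itv_partition1.
have TVfin i : total_variation (a i) (b i) f \is a fin_num.
  have [a0 ab b1] := ab01 i.
  rewrite ge0_fin_numE ?total_variation_ge0//.
  apply: (@le_lt_trans _ _ e%:E); last by rewrite ltry.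
  apply: ge_ereal_sup => _ [_ [s ps <-] <-]; rewrite lee_fin.
  have [s0 s0P] := choice sP.
  pose t j := if j == i then s else s0 j.
  have pt j : itv_partition (a j) (b j) (t j).
    by rewrite /t; case: eqP => [->|_].
  apply/ltW/(le_lt_trans _ (ac_modulus_partitions fed ab01 tab sab pt)).
  rewrite (bigD1 i)//= /t eqxx lerDl sumr_ge0// => j _.
  exact: variation_ge0.
apply/lee_addgt0Pr => eta eta0.
pose h := eta / (#|I|%:R + 1).
have h0 : 0 < h by rewrite divr_gt0// ltr_wpDl.
have : forall i, exists s, itv_partition (a i) (b i) s /\
    (total_variation (a i) (b i) f <= (variation (a i) (b i) f s + h)%:E)%E.
  move=> i; have := TVfin i.
  rewrite /total_variation => /(@ub_ereal_sup_adherent _ _ h h0).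
  move=> [_ [_ [s ps <-] <-]] hs; exists s; split => //.
  rewrite EFinD -leeBlDr//; exact: ltW.
move=> /choice[s hs].
apply: (@le_trans _ _ (\sum_i (variation (a i) (b i) f (s i) + h)%:E)%E).
  by apply: lee_sum => i _; have [] := hs i.
rewrite sumEFin big_split/= sumr_const -EFinD lee_fin lerD//.
  apply/ltW/(ac_modulus_partitions fed ab01 tab sab) => i.
  by have [] := hs i.
rewrite -mulr_natr /h mulrAC ler_pdivrMr; last by rewrite ltr_wpDl.
by rewrite ler_wpM2l// ?ltW// ltrDl.
Qed.

End absolutely_continuous_functions.

Section absolutely_continuous_measures.
Context {R : realType}.
Implicit Types f : R -> R.
Notation lambda := (@lebesgue_measure R).

(** Paths are constrained on [0, 1] only. Composition with [clamp] extends them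
    to the line by constants, so that derivatives and Stieltjes measures on the
    line are available. *)
Definition clamp (x : R) : R := Num.max 0 (Num.min 1 x).

Lemma clamp01 x : 0 <= clamp x <= 1.
Proof. by rewrite /clamp le_max lexx/= ge_max ler01 ge_min lexx. Qed.

Lemma clampK x : 0 <= x <= 1 -> clamp x = x.
Proof. by move=> /andP[x0 x1]; rewrite /clamp (min_r x1) (max_r x0). Qed.

Lemma clamp_le x y : x <= y -> clamp x <= clamp y.
Proof.
move=> xy; rewrite /clamp ge_max le_max lexx /= le_max; apply/orP; right.
by rewrite le_min ge_min lexx/= ge_min xy orbT.
Qed.

Lemma clamp_contract x y : x <= y -> clamp y - clamp x <= y - x.
Proof.
move=> xy; rewrite /clamp; case: (leP 1 x) => ?; case: (leP 1 y) => ?;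
  do 2?[case: (leP 0 _) => ?]; lra.
Qed.

Lemma ac_modulus_step f e delta a b : ac_modulus f e delta ->
  0 <= a -> a <= b -> b <= 1 -> b - a < delta ->
  `|f b - f a| < e /\ (total_variation a b f <= e%:E)%E.
Proof.
move=> fed a0 ab b1 abd.
have A (i : 'I_1) : [/\ 0 <= a, a <= b & b <= 1] by split.
have T : trivIset [set: 'I_1] (fun=> [set` `]a, b[]).
  by move=> i j _ _ _; rewrite !ord1.
have := fed 1%N (fun=> a) (fun=> b) A T; rewrite !big_ord1 => /(_ abd) ?.
split => //.
have := ac_modulus_total_variation fed A T.
by rewrite !big_ord1 => /(_ abd).
Qed.

(** Cut [0, 1] into finitely many intervals shorter than the delta that belongs
    to 1: the variation on each of them is at most 1. *)
Lemma ac_bounded_variation f : absolutely_continuous_fun f ->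
  bounded_variation 0 1 f.
Proof.
move=> /(_ 1 ltr01)[delta delta0 fd].
apply/bounded_variationP => //.
pose n := Num.bound (delta^-1).
have n0 : 0 < n%:R :> R.
  rewrite -(@ltr_pM2l _ delta)// mulr0.
  by rewrite pmulr_rgt0// (le_lt_trans _ (archi_boundP _)) ?invr_ge0// ltW.
have nd : n%:R^-1 < delta.
  rewrite -[ltRHS]invrK ltf_pV2 ?posrE ?invr_gt0//.
  by rewrite archi_boundP ?invr_ge0 ?ltW.
suff H k : (k <= n)%N -> total_variation 0 (k%:R / n%:R) f \is a fin_num.
  by have := H n (leqnn n); rewrite divff ?gt_eqF.
elim: k => [|k ih] kn; first by rewrite mul0r total_variationxx.
have k0 : 0 <= k%:R / n%:R :> R by rewrite divr_ge0 ?ler0n// ltW.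
have kk1 : k%:R / n%:R <= k.+1%:R / n%:R :> R.
  by rewrite ler_pM2r ?invr_gt0// ler_nat.
rewrite (@total_variationD _ _ _ (k%:R / n%:R))// fin_numD ih ?(ltnW kn)//=.
rewrite ge0_fin_numE ?total_variation_ge0//.
have [||_] := @ac_modulus_step f 1 delta _ _ fd k0 kk1.
- by rewrite ler_pdivrMr// mul1r ler_nat.
- by rewrite -mulrBl -natrB// subSnn mul1r.
by move=> /le_lt_trans; apply; rewrite ltry.
Qed.

Lemma ac_clamp_continuous f : absolutely_continuous_fun f ->
  continuous (f \o clamp).
Proof.
move=> acf x; apply/cvgrPdist_lt => e e0.
have [delta delta0 fd] := acf _ e0.
suff H y z : y <= z -> `|y - z| < delta ->
    `|f (clamp y) - f (clamp z)| < e.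
  near=> y.
  have xy : `|x - y| < delta by near: y; apply: cvgr_dist_lt.
  have [/H|/ltW /H yx] := leP x y; first exact.
  by rewrite distrC; apply: yx; rewrite distrC.
move=> yz; rewrite distrC [X in X < e]distrC => yzd.
have [y0 _] := andP (clamp01 y); have [_ z1] := andP (clamp01 z).
apply: (ac_modulus_step fd y0 (clamp_le yz) z1 _).1.
by rewrite (le_lt_trans (clamp_contract yz))// (le_lt_trans (ler_norm _)).
Unshelve. all: by end_near. Qed.

Section stieltjes.
Variable g : cumulative R R.
Hypothesis acg : absolutely_continuous_fun g.
Notation mu := (lebesgue_stieltjes_measure g).

Lemma stieltjes_ocitv a b : a <= b -> mu `]a, b]%classic = (g b - g a)%:E.
Proof.
move=> ab; rewrite /lebesgue_stieltjes_measure /measure_extension.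
rewrite measurable_mu_extE/=; last exact: is_ocitv.
by rewrite wlength_itv_bnd.
Qed.

Let cell n k : set R := `]k%:R / 2 ^+ n, k.+1%:R / 2 ^+ n]%classic.

Let two0 n : 0 < 2 ^+ n :> R. Proof. by rewrite exprn_gt0. Qed.

Let triv_cell n : trivIset [set: nat] (cell n).
Proof.
move=> i j _ _ [x []]; rewrite /cell /= !in_itv/= => /andP[i1 i2] /andP[j1 j2].
have h a b : a%:R / 2 ^+ n < x -> x <= b.+1%:R / 2 ^+ n -> (a <= b)%N.
  move=> h1 h2; have := lt_le_trans h1 h2.
  by rewrite ltr_pM2r ?invr_gt0// ltr_nat.
by apply/eqP; rewrite eqn_leq !h.
Qed.

Let cell_point n x : 0 < x -> x <= 1 -> exists2 k, (k < 2 ^ n)%N & cell n k x.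
Proof.
move=> x0 x1; have xn0 : 0 < x * 2 ^+ n by rewrite mulr_gt0.
have [|m xm mmin] := @ex_minnP (fun m => x * 2 ^+ n <= m%:R).
  by exists (Num.bound (x * 2 ^+ n)); rewrite ltW// archi_boundP// ltW.
case: m xm mmin => [|k] xm mmin; first by rewrite leNgt xn0 in xm.
have kx : k%:R < x * 2 ^+ n.
  by rewrite ltNge; apply/negP => /mmin; rewrite ltnn.
exists k.
  by rewrite -(ltr_nat R) natrX (lt_le_trans kx)// ler_piMl// ltW.
by rewrite /cell /= in_itv/= ltr_pdivrMr// ler_pdivlMr// kx.
Qed.

(** A null set lies in an open set U of length less than delta. Finitely many
    dyadic cells inside U have total length less than delta, hence Stieltjes
    mass at most e, and these finite unions exhaust U within ]0, 1] as the cells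
    get finer. *)
Lemma ac_stieltjes_dominates (N : set R) : measurable N ->
  lambda N = 0%E -> mu (N `&` `]0, 1]%classic) = 0%E.
Proof.
move=> mN N0; apply/eqP; rewrite eq_le measure_ge0 andbT.
apply/lee_addgt0Pr => e e0; rewrite add0e.
have [delta delta0 gd] := acg e0.
have [] := @lebesgue_regularity_outer _ N _ mN _ delta0.
  by rewrite [X in (X < _)%E]N0.
move=> U [oU NU ltU].
have Ud : (lambda U < delta%:E)%E.
  apply: le_lt_trans ltU.
  have UE : U = (U `\` N) `|` N by rewrite setUC setDUK.
  rewrite {1}UE (le_trans (measureU2 _ _ _))//.
    by apply: measurableD => //; exact: open_measurable.
  by rewrite [X in (_ + X)%E]N0 adde0.
pose V n := \bigcup_(k in [set k | (k < 2 ^ n)%N /\ cell n k `<=` U]) cell n k.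
have mcell n k : measurable (cell n k) by exact: measurable_itv.
have mV n : measurable (V n).
  by apply: bigcup_measurable => k _.
have VU n : V n `<=` U by move=> x [k [_ kU]] /kU.
have ndV : nondecreasing_seq V.
  apply/nondecreasing_seqP => n; apply/subsetPset => x [k [kn kU]].
  have := two0 n; have := two0 n.+1; rewrite exprS => H1 H2.
  rewrite /cell /= in_itv/= ltr_pdivrMr// ler_pdivlMr// => /andP[x1 x2].
  have dbl (m : nat) : (2 * m)%:R / (2 * 2 ^+ n) = m%:R / 2 ^+ n :> R.
    by rewrite natrM -mulf_div divff// mul1r.
  have [xm|xm] := leP x ((2 * k + 1)%:R / (2 ^+ n.+1)).
    exists (2 * k)%N; last first.
      rewrite /cell /= in_itv /= -[(2 * k).+1]addn1 xm andbT.
      by rewrite exprS dbl ltr_pdivrMr.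
    split; first by rewrite expnS ltn_pmul2l.
    apply: (subset_trans _ kU); rewrite /cell exprS; apply: subset_itv.
      by rewrite bnd_simp dbl.
    rewrite bnd_simp -(dbl k.+1) ler_pM2r ?invr_gt0// ler_nat.
    by rewrite mulnS -add1n leq_add2r.
  exists (2 * k).+1%N; last first.
    rewrite /cell /= in_itv /= -[(2 * k).+1]addn1 xm /=.
    rewrite exprS addn1 -[(2 * k).+2]/(2 + 2 * k)%N -mulnS dbl.
    by rewrite ler_pdivlMr.
  split.
    by rewrite expnS -[leqLHS]/(2 + 2 * k)%N -mulnS leq_mul2l.
  apply: (subset_trans _ kU); rewrite /cell exprS; apply: subset_itv.
    by rewrite bnd_simp -(dbl k) ler_pM2r ?invr_gt0// ler_nat.
  by rewrite bnd_simp -[(2 * k).+2]/(2 + 2 * k)%N -mulnS dbl.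
have Vmu n : (mu (V n) <= e%:E)%E.
  pose A (k : nat) := k%:R / 2 ^+ n : R.
  (* Cells that stick out of U are replaced by empty intervals, so that the sum
     extends over the whole level. *)
  pose B (k : nat) := if `[< cell n k `<=` U >]
    then k.+1%:R / 2 ^+ n else A k : R.
  have AB k : A k <= B k.
    rewrite /B; case: asboolP => // _.
    by rewrite /A ler_pM2r ?invr_gt0// ler_nat.
  have ABcell k : `]A k, B k]%classic `<=` cell n k.
    rewrite /B; case: asboolP => [_|_]; first exact: subset_refl.
    by rewrite set_itvE; exact: sub0set.
  have cellV : V n = \big[setU/set0]_(k < 2 ^ n) `]A k, B k]%classic.
    rewrite -(bigcup_mkord _ (fun k => `]A k, B k]%classic)).
    apply/seteqP; split => x [k].
      move=> [kn kU] xk; exists k => //.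
      by rewrite /A /B /= asboolT.
    move=> kn; rewrite /B /=; case: asboolP => [kU xk|_].
      by exists k => //; split.
    by rewrite in_itv/= => /andP[/lt_le_trans h /h]; rewrite ltxx.
  have tAB : trivIset [set: 'I_(2 ^ n)] (fun k : 'I_(2 ^ n) => `]A k, B k]%classic).
    move=> i j _ _ [x [xi xj]]; apply/val_inj/(@triv_cell n) => //.
    by exists x; split; exact: ABcell.
  have mAB k : measurable (`]A k, B k]%classic : set R).
    exact: measurable_itv.
  rewrite cellV measure_bigsetU_ord//=.
  rewrite (eq_bigr (fun k : 'I_(2 ^ n) => (g (B k) - g (A k))%:E)); last first.
    by move=> k _; exact: stieltjes_ocitv.
  rewrite sumEFin lee_fin.
  apply: (@le_trans _ _ (\sum_(k < 2 ^ n) `|g (B k) - g (A k)|)).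
    by apply: ler_sum => k _; exact: ler_norm.
  apply/ltW/(gd _ (fun k : 'I_(2 ^ n) => A k) (fun k : 'I_(2 ^ n) => B k)).
  - move=> k; split => //; first by rewrite divr_ge0// ltW.
    rewrite /B /A; case: ifPn => _; rewrite ler_pdivrMr// mul1r -natrX ler_nat//.
    exact: ltnW.
  - move=> i j _ _ [x [xi xj]]; apply: tAB => //.
    by exists x; split; exact: subset_itv_oo_oc.
  - rewrite -lte_fin; apply: le_lt_trans Ud.
    apply: (@le_trans _ _ (lambda (V n))); last first.
      apply: (@le_measure _ _ _ lambda); [rewrite inE| rewrite inE|exact: VU].
        exact: mV.
      exact: open_measurable.
    rewrite cellV (@measure_bigsetU_ord _ _ _ lambda)//= -sumEFin.
    apply: lee_sum => k _; rewrite lebesgue_measure_itv/= lte_fin.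
    case: ifPn => [_|]; first by rewrite EFinB.
    by rewrite -leNgt => BA; rewrite lee_fin subr_le0.
apply: (@le_trans _ _ (mu (\bigcup_n V n))).
  apply: le_measure.
  - by rewrite inE; apply: measurableI; [exact: mN|exact: measurable_itv].
  - by rewrite inE; apply: bigcup_measurable => n _; exact: mV.
  move=> x [/NU Ux]; rewrite /= in_itv/= => /andP[x0 x1].
  have /nbhs_ballP[r /= r0 xr] := open_nbhs_nbhs (conj oU Ux).
  pose n := Num.bound r^-1.
  have nr : (2 ^+ n)^-1 < r.
    rewrite -[ltRHS]invrK ltf_pV2 ?posrE ?invr_gt0//.
    rewrite (lt_trans (archi_boundP _)) ?invr_ge0 ?ltW// -natrX ltr_nat.
    exact: ltn_expl.
  have [k kn xk] := cell_point n x0 x1.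
  exists n => //; exists k => //; split => // y yk; apply: xr.
  rewrite /ball/=; apply: le_lt_trans nr.
  move: xk yk; rewrite /cell /= !in_itv/= -(natr1 k) mulrDl mul1r.
  by move=> /andP[? ?] /andP[? ?]; rewrite ler_norml; apply/andP; split; lra.
have cvgV : mu (V n) @[n --> \oo] --> mu (\bigcup_n V n).
  apply: nondecreasing_cvg_mu => //; by apply: bigcup_measurable => n _; exact: mV.
rewrite -(cvg_lim _ cvgV)//; apply: lime_le; first by apply/cvg_ex; eexists; exact: cvgV.
by apply: nearW.
Qed.

End stieltjes.

End absolutely_continuous_measures.

Section absolutely_continuous_densities.
Context {R : realType}.
Implicit Types f : R -> R.
Notation lambda := (@lebesgue_measure R).

(** Radon-Nikodym for the Stieltjes measure restricted to ]0, 1]. *)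
Lemma ac_stieltjes_density (g : cumulative R R) :
  absolutely_continuous_fun g ->
  exists2 h : R -> R, lambda.-integrable setT (EFin \o h) &
    forall x, g (clamp x) - g 0 = \int[lambda]_(t in `]-oo, x]) h t.
Proof.
move=> acg.
pose mu := lebesgue_stieltjes_measure g.
have mD : measurable (`]0, 1]%classic : set (measurableTypeR R)).
  exact: measurable_itv.
have moo : (mu (`]0%R, 1%R]%classic : set R) < +oo)%E.
  by rewrite /mu stieltjes_ocitv// ltry.
pose nu0 : {finite_measure set (measurableTypeR R) -> \bar R} := mfrestr mD moo.
pose nu := charge_of_finite_measure nu0.
have nul : nu `<< lambda.
  apply/null_content_dominatesP => N mN N0.
  rewrite /nu /= /charge_of_finite_measure /mfrestr /mrestr /=.
  exact: ac_stieltjes_dominates.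
have fin := fun x => Radon_Nikodym_fin_num x nul.
pose h := fine \o Radon_Nikodym nu lambda.
have hE : EFin \o h = Radon_Nikodym nu lambda.
  by apply/funext => x /=; rewrite fineK.
exists h; first by rewrite hE; exact: Radon_Nikodym_integrable.
move=> x; rewrite /Rintegral -[RHS]/(fine (\int[lambda]_(t in _) (EFin \o h) t)).
rewrite hE -Radon_Nikodym_integral//.
rewrite /nu /charge_of_finite_measure /nu0 /mfrestr /mrestr /=.
transitivity (fine (mu (`]0%R, clamp x]%classic : set R))).
  by rewrite /mu stieltjes_ocitv//; have /andP[] := clamp01 x.
congr (fine (mu _)); apply/esym.
apply/seteqP; split => y /=; rewrite !in_itv/= /clamp le_max le_min.
  by move=> [-> /andP[-> ->]]; rewrite orbT.
by move=> /andP[y0]; rewrite leNgt y0/= => /andP[-> ->].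
Qed.

(** Jordan decomposition: f = (f + W) - W with W the variation function of f.
    Both parts are nondecreasing and absolutely continuous, so that their
    Stieltjes measures have densities. *)
Lemma ac_density f : absolutely_continuous_fun f ->
  exists2 h : R -> R, lambda.-integrable setT (EFin \o h) &
    forall x, f (clamp x) - f 0 = \int[lambda]_(t in `]-oo, x]) h t.
Proof.
move=> acf.
have BVf := ac_bounded_variation acf.
have TVfin a b : 0 <= a -> a <= b -> b <= 1 -> total_variation a b f \is a fin_num.
  move=> a0 ab b1; apply/bounded_variationP => //.
  apply: (@bounded_variationr _ 0) => //.
  by apply: (@bounded_variationl _ 0 _ 1) => //; exact: le_trans ab.
pose W x := fine (total_variation 0 (clamp x) f).
have WE a b : 0 <= a -> a <= b -> b <= 1 ->
    W b - W a = fine (total_variation a b f).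
  move=> a0 ab b1; have b0 := le_trans a0 ab; have a1 := le_trans ab b1.
  rewrite /W !clampK ?a0 ?b0//.
  by rewrite (total_variationD _ a0 ab) fineD ?TVfin// addrAC subrr add0r.
have acW : absolutely_continuous_fun W.
  move=> e e0; have e20 : 0 < e / 2 by rewrite divr_gt0.
  have [delta delta0 fd] := acf _ e20; exists delta => // k a b ab01 tab sab.
  apply: (@le_lt_trans _ _ (e / 2)); last by rewrite ltr_pdivrMr// ltr_pMr// ltr1n.
  rewrite -lee_fin -sumEFin.
  apply: le_trans (ac_modulus_total_variation fd ab01 tab sab).
  apply: lee_sum => i _; have [a0 ab b1] := ab01 i.
  rewrite WE// ger0_norm ?fineK ?TVfin//.
  by rewrite fine_ge0// total_variation_ge0.
have Wcl : W \o clamp = W.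
  by apply/funext => x; rewrite /W /= (clampK (clamp01 x)).
have ndW : nondecreasing W.
  move=> x y xy; rewrite -Wcl /= -subr_ge0.
  have /andP[x0 _] := clamp01 x; have /andP[_ y1] := clamp01 y.
  by rewrite WE ?clamp_le// fine_ge0// total_variation_ge0 ?clamp_le.
have rcW : right_continuous W.
  by apply: right_continuousW; rewrite -Wcl; exact: ac_clamp_continuous.
pose Wc : cumulative R R := HB.pack W (isCumulative.Build _ _ _ W ndW rcW).
pose G x := f (clamp x) + W x.
have Gcl : G \o clamp = G.
  by apply/funext => x; rewrite /G /= -[in RHS]Wcl /= (clampK (clamp01 x)).
have acG : absolutely_continuous_fun G.
  move=> e e0; have e20 : 0 < e / 2 by rewrite divr_gt0.
  have [d1 d10 fd1] := acf _ e20; have [d2 d20 Wd2] := acW _ e20.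
  exists (Num.min d1 d2); first by rewrite lt_min d10.
  move=> k a b ab01 tab; rewrite lt_min => /andP[s1 s2].
  rewrite (splitr e); apply: le_lt_trans (ltrD (fd1 _ _ _ ab01 tab s1) (Wd2 _ _ _ ab01 tab s2)).
  rewrite -big_split/=; apply: ler_sum => i _.
  have [a0 ab b1] := ab01 i; rewrite /G !clampK ?a0 ?(le_trans a0)//; last first.
    by rewrite (le_trans ab).
  by rewrite opprD addrACA ler_normD.
have ndG : nondecreasing G.
  move=> x y xy; rewrite -subr_ge0 /G -Wcl /= opprD addrACA.
  have /andP[x0 _] := clamp01 x; have /andP[_ y1] := clamp01 y.
  have xy' := clamp_le xy.
  rewrite WE// -lerBlDr sub0r lerNl.
  rewrite -lee_fin fineK ?TVfin//.
  apply: le_trans (total_variation_ge f xy').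
  by rewrite lee_fin -normrN ler_norm.
have rcG : right_continuous G.
  by apply: right_continuousW; rewrite -Gcl; exact: ac_clamp_continuous.
pose Gc : cumulative R R := HB.pack G (isCumulative.Build _ _ _ G ndG rcG).
have [h1 ih1 h1E] := @ac_stieltjes_density Gc acG.
have [h2 ih2 h2E] := @ac_stieltjes_density Wc acW.
have iS x h : lambda.-integrable setT (EFin \o h) ->
    lambda.-integrable `]-oo, x]%classic (EFin \o h).
  by move=> ih; apply: integrableS ih => //.
exists (h1 \- h2).
  rewrite (_ : EFin \o _ = (EFin \o h1) \- (EFin \o h2))%E//.
  exact: integrableB.
move=> x; rewrite RintegralB//; [|exact: iS|exact: iS].
rewrite -h1E -h2E /= /G /= !(clampK (clamp01 x)) (clampK (x := 0)) ?lexx ?ler01//.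
by rewrite -[W 0]/(W 0); ring.
Qed.

(** Lebesgue differentiation of the indefinite integral of the density. *)
Lemma ac_clamp_derivable f : absolutely_continuous_fun f ->
  exists2 h : R -> R, lambda.-integrable setT (EFin \o h) &
    (forall x, f (clamp x) - f 0 = \int[lambda]_(t in `]-oo, x]) h t) /\
    {ae lambda, forall x, derivable (f \o clamp) x 1 /\
                          derive1 (f \o clamp) x = h x}.
Proof.
move=> /ac_density[h ih hE]; exists h => //; split => //.
have iS x : lambda.-integrable `]-oo, x]%classic (EFin \o h).
  by apply: integrableS ih => //.
have lh : locally_integrable [set: R] h.
  by apply: open_integrable_locally => //; exact: openT.
have := FTC1Ny iS lh; apply: filterS.
  exact: (ae_filter_ringOfSetsType lambda).
move=> x.
have -> : (fun x => \int[lambda]_(t in `]-oo, x]) h t) = (f \o clamp) \- cst (f 0).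
  by apply/funext => y /=; rewrite -hE.
move=> [dF F'].
have -> : f \o clamp = (f \o clamp \- cst (f 0)) + cst (f 0).
  by apply/funext => y; rewrite /= !fctE /= subrK.
split; first exact: derivableD.
by rewrite derive1E deriveD// -derive1E F' derive_cst addr0.
Qed.

End absolutely_continuous_densities.

(** * Speed and length of absolutely continuous paths *)

Section path_coordinates.
Context {R : realType}.
Notation lambda := (@lebesgue_measure R).
Variables (m : nat) (f : R -> 'rV[R]_m).
Hypothesis acf : absolutely_continuous_path f.

Lemma path_dot_ac (v : 'rV[R]_m) :
  absolutely_continuous_fun (fun t => \sum_i v 0 i * f t 0 i).
Proof.
move=> e e0; have v0 : 0 < enorm v + 1 by rewrite ltr_wpDl ?enorm_ge0.
have [delta delta0 H] := acf (divr_gt0 e0 v0); exists delta => //.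
move=> k a b ab tab sab; have := H k a b ab tab sab.
rewrite ltr_pdivlMr//; apply: le_lt_trans.
rewrite mulr_suml; apply: ler_sum => i _.
rewrite -sumrB ler_norml; apply/andP; split.
  rewrite lerNl -sumrN; apply: (@le_trans _ _ (enorm v * enorm (f (a i) - f (b i)))).
    apply: le_trans (dot_le_enorm _ _); apply: ler_sum => j _.
    by rewrite !mxE mulrBr opprB.
  by rewrite enormB mulrC ler_wpM2l ?enorm_ge0// lerDl.
apply: (@le_trans _ _ (enorm v * enorm (f (b i) - f (a i)))).
  apply: le_trans (dot_le_enorm _ _); apply: ler_sum => j _.
  by rewrite !mxE mulrBr.
by rewrite mulrC ler_wpM2l ?enorm_ge0// lerDl.
Qed.

Lemma path_coord_ac i : absolutely_continuous_fun (fun t => f t 0 i).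
Proof.
have := path_dot_ac (delta_mx 0 i); congr absolutely_continuous_fun.
apply/funext => t; rewrite (bigD1 i)//= mxE !eqxx mul1r big1 ?addr0// => j ji.
by rewrite mxE (negPf ji) andbF mul0r.
Qed.

(** Differentiability by coordinates and of the clamped path is what the scalar
    theory provides directly. *)
Definition coord_derivable t :=
  forall i, derivable (fun s => f (clamp s) 0 i) t 1.

Lemma path_derivable_ae : {ae lambda, forall t, coord_derivable t}.
Proof.
have FF := ae_filter_ringOfSetsType lambda.
apply: (@filter_forall _ _ _ _ FF) => i.
have [h _ [_]] := ac_clamp_derivable (path_coord_ac i).
by apply: (@filterS _ _ FF) => t [].
Qed.

End path_coordinates.

Section paths_derive.
Context {R : realType}.
Notation lambda := (@lebesgue_measure R).
Variables (m : nat) (f : R -> 'rV[R]_m).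

Lemma near_clamp (t : R) : 0 < t < 1 -> \forall s \near t, clamp s = s.
Proof.
move=> /andP[t0 t1]; near=> s; apply: clampK; apply/andP; split; apply: ltW.
  by near: s; exact: lt_nbhsr.
by near: s; exact: lt_nbhsl.
Unshelve. all: by end_near. Qed.

Lemma derive1_clamp_coord t : 0 < t < 1 -> coord_derivable f t ->
  derive1 f t = \row_i derive1 (fun s => f (clamp s) 0 i) t.
Proof.
move=> t01 df; rewrite derive1E.
have /derive_mx H : derivable (f \o clamp) t 1.
  apply/derivable_mxP => i j; rewrite (ord1 i); exact: df.
rewrite (@near_eq_derive _ _ _ _ (f \o clamp)) ?oner_neq0//; last first.
  have := near_clamp t01; apply: filterS => s /= sE; by rewrite sE.
rewrite H; apply/rowP => i; rewrite !mxE derive1E//.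
Qed.

End paths_derive.

Section path_length.
Context {R : realType}.
Notation lambda := (@lebesgue_measure R).

(** Let v be the unit vector along the chord. The scalar function v . f is
    absolutely continuous, its increment is the length of the chord, and its
    derivative is at most the speed. The speed enters through a function g that
    only has to agree with it at times of differentiability, so that g can be
    chosen measurable jointly in particle and time. *)
Lemma path_length_ge m (f : R -> 'rV[R]_m) (g : R -> R) (a b : R) :
  absolutely_continuous_path f -> 0 <= a -> a <= b -> b <= 1 ->
  measurable_fun `]a, b[ g -> (forall t, 0 <= g t) ->
  (forall t, a < t < b -> coord_derivable f t -> g t = enorm (derive1 f t)) ->
  ((enorm (f b - f a))%:E <= \int[lambda]_(t in `]a, b[) (g t)%:E)%E.
Proof.
move=> acf a0 ab b1 mg g0 gE.
have [->|fab] := eqVneq (enorm (f b - f a)) 0.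
  by apply: integral_ge0 => t _; rewrite lee_fin.
have fabgt0 : 0 < enorm (f b - f a) by rewrite lt0r fab enorm_ge0.
pose v : 'rV[R]_m := (enorm (f b - f a))^-1 *: (f b - f a).
have v1 : enorm v = 1.
  by rewrite enormZ gtr0_norm ?invr_gt0// mulVf.
pose phi t := \sum_i v 0 i * f t 0 i.
have acphi : absolutely_continuous_fun phi by exact: path_dot_ac.
have [h ih [hE dphi]] := ac_clamp_derivable acphi.
have phiab : enorm (f b - f a) = phi b - phi a.
  rewrite /phi -sumrB.
  transitivity ((enorm (f b - f a))^-1 * enorm (f b - f a) ^+ 2).
    by rewrite expr2 mulrA mulVf// mul1r.
  rewrite sqr_enorm mulr_sumr; apply: eq_bigr => i _.
  by rewrite -mulrBr !mxE -mulrA -expr2.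
have iS (A : set R) : measurable A -> lambda.-integrable A (EFin \o h).
  by move=> mA; apply: integrableS ih => //.
have phih : phi b - phi a = \int[lambda]_(t in `]a, b[) h t.
  have := hE b; have := hE a.
  rewrite !clampK ?a0 ?b1 ?andbT ?(le_trans ab)// ?(le_trans a0)//.
  move=> ha hb; have -> : phi b - phi a = (phi b - phi 0) - (phi a - phi 0).
    by rewrite opprB addrA subrK.
  rewrite ha hb Rintegral_itvB//; [|exact: iS].
  by rewrite -Rintegral_itv_bndo_bndc//; exact: iS.
rewrite phiab phih.
rewrite /Rintegral fineK; last first.
  by apply: integrable_fin_num => //; exact: iS.
have mab : measurable (`]a, b[%classic : set R) by [].
have mh : measurable_fun `]a, b[ (EFin \o h).
  by have /integrableP[] := iS _ mab.
apply: le_trans (lee_abs _) _.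
apply: le_trans (le_abse_integral lambda mab mh) _.
apply: ae_ge0_le_integral => //.
- by apply: measurableT_comp.
- by move=> t _; rewrite lee_fin.
- exact/measurable_EFinP.
have FF := ae_filter_ringOfSetsType lambda.
apply: (@filterS2 _ _ FF _ _ _ _ dphi (path_derivable_ae acf)).
move=> t [dphit phit] dft; rewrite /= in_itv/= => tab.
have t01 : 0 < t < 1.
  by move: tab => /andP[? ?]; rewrite (le_lt_trans a0)//= (lt_le_trans _ b1).
rewrite lee_fin gE// -phit derive1_clamp_coord//.
set w := \row_i _.
have -> : derive1 (phi \o clamp) t = \sum_i v 0 i * w 0 i.
  rewrite derive1E (_ : phi \o clamp =
    \sum_i (v 0 i *: (fun s => f (clamp s) 0 i))); last first.
    by apply/funext => s; rewrite fct_sumE.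
  rewrite derive_sum; last by move=> i; apply: derivableZ; exact: dft.
  apply: eq_bigr => i _; rewrite deriveZ; last exact: dft.
  by rewrite /w mxE derive1E.
rewrite ler_norml -{1 2}[enorm w]mul1r -v1; apply/andP; split.
  rewrite lerNl -sumrN -enormN; apply: le_trans (dot_le_enorm _ _).
  by apply: ler_sum => i _; rewrite !mxE mulNr.
exact: dot_le_enorm.
Qed.

End path_length.

(** * Hausdorff outer measure *)

Section hausdorff_outer_measure.
Context {R : realType}.
Local Open Scope ereal_scope.

Lemma unit_ball_volume_ge0 r : (0 <= unit_ball_volume r :> R)%R.
Proof.
suff : ((0 <= unit_ball_volume r :> R) /\ (0 <= unit_ball_volume r.+1 :> R))%R by case.
elim: r => [|r [ih1 ih2]]; first by split => /=; rewrite ?ler01 ?ler0n.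
split => //=; rewrite mulr_ge0 ?divr_ge0 ?ler0n// mulr_ge0// pi_ge0//.
Qed.

Lemma diam_ge0 m (U : set 'rV[R]_m) : U !=set0 -> 0 <= diam U.
Proof.
move=> [x Ux]; apply: ereal_sup_ubound; exists (x, x) => //=.
by rewrite subrr enorm0.
Qed.

Lemma hausdorff_weight_ge0 r m (U : set 'rV[R]_m) : 0 <= hausdorff_weight r U.
Proof.
rewrite /hausdorff_weight; case: eqVneq => // /set0P U0.
by rewrite mule_ge0 ?expe_ge0 ?diam_ge0// lee_fin divr_ge0 ?unit_ball_volume_ge0.
Qed.

Lemma hausdorff_premeasure_ge0 r delta m (E : set 'rV[R]_m) :
  0 <= hausdorff_premeasure r delta E.
Proof.
apply: le_ereal_inf_tmp => _ [U _ <-]; apply: nneseries_ge0 => i _ _.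
exact: hausdorff_weight_ge0.
Qed.

Lemma hausdorff_ge_premeasure r delta m (E : set 'rV[R]_m) : (0 < delta)%R ->
  hausdorff_premeasure r delta E <= hausdorff r E.
Proof.
by move=> d0; apply: ereal_sup_ubound; exists delta => //=; rewrite in_itv/= d0.
Qed.

Lemma hausdorff_ge0 r m (E : set 'rV[R]_m) : 0 <= hausdorff r E.
Proof.
by apply: le_trans (hausdorff_ge_premeasure r E ltr01); exact: hausdorff_premeasure_ge0.
Qed.

Lemma lee_expe (x y : \bar R) n : 0 <= x -> x <= y -> x ^+ n <= y ^+ n.
Proof.
move=> x0 xy; elim: n => [//|n ih].
by rewrite !expeS lee_pmul// expe_ge0.
Qed.

Lemma expeMn (x y : \bar R) n : (x * y) ^+ n = x ^+ n * y ^+ n.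
Proof.
by elim: n => [|n ih]; rewrite ?expe0 ?mule1// !expeS ih muleACA.
Qed.

Section lipschitz.
Variables (m p : nat) (phi : 'rV[R]_m -> 'rV[R]_p) (S : set 'rV[R]_m) (L : R).
Hypotheses (L0 : (0 < L)%R)
  (lip : forall x y, S x -> S y -> (enorm (phi x - phi y) <= L * enorm (x - y))%R).

Lemma diam_lipschitz U : diam (phi @` (U `&` S)) <= L%:E * diam U.
Proof.
apply: ge_ereal_sup => _ [[_ _] [/= [x [Ux Sx] <-] [y [Uy Sy] <-]] <-].
apply: (@le_trans _ _ (L%:E * (enorm (x - y))%:E)).
  by rewrite -EFinM lee_fin lip.
apply: lee_wpmul2l; first by rewrite lee_fin ltW.
by apply: ereal_sup_ubound; exists (x, y).
Qed.

Lemma hausdorff_weight_lipschitz r U :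
  hausdorff_weight r (phi @` (U `&` S)) <= (L ^+ r)%:E * hausdorff_weight r U.
Proof.
have L1 : 0 <= (L ^+ r)%:E by rewrite lee_fin exprn_ge0// ltW.
rewrite {1}/hausdorff_weight; case: eqVneq => [_|/set0P].
  by rewrite mule_ge0// hausdorff_weight_ge0.
move=> US; have [_ [x [Ux _] _]] := US.
have U0 : U != set0 by apply/set0P; exists x.
rewrite /hausdorff_weight (negPf U0) muleCA; apply: lee_wpmul2l.
  by rewrite lee_fin divr_ge0 ?unit_ball_volume_ge0// exprn_ge0.
rewrite EFin_expe -expeMn; apply: lee_expe; first exact: diam_ge0.
exact: diam_lipschitz.
Qed.

(** If the U i cover S, then the images of the U i `&` S cover the image of S,
    with diameters multiplied by at most L. *)
Lemma hausdorff_lipschitz r : hausdorff r (phi @` S) <= (L ^+ r)%:E * hausdorff r S.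
Proof.
have L1 : (0 < L ^+ r)%R by rewrite exprn_gt0.
apply: ge_ereal_sup => _ [delta /= + <-]; rewrite in_itv/= andbT => d0.
have dL : (0 < delta / L)%R by rewrite divr_gt0.
apply: (@le_trans _ _ ((L ^+ r)%:E * hausdorff_premeasure r (delta / L) S)); last first.
  apply: lee_wpmul2l; first by rewrite lee_fin ltW.
  exact: hausdorff_ge_premeasure.
rewrite -lee_pdivrMl//; apply: le_ereal_inf_tmp => _ [U [SU dU] <-].
rewrite lee_pdivrMl// -nneseriesZl; last by move=> i _; exact: hausdorff_weight_ge0.
apply: (@le_trans _ _ (\sum_(i <oo) hausdorff_weight r (phi @` (U i `&` S)))).
  apply: ereal_inf_lbound; exists (fun i => phi @` (U i `&` S)) => //; split.
    move=> _ [x Sx <-]; have [i _ Uix] := SU _ Sx; exists i => //.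
    by exists x.
  move=> i; apply: le_trans (diam_lipschitz _) _.
  by rewrite -lee_pdivlMl// -EFinM mulrC dU.
apply: lee_nneseries => i _; first by move=> _; exact: hausdorff_weight_ge0.
exact: hausdorff_weight_lipschitz.
Qed.

End lipschitz.

Lemma le_hausdorff r m (E F : set 'rV[R]_m) : E `<=` F ->
  hausdorff r E <= hausdorff r F.
Proof.
move=> EF; apply: ge_ereal_sup => _ [delta /= + <-].
rewrite in_itv/= andbT => d0; apply: le_trans (hausdorff_ge_premeasure r F d0).
apply: le_ereal_inf_tmp => _ [U [FU dU] <-]; apply: ereal_inf_lbound.
by exists U => //; split => //; exact: subset_trans EF _.
Qed.

Section subadditive.
Variables (r m : nat).

(** On the sigma-algebra of all sets, the premeasure is the outer measure
    generated by a set function: the weight, made infinite on sets of large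
    diameter. Countable subadditivity of generated outer measures then carries
    over. *)
Let D := g_sigma_algebraType [set: set 'rV[R]_m].

Let w (delta : R) (U : set D) : \bar R :=
  if diam (U : set 'rV[R]_m) <= delta%:E
  then hausdorff_weight r (U : set 'rV[R]_m) else +oo.

Let w_ge0 delta U : 0 <= w delta U.
Proof. by rewrite /w; case: ifPn => // _; exact: hausdorff_weight_ge0. Qed.

Let premeasureE delta E : hausdorff_premeasure r delta E = ((w delta)^*)%mu E.
Proof.
apply/eqP; rewrite eq_le; apply/andP; split; apply: le_ereal_inf_tmp => /=.
  move=> _ [U [_ EU] <-].
  have [dU|] := pselect (forall i, diam (U i : set 'rV[R]_m) <= delta%:E).
    apply: ereal_inf_lbound; exists U => //.
    by apply: eq_eseriesr => i _; rewrite /w dU.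
  move=> /existsNP[i /negP dU].
  rewrite (@nneseries_pinfty _ _ xpredT i) ?leey//.
  by rewrite /w (negPf dU).
move=> _ [U [EU dU] <-]; apply: ereal_inf_lbound; exists U => //.
  by split => // i; exact: sub_sigma_algebra.
by apply: eq_eseriesr => i _; rewrite /w dU.
Qed.

Lemma hausdorff_sigma_subadditive (A : (set 'rV[R]_m)^nat) :
  hausdorff r (\bigcup_i A i) <= \sum_(i <oo) hausdorff r (A i).
Proof.
apply: ge_ereal_sup => _ [delta /= + <-]; rewrite in_itv/= andbT => d0.
rewrite premeasureE; apply: le_trans (mu_ext_sigma_subadditive (w_ge0 delta) A) _.
apply: lee_nneseries => i _; first by move=> _; exact: mu_ext_ge0.
by rewrite -premeasureE hausdorff_ge_premeasure.
Qed.

Lemma hausdorff0 : hausdorff r (set0 : set 'rV[R]_m) = 0.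
Proof.
apply/eqP; rewrite eq_le hausdorff_ge0 andbT.
apply: ge_ereal_sup => _ [delta /= + <-]; rewrite in_itv/= andbT => d0.
apply: ereal_inf_lbound; exists (fun=> set0); first split => // i.
  apply: ge_ereal_sup => _ [[x y] [/= []]].
by rewrite eseries0// => i _ _; rewrite /hausdorff_weight eqxx.
Qed.

Lemma hausdorffU2 (A B : set 'rV[R]_m) :
  hausdorff r (A `|` B) <= hausdorff r A + hausdorff r B.
Proof.
rewrite -bigcup2E; apply: le_trans (hausdorff_sigma_subadditive _) _.
rewrite (nneseries_split 0 2)//; last by move=> k _; exact: hausdorff_ge0.
rewrite eseries0 ?adde0; last first.
  by move=> [|[|k]]// _ _; rewrite /bigcup2/= hausdorff0.
by rewrite big_mkord !big_ord_recr/= big_ord0 add0e.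
Qed.

End subadditive.

Section isometry.
Variables (m p : nat) (phi : 'rV[R]_m -> 'rV[R]_p).
Hypothesis iso : forall x y, enorm (phi x - phi y) = enorm (x - y).

(** An isometry and its inverse on the image are both 1-Lipschitz. *)
Lemma hausdorff_isometry r (S : set 'rV[R]_m) :
  hausdorff r (phi @` S) = hausdorff r S.
Proof.
have phiI : injective phi.
  move=> x y xy; apply/eqP; rewrite -subr_eq0; apply/eqP/enorm_eq0.
  by rewrite -iso xy subrr enorm0.
have [->|/set0P[x0 Sx0]] := eqVneq S set0; first by rewrite image_set0 !hausdorff0.
apply/eqP; rewrite eq_le; apply/andP; split.
  rewrite -[leRHS]mul1e -[X in X%:E * _](expr1n _ r).
  by apply: (hausdorff_lipschitz ltr01) => x y _ _; rewrite iso mul1r.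
pose psi y := xget x0 [set x | phi x = y].
have psiK x : psi (phi x) = x.
  rewrite /psi; case: xgetP => [y _ /phiI //|/(_ x)/= h].
  by exfalso; apply: h.
have {1}-> : S = psi @` (phi @` S).
  rewrite image_comp; apply/seteqP; split => [x Sx|_ [x Sx <-]].
    by exists x => //=; rewrite psiK.
  by rewrite /= psiK.
rewrite -[leRHS]mul1e -[X in X%:E * _](expr1n _ r).
apply: (hausdorff_lipschitz ltr01) => _ _ [x Sx <-] [y Sy <-].
by rewrite !psiK mul1r iso.
Qed.

End isometry.

End hausdorff_outer_measure.

(** * Hausdorff measure of cubes *)

Section cubes.
Context {R : realType}.
Variable d : nat.

Definition cube (l : R) : set 'rV[R]_d := [set u | forall i, 0 <= u 0 i <= l].

Lemma hausdorff_cube_le (l k : R) : 0 < l -> 0 < k ->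
  (hausdorff d (cube k) <= ((k / l) ^+ d)%:E * hausdorff d (cube l))%E.
Proof.
move=> l0 k0; have kl : 0 < k / l by rewrite divr_gt0.
have -> : cube k = (fun u => (k / l) *: u) @` cube l.
  apply/seteqP; split => [u uk|_ [u ul <-] i].
    exists ((l / k) *: u).
      move=> i; rewrite mxE; have /andP[u0 uk1] := uk i.
      apply/andP; split; first by rewrite mulr_ge0 ?divr_ge0// ltW.
      by rewrite mulrAC ler_pdivrMr// ler_pM2l.
    by rewrite scalerA mulrA divfK ?gt_eqF// divff ?gt_eqF// scale1r.
  have /andP[u0 uk1] := ul i; rewrite mxE.
  apply/andP; split; first by rewrite mulr_ge0// ltW.
  by rewrite mulrAC ler_pdivrMr// ler_pM2l.
apply: hausdorff_lipschitz => // x y _ _.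
by rewrite -scalerBr enormZ gtr0_norm.
Qed.

(** Scaling maps any cube onto any other; the two Lipschitz bounds together give
    equality. *)
Lemma hausdorff_cube (l : R) : 0 < l ->
  hausdorff d (cube l) = ((l ^+ d)%:E * hausdorff d (cube 1))%E.
Proof.
move=> l0; apply/eqP; rewrite eq_le; apply/andP; split.
  by have := hausdorff_cube_le ltr01 l0; rewrite divr1.
have := hausdorff_cube_le l0 ltr01.
by rewrite div1r exprVn lee_pdivlMl// exprn_gt0.
Qed.

Lemma hausdorff_box (c : 'rV[R]_d) (l : R) :
  hausdorff d [set u : 'rV[R]_d | forall i, c 0 i <= u 0 i <= c 0 i + l] =
  hausdorff d (cube l).
Proof.
have -> : [set u : 'rV[R]_d | forall i, c 0 i <= u 0 i <= c 0 i + l] =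
    (fun u => c + u) @` cube l.
  apply/seteqP; split => [u uc|_ [u ul <-] i].
    exists (u - c); last by rewrite addrC subrK.
    move=> i; have := uc i.
    by rewrite !mxE subr_ge0 lerBlDl.
  by have := ul i; rewrite !mxE lerDl lerD2l.
by apply: hausdorff_isometry => x y; rewrite opprD addrACA subrr add0r.
Qed.

(** The face at height c of the box over the hypersquare, parametrised by the
    cube. *)
Definition square_embedding (a : 'rV[R]_d) (Q : 'M[R]_d) (c : R) (u : 'rV[R]_d) :
  'rV[R]_(d + 1) := row_mx (a + u *m Q) (const_mx c).

Lemma square_embedding_isometry a Q c : Q *m Q^T = 1%:M ->
  forall u v, enorm (square_embedding a Q c u - square_embedding a Q c v) =
    enorm (u - v).
Proof.
move=> QQ u v; rewrite /square_embedding opp_row_mx add_row_mx subrr.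
apply/eqP; rewrite -(@eqrXn2 _ 2) ?enorm_ge0// sqr_enorm_row_mx enorm0.
by rewrite expr0n addr0 opprD addrACA subrr add0r -mulmxBl enorm_isometry.
Qed.

Lemma hausdorff_at_height a Q l c (B : set 'rV[R]_(d + 1)) :
  Q *m Q^T = 1%:M ->
  hausdorff d (B `&` at_height [set a + u *m Q | u in cube l] c) =
  hausdorff d (cube l `&` square_embedding a Q c @^-1` B).
Proof.
move=> QQ.
rewrite -(hausdorff_isometry (square_embedding_isometry a c QQ)).
congr hausdorff; apply/seteqP; split.
  move=> z [Bz [_ [u ul <-] uz]]; exists u => //; split => //=.
  by rewrite /square_embedding uz.
by move=> _ [u [ul Bu] <-]; split => //; exists (a + u *m Q) => //; exists u.
Qed.

Lemma hausdorff_square a Q l : Q *m Q^T = 1%:M ->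
  hausdorff d [set (a : 'rV[R]_d) + u *m Q | u in cube l] =
  hausdorff d (cube l).
Proof.
move=> QQ; apply: (@hausdorff_isometry _ _ _ (fun u => a + u *m Q)) => u v.
by rewrite opprD addrACA subrr add0r -mulmxBl enorm_isometry.
Qed.

(** The points of a face within horizontal distance r of x lie in a copy of the
    cube of side 2 r centred at x. *)
Lemma hausdorff_near_axis (A : set 'rV[R]_d) (c r : R) (x : 'rV[R]_d) : 0 < r ->
  (hausdorff d ([set z : 'rV[R]_(d + 1) | (enorm (lsubmx z - x) < r)%R]
      `&` at_height A c) <=
   ((2 * r) ^+ d)%:E * hausdorff d (cube 1))%E.
Proof.
move=> r0; rewrite -hausdorff_cube ?mulr_gt0//.
rewrite -(hausdorff_box (x - const_mx r)) -(@hausdorff_isometry _ _ _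
  (fun v : 'rV[R]_d => row_mx v (const_mx c : 'rV[R]_1))); last first.
  move=> u v; rewrite opp_row_mx add_row_mx subrr.
  by apply/eqP; rewrite -(@eqrXn2 _ 2) ?enorm_ge0// sqr_enorm_row_mx enorm0 expr0n addr0.
apply: le_hausdorff => z [/= zr [v _ vz]]; subst z.
move: zr; rewrite row_mxKl => vr.
exists v => // i; rewrite !mxE.
have := le_lt_trans (coord_le_enorm (v - x) i) vr.
by rewrite !mxE ltr_norml => /andP[? ?]; lra.
Qed.

End cubes.

(** * Borel sets of row vectors *)

Section borel_row_vectors.
Context {R : realType}.
Variable m : nat.

Lemma coord_measurable (i : 'I_m) :
  measurable_fun setT (fun u : borel 'rV[R]_m => (u : 'rV[R]_m) 0 i).
Proof.
apply: (measurability _ (RGenOpens.measurableE R)) => //.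
move=> _ [_ [a [b ->]] <-]; rewrite setTI; apply: sub_sigma_algebra.
apply: open_comp; last exact: interval_open.
by move=> u _; exact: coord_continuous.
Qed.

Let box (q : 'rV[rat]_m * nat) : set 'rV[R]_m :=
  [set u | forall i, `|u 0 i - ratr (q.1 0 i)| < q.2.+1%:R^-1].

Let open_boxes (O : set 'rV[R]_m) : open O ->
  O = \bigcup_(q in [set q | box q `<=` O]) box q.
Proof.
move=> oO; apply/seteqP; split => [u Ou|u [q qO /qO //]].
have /nbhs_ballP[e /= e0 ueO] := open_nbhs_nbhs (conj oO Ou).
have [k] : exists k : nat, k.+1%:R^-1 < e / 2.
  have /ltr_add_invr[k] : 0 < e / 2 by rewrite divr_gt0.
  by rewrite add0r; exists k.
set h : R := k.+1%:R^-1 => he.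
have h0 : 0 < h by rewrite invr_gt0.
have : forall i, exists q : rat, `|u 0 i - ratr q| < h.
  move=> i; have [|q] := @rat_in_itvoo _ (u 0 i - h) (u 0 i + h).
    by rewrite ltrBlDr -addrA ltrDl addr_gt0.
  rewrite in_itv/= => /andP[q1 q2]; exists q.
  by rewrite ltr_norml; apply/andP; split; lra.
move=> /choice[q qu]; exists (\row_i q i, k); last first.
  by move=> i; rewrite mxE; exact: qu.
move=> v /= vq; apply: ueO; split => // i j; rewrite ord1.
rewrite /ball/= -(subrKA (ratr (q j))) (le_lt_trans (ler_normD _ _))//.
rewrite (splitr e) ltrD//.
  exact: lt_trans (qu j) he.
by have := vq j; rewrite mxE distrC => /lt_trans; apply.
Qed.

(** Every open set is a countable union of boxes with rational centre and radius
    1 / (k + 1), so that the preimages of boxes decide. *)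
Lemma measurable_fun_rV d (T : measurableType d) (D : set T)
    (f : T -> borel 'rV[R]_m) :
  (forall i, measurable_fun D (fun x => (f x : 'rV[R]_m) 0 i)) ->
  measurable_fun D f.
Proof.
move=> mf mD.
suff : measurable_fun D f by apply.
apply: (@measurability _ _ _ (borel 'rV[R]_m) _ _ (@open 'rV[R]_m) erefl).
move=> _ [V oV <-]; rewrite (open_boxes oV) preimage_bigcup setI_bigcupr.
rewrite bigcup_mkcond; apply: countable_bigcupT_measurable.
  exact: countableP.
move=> q; case: ifPn => // _.
have -> : D `&` f @^-1` box q = \bigcap_(i in [set: 'I_m]) (D `&`
    (fun x => (f x : 'rV[R]_m) 0 i) @^-1` [set y | `|y - ratr (q.1 0 i)| < q.2.+1%:R^-1])
    `&` D.
  apply/seteqP; split => [x [Dx fx]|x [fx Dx]].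
    by split => // i _; split => //; exact: fx.
  by split => // i; have [] := fx i I.
apply: measurableI => //.
apply: fin_bigcap_measurable => // i _; apply: mf => //.
have := @measurable_ball R (ratr (q.1 0 i)) (q.2.+1%:R^-1).
by congr measurable; apply/seteqP; split => y; rewrite /ball/= distrC.
Qed.

Lemma measurable_coord_fun d (T : measurableType d) (D : set T)
    (f : T -> borel 'rV[R]_m) i :
  measurable_fun D f -> measurable_fun D (fun x => (f x : 'rV[R]_m) 0 i).
Proof.
by move=> mf; exact: (measurableT_comp (coord_measurable i) mf).
Qed.

Section outer_regularity.
Variable nu : {finite_measure set (borel 'rV[R]_m) -> \bar R}.

(** The sets that can be enclosed between a closed and an open set whose
    difference has small mass form a sigma-algebra. It contains the open
    sets. *)
Let approx (B : set 'rV[R]_m) := forall e : R, 0 < e ->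
  exists F O : set 'rV[R]_m, [/\ closed F, open O, F `<=` B, B `<=` O &
    (nu (O `\` F : set (borel 'rV[R]_m)) < e%:E)%E].

Let mopen (O : set 'rV[R]_m) : open O -> measurable (O : set (borel 'rV[R]_m)).
Proof. by move=> oO; exact: sub_sigma_algebra. Qed.

Let mclosed (F : set 'rV[R]_m) : closed F -> measurable (F : set (borel 'rV[R]_m)).
Proof.
move=> cF; rewrite -[F]setCK; apply: measurableC; apply: mopen.
exact: closed_openC.
Qed.

Let approxC B : approx B -> approx (~` B).
Proof.
move=> aB e /aB[F [V [cF oV FB BV nuVF]]]; exists (~` V), (~` F); split.
- exact: open_closedC.
- exact: closed_openC.
- exact: subsetC.
- exact: subsetC.
- by rewrite setDE setCK setIC -setDE.
Qed.

Let approx_open (B : set 'rV[R]_m) : open B -> approx B.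
Proof.
move=> oB e e0.
pose F (n : nat) : set 'rV[R]_m :=
  \bigcap_(y in ~` B) [set x | n.+1%:R^-1 <= `|x - y|].
have cF n : closed (F n).
  apply: closed_bigI => y _.
  apply: (@closed_comp _ _ (fun x : 'rV[R]_m => `|x - y|) [set z | n.+1%:R^-1 <= z]).
    by move=> x _; exact: (cvg_norm (cvgB cvg_id (cvg_cst y))).
  exact: closed_ge.
have FB n : F n `<=` B.
  move=> x Fx; apply: contrapT => /Fx /=.
  by rewrite subrr normr0 leNgt invr_gt0 ltr0n.
have BF : \bigcup_n F n = B.
  apply/seteqP; split => [x [n _ /FB //]|x Bx].
  have /nbhs_ballP[r /= r0 xr] := open_nbhs_nbhs (conj oB Bx).
  have [k] := ltr_add_invr r0; rewrite add0r => kr.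
  exists k => // y By /=; rewrite leNgt; apply/negP => xy; apply: By; apply: xr.
  by rewrite -ball_normE /=; exact: lt_trans kr.
have cvgF : nu (B `\` F n : set (borel 'rV[R]_m)) @[n --> \oo] -->
    nu (\bigcap_n (B `\` F n) : set (borel 'rV[R]_m)).
  apply: (@nonincreasing_cvg_mu _ _ _ nu (fun n => B `\` F n)).
  - by rewrite -ge0_fin_numE//; apply: fin_num_measure; apply: measurableD; auto.
  - by move=> n; apply: measurableD; auto.
  - by apply: bigcapT_measurable => n; apply: measurableD; auto.
  - move=> i j ij; apply/subsetPset => x [Bx Fx]; split => // Fix; apply: Fx.
    move=> y /Fix/=; apply: le_trans.
    by rewrite lef_pV2 ?posrE ?ltr0n// ler_nat ltnS.
have cap0 : \bigcap_n (B `\` F n) = set0.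
  apply/seteqP; split => // x capx; have [Bx _] := capx 0%N I.
  move: (Bx); rewrite -BF => -[n _ Fx].
  by have [_] := capx n I.
rewrite cap0 measure0 in cvgF.
have : \forall n \near \oo, (nu (B `\` F n : set (borel 'rV[R]_m)) < e%:E)%E.
  by apply: (cvgF [set x | (x < e%:E)%E]); apply: lt_nbhsl; exact: e0.
move=> [n _ /(_ n (leqnn n)) ne]; exists (F n), B; split => //.
Qed.

Let approx_bigcup (B : (set 'rV[R]_m)^nat) :
  (forall n, approx (B n)) -> approx (\bigcup_n B n).
Proof.
move=> aB e e0; have e20 : 0 < e / 2 by rewrite divr_gt0.
have en n : 0 < e / 2 / (2 ^ n.+1)%:R by rewrite divr_gt0// ltr0n expn_gt0.
have /choice[F] : forall n, exists FV : set 'rV[R]_m * set 'rV[R]_m,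
    [/\ closed FV.1, open FV.2, FV.1 `<=` B n, B n `<=` FV.2 &
    (nu (FV.2 `\` FV.1 : set (borel 'rV[R]_m)) < (e / 2 / (2 ^ n.+1)%:R)%:E)%E].
  by move=> n; have [F [V H]] := aB n _ (en n); exists (F, V).
move=> FE.
pose V := \bigcup_n (F n).2.
have oV : open V by apply: bigcup_open => n _; have [] := FE n.
pose K n := \bigcup_(k < n) (F k).1.
have cK n : closed (K n).
  by apply: closed_bigcup => // k _; have [] := FE k.
have mF1 n : measurable ((F n).1 : set (borel 'rV[R]_m)).
  by apply: mclosed; have [] := FE n.
have mF2 n : measurable ((F n).2 : set (borel 'rV[R]_m)).
  by apply: mopen; have [] := FE n.
have mFD n : measurable ((F n).2 `\` (F n).1 : set (borel 'rV[R]_m)).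
  exact: measurableD.
have mVK n : measurable (V `\` K n : set (borel 'rV[R]_m)).
  by apply: measurableD; [exact: mopen|exact: mclosed].
have capE : \bigcap_n (V `\` K n) `<=` \bigcup_n ((F n).2 `\` (F n).1).
  move=> x capx; have [[n _ Vx] _] := capx 0%N I; exists n => //; split => // Fx.
  by have [_ +] := capx n.+1 I; apply; exists n => //=.
have nucap : (nu (\bigcap_n (V `\` K n) : set (borel 'rV[R]_m)) <= (e / 2)%:E)%E.
  apply: (@le_trans _ _ (nu (\bigcup_n ((F n).2 `\` (F n).1) : set (borel 'rV[R]_m)))).
    apply: le_measure => //; rewrite inE.
      exact: bigcapT_measurable.
    exact: bigcupT_measurable.
  apply: le_trans (measure_sigma_subadditive _ _ _ _) _ => //.
    exact: mFD.
    exact: bigcupT_measurable.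
    exact: subset_refl.
  rewrite -[leRHS]add0e -[X in (X + _)%E](@eseries0 R (fun=> 0%E) 0%N xpredT)//.
  apply: le_trans (epsilon_trick xpredT _ (ltW e20)) => //.
  apply: lee_nneseries => // n _; rewrite add0e; apply: ltW.
  by have [] := FE n.
have cvgK : nu (V `\` K n : set (borel 'rV[R]_m)) @[n --> \oo] -->
    nu (\bigcap_n (V `\` K n) : set (borel 'rV[R]_m)).
  apply: (@nonincreasing_cvg_mu _ _ _ nu (fun n => V `\` K n)).
  - by rewrite -ge0_fin_numE//; exact: fin_num_measure.
  - exact: mVK.
  - exact: bigcapT_measurable.
  - move=> i j ij; apply/subsetPset => x [Vx Kx]; split => // -[k ki Fk]; apply: Kx.
    by exists k => //=; exact: leq_trans ij.
have : \forall n \near \oo, (nu (V `\` K n : set (borel 'rV[R]_m)) < e%:E)%E.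
  have ltcap : (nu (\bigcap_n (V `\` K n) : set (borel 'rV[R]_m)) < e%:E)%E.
    apply: le_lt_trans nucap _.
    by rewrite lte_fin ltr_pdivrMr// ltr_pMr// ltr1n.
  apply: (cvgK [set x | (x < e%:E)%E]).
  exact: (open_nbhs_nbhs (conj (@open_ereal_lt_ereal _ _) ltcap)).
move=> [n _ /(_ n (leqnn n)) ne]; exists (K n), V; split => //.
- by move=> x [k _ Fx]; exists k => //; have [_ _ H _ _] := FE k; exact: H.
- by move=> x [k _ Bx]; exists k => //; have [_ _ _ H _] := FE k; exact: H.
Qed.

Lemma borel_outer_regular (B : set (borel 'rV[R]_m)) (e : R) :
  measurable B -> 0 < e ->
  exists V : set 'rV[R]_m, [/\ open V, B `<=` V &
    (nu (V : set (borel 'rV[R]_m)) <= nu B + e%:E)%E].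
Proof.
move=> mB e0.
have : approx B.
  apply: (smallest_sub _ _ mB); last by move=> V; exact: approx_open.
  split.
  - by apply: approx_open; exact: open0.
  - by move=> A; rewrite setTD; exact: approxC.
  - exact: approx_bigcup.
move=> /(_ e e0)[F [V [cF oV FB BV nuVF]]]; exists V; split => //.
have -> : V = B `|` (V `\` B) by rewrite setDUK.
have mVB : measurable (V `\` B : set (borel 'rV[R]_m)).
  by apply: measurableD => //; exact: mopen.
apply: le_trans (measureU2 _ _ _) _ => //; rewrite leeD2l// ltW//.
apply: le_lt_trans nuVF; apply: le_measure; rewrite ?inE//.
  by apply: measurableD; [exact: mopen|exact: mclosed].
by move=> x [Vx Bx]; split => // /FB.
Qed.

End outer_regularity.

End borel_row_vectors.

(** * Coin tosses on an atomless space *)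

(** Independent fair coin tosses, by the masses of the cylinder sets. *)
Definition fair_bits {R : realType} d (T : measurableType d)
    (P : {finite_measure set T -> \bar R}) (bit : T -> nat -> bool) : Prop :=
  forall (b : nat -> bool) n,
    measurable [set p | forall k, (k < n)%N -> bit p k = b k] /\
    P [set p | forall k, (k < n)%N -> bit p k = b k] =
      (fine (P setT) / 2 ^+ n)%:E.

Section atomless_measures.
Context {R : realType} d (T : measurableType d).
Variable P : {finite_measure set T -> \bar R}.
Hypothesis aP : atomless P.

Let mass (A : set T) : R := fine (P A).

Let massE A : measurable A -> (mass A)%:E = P A.
Proof. by move=> mA; rewrite fineK// fin_num_measure. Qed.

Let mass_ge0 A : 0 <= mass A.
Proof. exact: fine_ge0. Qed.

Let massD A B : measurable A -> measurable B -> B `<=` A ->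
  mass (A `\` B) = mass A - mass B.
Proof.
move=> mA mB BA; apply: EFin_inj; rewrite EFinB !massE//; last exact: measurableD.
rewrite measureD//; last by rewrite -ge0_fin_numE// fin_num_measure.
by rewrite setIidr.
Qed.

Let massS A B : measurable A -> measurable B -> A `<=` B -> mass A <= mass B.
Proof.
by move=> mA mB AB; rewrite -lee_fin !massE// le_measure// inE.
Qed.

Let massU A B : measurable A -> measurable B -> A `&` B = set0 ->
  mass (A `|` B) = mass A + mass B.
Proof.
move=> mA mB AB; apply: EFin_inj; rewrite EFinD !massE//; last exact: measurableU.
by rewrite measureU.
Qed.

(** Atomlessness splits a set of positive mass into two parts of positive mass,
    the lighter of which has at most half the mass. Iterate. *)
Lemma atomless_small_subset (B : set T) (e : R) : measurable B ->
  (0 < P B)%E -> 0 < e ->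
  exists C, [/\ measurable C, C `<=` B, 0 < mass C & mass C < e].
Proof.
move=> mB PB e0; have mB0 : 0 < mass B by rewrite -lte_fin massE.
suff H n : exists C, [/\ measurable C, C `<=` B, 0 < mass C & mass C * 2 ^+ n <= mass B].
  pose n := Num.bound (mass B / e).
  have [C [mC CB C0 Cn]] := H n; exists C; split => //.
  have : mass B / e < 2 ^+ n.
    rewrite (lt_trans (archi_boundP _)) ?divr_ge0 ?(ltW e0)//.
    by rewrite -natrX ltr_nat ltn_expl.
  rewrite ltr_pdivrMr// => h; have := le_lt_trans Cn h.
  by rewrite mulrC ltr_pM2l// exprn_gt0.
elim: n => [|n [C [mC CB C0 Cn]]]; first by exists B; split => //; rewrite expr0 mulr1.
have [D [mD DC D0 DltC]] : exists D, [/\ measurable D, D `<=` C, (0 < P D)%E & (P D < P C)%E].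
  have PC : (0 < P C)%E by rewrite -(massE mC) lte_fin.
  by have [D [? ? ? ?]] := aP mC PC; exists D.
rewrite -(massE mD) lte_fin in D0.
rewrite -(massE mD) -(massE mC) lte_fin in DltC.
have [h|h] := leP (2 * mass D) (mass C).
  exists D; split => //; first exact: subset_trans CB.
  by rewrite exprS mulrA (le_trans _ Cn)// ler_pM2r ?exprn_gt0// mulrC.
exists (C `\` D); split.
- exact: measurableD.
- by move=> x [/CB].
- by rewrite massD// subr_gt0.
- by rewrite exprS mulrA (le_trans _ Cn)// ler_pM2r ?exprn_gt0// massD//; lra.
Qed.

(** Sierpinski's theorem. Starting from the empty set, keep adding a subset
    whose mass is at least half the supremum of the masses that fit below c. If
    the limit had mass less than c, then a small set D' of positive mass would
    still fit at every step, so that each step would add at least half the mass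
    of D', without end. *)
Lemma atomless_subset_mass (B : set T) (c : R) : measurable B ->
  0 <= c -> (c%:E <= P B)%E ->
  exists C, [/\ measurable C, C `<=` B & P C = c%:E].
Proof.
move=> mB c0 cB; rewrite -massE// lee_fin in cB.
pose cand E D := [/\ measurable D, D `<=` B `\` E & mass E + mass D <= c].
have greedy E : exists D, mass E <= c -> cand E D /\
    forall D', cand E D' -> mass D' <= 2 * mass D.
  have [Ec|Ec] := pselect (mass E <= c); last by exists set0.
  pose S := [set mass D | D in cand E].
  have c0S : cand E set0.
    by split => //; rewrite /mass measure0/= addr0.
  have supS : has_sup S.
    split; first by exists (mass set0), set0.
    exists c => _ [D [_ _ Dc] <-]; apply: le_trans Dc.
    by rewrite lerDr.
  have [s0|s0] := leP (sup S) 0.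
    exists set0 => _; split => // D' cD'; rewrite (@le_trans _ _ 0) ?mulr_ge0//.
    by apply: le_trans s0; apply: ub_le_sup; [exact: supS.2|exists D'].
  have [_ [D cD <-] sD] := sup_adherent (divr_gt0 s0 (ltr0n R 2)) supS.
  exists D => _; split => // D' cD'.
  have : mass D' <= sup S by apply: ub_le_sup; [exact: supS.2|exists D'].
  by move: sD; set s := sup S; lra.
move/choice : greedy => [D DP].
pose E := fix E n := if n is n'.+1 then E n' `|` D (E n') else set0.
have EP n : [/\ measurable (E n), E n `<=` B & mass (E n) <= c].
  elim: n => [|n [mE EB Ec]]; first by split => /=; [|exact: sub0set|rewrite /mass measure0].
  have [[mD DB Dc] _] := DP _ Ec; split => /=.
  - exact: measurableU.
  - by move=> x [/EB //|/DB []].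
  - by rewrite massU//; apply/seteqP; split => // x [Ex /DB[]].
have mE n : measurable (E n) by have [] := EP n.
have ndE : nondecreasing_seq E.
  by apply/nondecreasing_seqP => n; apply/subsetPset => x; left.
pose C := \bigcup_n E n.
have mC : measurable C by exact: bigcupT_measurable.
have CB : C `<=` B by move=> x [n _]; have [_ + _] := EP n; apply.
have Cc : mass C <= c.
  rewrite -lee_fin massE//.
  have cvgE : P (E n) @[n --> \oo] --> P C by exact: nondecreasing_cvg_mu.
  apply: (cvge_to_le cvgE); apply: nearW => n; rewrite -massE// lee_fin.
  by have [] := EP n.
exists C; split => //; rewrite -massE//; congr EFin.
apply/eqP; rewrite eq_le Cc /= leNgt; apply/negP => Cltc.
have mBC : measurable (B `\` C) by exact: measurableD.
have [||D' [mD' D'B D'0 D'c]] := @atomless_small_subset (B `\` C) (c - mass C) mBC.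
- by rewrite -massE// lte_fin massD// subr_gt0 (lt_le_trans Cltc).
- by rewrite subr_gt0.
have step n : mass D' <= 2 * mass (D (E n)).
  have [_ _ Ec] := EP n; have [_ h] := DP _ Ec; apply: h; split => //.
    by move=> x /D'B[Bx Cx]; split => // Ex; apply: Cx; exists n.
  have : mass (E n) <= mass C by apply: massS => // x Ex; exists n.
  by lra.
have grow n : n%:R * mass D' <= 2 * mass (E n).
  elim: n => [|n ih]; first by rewrite mul0r mulr_ge0.
  have [_ EB Ec] := EP n; have [[mD DB _] _] := DP _ Ec.
  rewrite -natr1 mulrDl mul1r /= massU//; last first.
    by apply/seteqP; split => // x [Ex /DB[]].
  by rewrite mulrDr lerD.
have := archi_boundP (x := 2 * c / mass D'); rewrite divr_ge0 ?mulr_ge0// => /(_ isT).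
rewrite ltr_pdivrMr// ltNge => /negP; apply; apply: le_trans (grow _) _.
by rewrite ler_pM2l//; have [] := EP (Num.bound (2 * c / mass D')).
Qed.

(** Halve the space again and again. The tosses of a particle become the binary
    digits of the coordinates of its endpoint. *)
Lemma atomless_bits : exists bit : T -> nat -> bool, fair_bits P bit.
Proof.
have halfP (B : set T) : exists C, measurable B ->
    [/\ measurable C, C `<=` B & mass C = mass B / 2].
  have [mB|mB] := pselect (measurable B); last by exists set0.
  have [|||C [mC CB PC]] := @atomless_subset_mass B (mass B / 2).
  - by [].
  - by rewrite divr_ge0.
  - by rewrite -massE// lee_fin; have := mass_ge0 B; lra.
  by exists C => _; split => //; rewrite /mass PC.
move/choice : halfP => [half halfP].
(* [cyl s] is the set of particles with tosses s, the latest toss first. *)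
pose cyl := fix cyl (s : seq bool) : set T := if s is b :: s' then
  (if b then half (cyl s') else cyl s' `\` half (cyl s')) else setT.
have cylP s : measurable (cyl s) /\ mass (cyl s) = mass setT / 2 ^+ size s.
  elim: s => [|b s [ms ps]]; first by split => //=; rewrite expr0 divr1.
  have [mh hs ph] := halfP _ ms.
  have E : mass (cyl s) / 2 = mass setT / 2 ^+ (size s).+1.
    by rewrite ps exprS invfM mulrAC mulrA.
  case: b => /=; first by split => //; rewrite ph.
  split; first exact: measurableD.
  by rewrite massD// ph -E; lra.
pose word := fix word (p : T) (n : nat) : seq bool := if n is n'.+1 then
  `[< half (cyl (word p n')) p >] :: word p n' else [::].
pose bit p n := `[< half (cyl (word p n)) p >].
exists bit => b n.
have -> : [set p | forall k, (k < n)%N -> bit p k = b k] = cyl (rev (mkseq b n)).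
  have word_size p k : size (word p k) = k by elim: k => //= k ->.
  have wordP p : forall k, word p k = rev (mkseq (bit p) k).
    by elim=> [//|k ih]; rewrite mkseqS rev_rcons -ih.
  have cylword p k : cyl (word p k) p.
    elim: k => [//|k ih] /=; case: asboolP => //.
  have cyl_unique p s : cyl s p -> s = word p (size s).
    elim: s => [//|c s ih] /=; case: c => [hp|[sp nhp]].
      have [_ hs _] := halfP _ (cylP s).1.
      have /ih <- := hs _ hp.
      by rewrite asboolT.
    by move: (sp) => /ih <-; rewrite asboolF.
  apply/seteqP; split => p.
    move=> pb; suff <- : word p n = rev (mkseq b n) by [].
    rewrite wordP; congr rev; apply/eq_in_map => k; rewrite mem_iota => /andP[_].
    by rewrite add0n; exact: pb.
  move=> /cyl_unique; rewrite size_rev size_mkseq wordP => /(can_inj revK) bE k kn.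
  by have := congr1 (fun s => nth false s k) bE; rewrite !nth_mkseq.
have [mc pc] := cylP (rev (mkseq b n)); split => //.
by rewrite -massE// pc size_rev size_mkseq.
Qed.

End atomless_measures.

(** * Binary expansions with coalescence *)

Section sups_bounds.
Context {R : realType}.

Lemma le_sups (u : nat -> R) k J : has_ubound (range u) -> (k <= J)%N ->
  u J <= sups u k.
Proof.
move=> [M uM] kJ; rewrite /sups /=; apply: ub_le_sup; last by exists J.
by exists M => _ [n _ <-]; apply: uM; exists n.
Qed.

Lemma sups_le (u : nat -> R) k c : (forall J, (k <= J)%N -> u J <= c) ->
  sups u k <= c.
Proof.
move=> uc; rewrite /sups /=; apply: ge_sup.
  by exists (u k), k => /=.
by move=> _ [n /= kn <-]; exact: uc.
Qed.

End sups_bounds.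

Section binary_expansions.
Context {R : realType}.
Implicit Types beta : nat -> bool.

Definition digit_sum beta J : R := \sum_(j < J) (beta j)%:R / 2 ^+ j.+1.

Lemma digit_sum0 beta : digit_sum beta 0 = 0.
Proof. by rewrite /digit_sum big_ord0. Qed.

Lemma digit_sumS beta J :
  digit_sum beta J.+1 = digit_sum beta J + (beta J)%:R / 2 ^+ J.+1.
Proof. by rewrite /digit_sum big_ord_recr. Qed.

Lemma invr_two_split J : (2 ^+ J)^-1 = (2 ^+ J.+1)^-1 + (2 ^+ J.+1)^-1 :> R.
Proof.
by rewrite exprS invfM -mulrDl -[X in X + _]mul1r -[X in _ + X]mul1r -splitr mul1r.
Qed.

Lemma digit_sum_le beta J K : (J <= K)%N -> digit_sum beta J <= digit_sum beta K.
Proof.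
move=> /subnK <-; elim: (K - J)%N => // n; rewrite addSn digit_sumS => /le_trans; apply.
by rewrite lerDl divr_ge0// exprn_ge0.
Qed.

Lemma digit_sum_right_end beta J K : (J <= K)%N ->
  digit_sum beta K + (2 ^+ K)^-1 <= digit_sum beta J + (2 ^+ J)^-1.
Proof.
move=> /subnK <-; elim: (K - J)%N => // n; rewrite addSn; apply: le_trans.
rewrite digit_sumS [in leRHS]invr_two_split addrA lerD2r lerD2l.
by rewrite -[leRHS]mul1r ler_pM2r ?invr_gt0 ?exprn_gt0// lern1 leq_b1.
Qed.

Lemma digit_sum_le1 beta J : digit_sum beta J <= 1.
Proof.
have := digit_sum_right_end beta (leq0n J).
rewrite digit_sum0 expr0 invr1 add0r; apply: le_trans.
by rewrite lerDl invr_ge0 exprn_ge0.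
Qed.

Lemma eq_digit_sum beta beta' J : (forall j, (j < J)%N -> beta j = beta' j) ->
  digit_sum beta J = digit_sum beta' J.
Proof. by move=> e; apply: eq_bigr => j _; rewrite e. Qed.

(** The greedy choice: a digit is 1 whenever the partial sum stays below x. *)
Lemma digits_exist (x : R) : 0 <= x <= 1 -> exists beta, forall J,
  digit_sum beta J <= x <= digit_sum beta J + (2 ^+ J)^-1.
Proof.
move=> /andP[x0 x1].
pose a := fix a n : R := if n is n'.+1 then
  a n' + ((a n' + (2 ^+ n)^-1 <= x)%R : nat)%:R / 2 ^+ n else 0.
pose beta n := a n + (2 ^+ n.+1)^-1 <= x.
have aE J : digit_sum beta J = a J.
  by elim: J => [|J ih]; [exact: digit_sum0|rewrite digit_sumS ih].
exists beta => J; rewrite aE; elim: J => [|J /andP[ih1 ih2]].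
  by rewrite /= expr0 invr1 add0r x0.
rewrite [a J.+1]/=; case: (boolP (a J + (2 ^+ J.+1)^-1 <= x)) => h /=.
  by rewrite mul1r h -addrA -invr_two_split.
by rewrite mul0r addr0 ih1/= ltW// ltNge.
Qed.

Definition digit_value beta : R := sups (digit_sum beta) 0.

Let ub_digit_sum beta : has_ubound (range (digit_sum beta)).
Proof. by exists 1 => _ [n _ <-]; exact: digit_sum_le1. Qed.

Lemma digit_value_itv beta J :
  digit_sum beta J <= digit_value beta <= digit_sum beta J + (2 ^+ J)^-1.
Proof.
rewrite le_sups//=; apply: sups_le => K _.
have [JK|/ltnW KJ] := leqP J K.
  apply: le_trans (digit_sum_right_end beta JK).
  by rewrite lerDl invr_ge0 exprn_ge0.
by rewrite (le_trans (digit_sum_le _ KJ))// lerDl invr_ge0 exprn_ge0.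
Qed.

(** Let [c_J, e_J] be the dyadic interval of level J that is determined by the
    digits. The supremum of min(c_J, e_J - u) over J >= k is 1-Lipschitz in u
    and equals the number with these digits at u = 0. For u >= 2^(-N) it depends
    on the first N digits only, if k <= N. So when u grows, the points of a
    dyadic interval merge as soon as u reaches its length; intervals of level k
    are the last to merge. *)
Definition branch k beta (u : R) : R :=
  sups (fun J => Num.min (digit_sum beta J)
                   (digit_sum beta J + (2 ^+ J)^-1 - u)) k.

Let ub_branch beta u : has_ubound (range (fun J => Num.min (digit_sum beta J)
  (digit_sum beta J + (2 ^+ J)^-1 - u))).
Proof.
by exists 1 => _ [n _ <-]; rewrite ge_min digit_sum_le1.
Qed.

Lemma branch0 k beta : branch k beta 0 = digit_value beta.
Proof.
have e J : Num.min (digit_sum beta J) (digit_sum beta J + (2 ^+ J)^-1 - 0) =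
    digit_sum beta J.
  by rewrite subr0 min_l// lerDl invr_ge0 exprn_ge0.
apply/eqP; rewrite eq_le; apply/andP; split; apply: sups_le => J kJ.
  by rewrite e le_sups.
apply: le_trans (digit_sum_le beta (leq_maxr k J)) _.
by rewrite -e le_sups// leq_maxl.
Qed.

Lemma branch_lipschitz k beta u v : `|branch k beta u - branch k beta v| <= `|u - v|.
Proof.
have H x y : branch k beta x - branch k beta y <= `|x - y|.
  rewrite lerBlDr; apply: sups_le => J kJ.
  rewrite -lerBlDl; apply: le_trans (le_sups (ub_branch beta y) kJ).
  have := ler_norm (y - x); rewrite distrC => ?; have := normr_ge0 (x - y) => ?.
  rewrite le_min; apply/andP; split.
    by rewrite lerBlDr ge_min lerDl normr_ge0.
  by rewrite lerBlDr ge_min; apply/orP; right; lra.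
rewrite ler_norml H andbT lerNl opprB distrC; exact: H.
Qed.

(** For J >= N the intervals are nested, hence e_J - u <= e_N - u <= c_N: the
    levels beyond N do not exceed level N in the supremum. *)
Lemma branch_coarse k N beta beta' u : (k <= N)%N ->
  (forall j, (j < N)%N -> beta j = beta' j) -> (2 ^+ N)^-1 <= u ->
  branch k beta u = branch k beta' u.
Proof.
have H b b' : (k <= N)%N -> (forall j, (j < N)%N -> b j = b' j) ->
    (2 ^+ N)^-1 <= u -> branch k b u <= branch k b' u.
  move=> kN bb uN; apply: sups_le => J kJ.
  have [JN|/ltnW NJ] := leqP J N.
    rewrite (@eq_digit_sum b b'); last by move=> j jJ; apply: bb; exact: leq_trans JN.
    exact: (le_sups (ub_branch b' u) kJ).
  apply: le_trans (le_sups (ub_branch b' u) kN).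
  rewrite -(@eq_digit_sum b b')// le_min !ge_min.
  have := digit_sum_right_end b NJ => h.
  by apply/andP; split; apply/orP; right; lra.
move=> kN bb uN; apply/eqP; rewrite eq_le !H// => j jN.
by rewrite bb.
Qed.

Lemma measurable_digit_sum d (T : measurableType d) (D : set T)
    (bit : T -> nat -> bool) J :
  (forall n, measurable_fun D (bit^~ n)) ->
  measurable_fun D (fun p => digit_sum (bit p) J).
Proof.
move=> mb; apply: measurable_sum => j; apply: measurable_funM => //.
rewrite (_ : (fun p => (bit p j)%:R) = (fun b : bool => (b%:R : R)) \o (bit^~ j))//.
by apply: measurableT_comp => //; exact: mb.
Qed.

Lemma measurable_branch d (T : measurableType d) (D : set T)
    (bit : T -> nat -> bool) (u : T -> R) k :
  (forall n, measurable_fun D (bit^~ n)) -> measurable_fun D u ->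
  measurable_fun D (fun p => branch k (bit p) (u p)).
Proof.
move=> mb mu; apply: (measurable_fun_sups (h := fun J p =>
  Num.min (digit_sum (bit p) J) (digit_sum (bit p) J + (2 ^+ J)^-1 - u p))).
  by move=> p _; exact: ub_branch.
move=> J; apply: measurable_minr; first exact: measurable_digit_sum.
apply: measurable_funB => //; apply: measurable_funD => //.
exact: measurable_digit_sum.
Qed.

End binary_expansions.

(** * Uniform distribution on a cube *)

Section uniform_map.
Context {R : realType} dT (T : measurableType dT).
Variables (d : nat) (l : R) (P : {finite_measure set T -> \bar R}).
Variable bit : T -> nat -> bool.
Hypotheses (d0 : (0 < d)%N) (l0 : 0 < l).
Hypothesis PT : P setT = hausdorff d (@cube R d l).
Hypothesis bitP : fair_bits P bit.

(** The tosses are dealt out to the d coordinates in turn. *)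
Definition channel (i : 'I_d) (b : nat -> bool) (j : nat) : bool := b (j * d + i)%N.

Lemma channel_eq i b b' J : (forall n, (n < J * d)%N -> b n = b' n) ->
  forall j, (j < J)%N -> channel i b j = channel i b' j.
Proof.
move=> bb j jJ; apply: bb; apply: (@leq_trans (j * d + d)).
  by rewrite ltn_add2l.
by rewrite -mulSnr leq_mul2r jJ orbT.
Qed.

Lemma measurable_bit n : measurable_fun setT (bit^~ n).
Proof.
apply: (measurable_fun_bool true); rewrite setTI.
pose ext (t : {ffun 'I_n -> bool}) k := if insub k is Some i then t i else true.
have -> : bit^~ n @^-1` [set true] = \bigcup_(t in [set: {ffun 'I_n -> bool}])
    [set p | forall k, (k < n.+1)%N -> bit p k = ext t k].
  apply/seteqP; split => [p pn|p [t _ pt]].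
    exists [ffun i : 'I_n => bit p i] => // k.
    rewrite ltnS /ext leq_eqVlt => /predU1P[->|kn].
      by rewrite insubF ?ltnn.
    by rewrite insubT ffunE.
  by rewrite /preimage/= pt// /ext insubF// ltnn.
apply: fin_bigcup_measurable; first exact: finite_finset.
by move=> t _; exact: (bitP _ _).1.
Qed.

Definition uniform_map (p : T) : borel 'rV[R]_d :=
  \row_i (l * digit_value (channel i (bit p))).

Lemma measurable_uniform_map : measurable_fun setT uniform_map.
Proof.
apply: measurable_fun_rV => i.
rewrite (_ : (fun _ => _) = fun p => l * branch 0 (channel i (bit p)) (cst 0 p)).
  apply: measurable_funM => //; apply: measurable_branch => // n.
  exact: measurable_bit.
by apply/funext => p; rewrite mxE branch0.
Qed.

Let cell b J : set 'rV[R]_d := [set u | forall i,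
  l * digit_sum (channel i b) J <= u 0 i <=
  l * digit_sum (channel i b) J + l / 2 ^+ J].

Let cell_eq b b' J : (forall n, (n < J * d)%N -> b n = b' n) ->
  cell b J = cell b' J.
Proof.
move=> bb; rewrite /cell; congr mkset; apply/funext => u.
apply/propext; split => H i; have := H i;
  rewrite (@eq_digit_sum _ _ (channel i b') J)//; exact: channel_eq.
Qed.

Let uniform_map_cell p J : cell (bit p) J (uniform_map p).
Proof.
move=> i; rewrite mxE; have /andP[h1 h2] := digit_value_itv (R := R) (channel i (bit p)) J.
by rewrite ler_pM2l// h1/= -mulrDr ler_pM2l.
Qed.

Let cell_cover u : cube l u -> exists b, forall J, cell b J u.
Proof.
move=> ul; have : forall i, exists beta, forall J,
    digit_sum beta J <= u 0 i / l <= digit_sum beta J + (2 ^+ J)^-1.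
  move=> i; apply: digits_exist; have /andP[u0 u1] := ul i.
  by rewrite divr_ge0 ?(ltW l0)//= ler_pdivrMr// mul1r.
move=> /choice[beta betaP].
exists (fun n => beta (Ordinal (ltn_pmod n d0)) (n %/ d)%N) => J i.
have -> : channel i (fun n => beta (Ordinal (ltn_pmod n d0)) (n %/ d)%N) = beta i.
  apply/funext => j; rewrite /channel divnMDl// divn_small// addn0; congr beta.
  by apply: val_inj; rewrite /= modnMDl modn_small.
have /andP[] := betaP i J; rewrite ler_pdivlMr// ler_pdivrMr// => h1 h2.
by rewrite -mulrDr ![l * _]mulrC h1 h2.
Qed.

Let hausdorff_cell b J :
  (hausdorff d (cell b J) <= (fine (P setT) / 2 ^+ (J * d))%:E)%E.
Proof.
have lJ : 0 < l / 2 ^+ J by rewrite divr_gt0// exprn_gt0.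
have -> : cell b J = [set u : 'rV[R]_d | forall i,
    (\row_i (l * digit_sum (channel i b) J) : 'rV[R]_d) 0 i <= u 0 i <=
    (\row_i (l * digit_sum (channel i b) J) : 'rV[R]_d) 0 i + l / 2 ^+ J].
  by apply/seteqP; split => u H i; have := H i; rewrite !mxE.
rewrite hausdorff_box; apply: le_trans (hausdorff_cube_le d l0 lJ) _.
rewrite -PT -{1}(@fineK _ (P setT)) ?fin_num_measure// -EFinM lee_fin mulrC.
rewrite mulrAC divff ?gt_eqF// mul1r exprVn exprM; exact: lexx.
Qed.

Let hausdorff_bigU (I : Type) (s : seq I) (F : I -> set 'rV[R]_d) :
  (hausdorff d (\big[setU/set0]_(i <- s) F i) <= \sum_(i <- s) hausdorff d (F i))%E.
Proof.
elim: s => [|i s ih]; first by rewrite !big_nil hausdorff0.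
rewrite !big_cons; apply: le_trans (hausdorffU2 _ _ _) _.
by rewrite leeD2l.
Qed.

(** A relatively open subset of the cube is a union of closed dyadic cubes, and
    the largest ones among them suffice. They correspond to finite words of
    tosses; distinct words have disjoint sets of particles, of mass M / 2^(J d),
    which is at least the measure of the dyadic cube. The cubes share boundary
    points, so this gives an inequality only. *)
Lemma uniform_map_open (V : set 'rV[R]_d) : open V ->
  (hausdorff d (cube l `&` V) <= P (uniform_map @^-1` V))%E.
Proof.
move=> oV.
(* [first b J] says that J is the level of the largest dyadic cube inside V
   along the digits b. *)
pose good b J := cell b J `<=` V.
pose first b J := good b J /\ forall J', (J' < J)%N -> ~ good b J'.
have good_eq b b' J : (forall n, (n < J * d)%N -> b n = b' n) ->
    good b J -> good b' J.
  by move=> bb; rewrite /good (cell_eq bb).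
have first_eq b b' J : (forall n, (n < J * d)%N -> b n = b' n) ->
    first b J -> first b' J.
  move=> bb [gb gb']; split; first exact: good_eq gb.
  move=> J' J'J g'; apply: (gb' _ J'J); apply: good_eq g' => n nJ'.
  by rewrite bb// (leq_trans nJ')// leq_mul2r (ltnW J'J) orbT.
pose A J := [set p | first (bit p) J].
pose F J := {ffun 'I_(J * d) -> bool}.
pose ext J (t : F J) k := if insub k is Some i then t i else true.
pose res J (b : nat -> bool) : F J := [ffun i : 'I_(J * d) => b i].
have resK : forall J (b : nat -> bool) n, (n < J * d)%N -> b n = ext J (res J b) n.
  by move=> K b n nK; rewrite /ext insubT ffunE.
pose Z J t := [set p | forall k, (k < J * d)%N -> bit p k = ext J t k].
have AE J : A J = \bigcup_(t in [set t | first (ext J t) J]) Z J t.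
  apply/seteqP; split => [p pJ|p [t tJ pt]].
    exists (res J (bit p)); last by move=> k kJ; rewrite -resK.
    by apply: first_eq pJ => n nJ; rewrite -resK.
  by apply: first_eq tJ => n nJ; rewrite pt.
have mZ J t : measurable (Z J t) by exact: (bitP _ _).1.
have PZ J t : ((fine (P setT) / 2 ^+ (J * d))%:E <= P (Z J t))%E.
  by rewrite (bitP _ _).2.
have mA J : measurable (A J).
  by rewrite AE; apply: fin_bigcup_measurable => //; exact: finite_finset.
have tZ J : trivIset [set t | first (ext J t) J] (Z J).
  move=> t t' _ _ [p [pt pt']]; apply/ffunP => i.
  have := pt i (ltn_ord i); rewrite pt'//.
  by rewrite /ext valK => ->.
have HA J : (hausdorff d (\bigcup_(t in [set t | first (ext J t) J]) cell (ext J t) J)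
    <= P (A J))%E.
  have finS : finite_set [set t | first (ext J t) J] by exact: finite_finset.
  rewrite AE -!bigsetU_fset_set// measure_fbigsetU//; last first.
    move=> t t' /=; rewrite !in_fset_set// !inE => ft ft'; exact: tZ.
  apply: le_trans (hausdorff_bigU _ _) _.
  by apply: lee_sum => t _; apply: le_trans (hausdorff_cell _ _) (PZ _ _).
have tA : trivIset setT A.
  move=> J J' _ _ [p [[g1 n1] [g2 n2]]]; apply/eqP; rewrite eqn_leq.
  rewrite leqNgt; apply/andP; split; last rewrite leqNgt.
    by apply/negP => /n1; apply.
  by apply/negP => /n2; apply.
apply: (@le_trans _ _ (P (\bigcup_J A J))); last first.
  apply: le_measure; rewrite ?inE.
  - exact: bigcupT_measurable.
  - rewrite -[X in measurable X]setTI; apply: measurable_uniform_map => //.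
    exact: sub_sigma_algebra.
  - by move=> p [J _ [gp _]]; apply: gp; exact: uniform_map_cell.
rewrite measure_bigcup//=.
apply: (@le_trans _ _ (hausdorff d
    (\bigcup_J \bigcup_(t in [set t | first (ext J t) J]) cell (ext J t) J))).
  apply: le_hausdorff => u [/cell_cover[b ub] Vu].
  have exJ : exists J, `[< good b J >].
    have /nbhs_ballP[r /= r0 ur] := open_nbhs_nbhs (conj oV Vu).
    pose J := Num.bound (l / r).
    have lJr : l / 2 ^+ J < r.
      rewrite ltr_pdivrMr ?exprn_gt0// mulrC -ltr_pdivrMr//.
      rewrite (lt_trans (archi_boundP _)) ?divr_ge0 ?(ltW l0) ?(ltW r0)//.
      by rewrite -natrX ltr_nat ltn_expl.
    exists J; apply/asboolP => v vb; apply: ur; split => // i j; rewrite ord1.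
    rewrite /ball/=; apply: le_lt_trans lJr.
    have /andP[? ?] := ub J j; have /andP[? ?] := vb j.
    by rewrite ler_norml; apply/andP; split; lra.
  have [J /asboolP gJ minJ] := ex_minnP exJ.
  exists J => //; exists (res J b); last first.
    by rewrite /= -(@cell_eq b)// => n; exact: resK.
  apply: (first_eq b); first by move=> n; exact: resK.
  split => // J' J'J /asboolP /minJ; by rewrite leqNgt J'J.
apply: le_trans (hausdorff_sigma_subadditive _ _) _.
apply: (@le_trans _ _ (\sum_(J <oo) P (A J))%E).
  by apply: lee_nneseries => J _ //; move=> _; exact: hausdorff_ge0.
by rewrite le_eqVlt; apply/orP; left; apply/eqP; apply: eq_eseriesl => J; rewrite in_setT.
Qed.

(** Outer regularity of the image of P extends the inequality to Borel sets. The
    total masses agree and the Hausdorff measure is subadditive, so the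
    inequality for the complement is the converse inequality for the set. *)
Lemma uniform_map_distribution (B : set (borel 'rV[R]_d)) : measurable B ->
  P (uniform_map @^-1` B) = hausdorff d (cube l `&` B).
Proof.
have mf := measurable_uniform_map.
pose nu0 : {measure set (borel 'rV[R]_d) -> \bar R} := pushforward P uniform_map.
have nuoo : (nu0 mf setT < +oo)%E.
  by rewrite /nu0 /= /pushforward preimage_setT -ge0_fin_numE// fin_num_measure.
pose nu : {finite_measure set (borel 'rV[R]_d) -> \bar R} := mfrestr measurableT nuoo.
have nuE A : nu A = P (uniform_map @^-1` A).
  by rewrite /nu /= /mfrestr /mrestr /= /pushforward setIT.
have le (A : set (borel 'rV[R]_d)) : measurable A ->
    (hausdorff d (cube l `&` A) <= P (uniform_map @^-1` A))%E.
  move=> mA; apply/lee_addgt0Pr => e e0.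
  have [V [oV AV nuV]] := borel_outer_regular nu mA e0.
  rewrite !nuE in nuV; apply: le_trans nuV.
  by apply: le_trans (uniform_map_open oV); apply: le_hausdorff; exact: setIS.
move=> mB; apply/eqP; rewrite eq_le le// andbT.
have mBC : measurable (~` B) by exact: measurableC.
have mfB (A : set (borel 'rV[R]_d)) : measurable A -> measurable (uniform_map @^-1` A).
  by move=> mA; rewrite -[X in measurable X]setTI; exact: (mf measurableT _ mA).
have PB : P setT = (P (uniform_map @^-1` B) + P (uniform_map @^-1` (~` B)))%E.
  rewrite -measureU//; [|exact: mfB|exact: mfB|].
    by rewrite -preimage_setU setUv preimage_setT.
  by rewrite -preimage_setI setICr preimage_set0.
have fC : P (uniform_map @^-1` (~` B)) \is a fin_num by rewrite fin_num_measure//; exact: mfB.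
rewrite -(leeD2rE _ _ fC) -PB PT.
apply: (@le_trans _ _ (hausdorff d (cube l `&` B) + hausdorff d (cube l `&` ~` B))%E).
  by rewrite -{1}[cube l]setIT -(setUv B) setIUr; exact: hausdorffU2.
by rewrite leeD2l// le.
Qed.

End uniform_map.

(** * The branching pattern *)

Section lipschitz_paths.
Context {R : realType}.
Variables (m : nat) (f : R -> 'rV[R]_m) (L : R).
Hypothesis lipf : forall s t, enorm (f s - f t) <= L * `|s - t|.

Lemma lipschitz_path_ac : 0 < L -> absolutely_continuous_path f.
Proof.
move=> L0 e e0; exists (e / L); first by rewrite divr_gt0.
move=> k a b ab _; rewrite ltr_pdivlMr//; apply: le_lt_trans.
rewrite mulr_suml; apply: ler_sum => i _; apply: le_trans (lipf _ _) _.
by rewrite mulrC ger0_norm// subr_ge0; have [] := ab i.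
Qed.

(** Test against the derivative v itself: the derivative of v . f is |v|^2, and
    its difference quotients are at most |v| L. Where f is not differentiable,
    [derive1] has the default value 0. *)
Lemma lipschitz_path_speed t : 0 <= L -> enorm (derive1 f t) <= L.
Proof.
move=> L0; have [df|ndf] := pselect (derivable f t 1); last first.
  rewrite derive1E /derive dvgP// (_ : point = 0) ?enorm0//.
  by apply/rowP => i; rewrite !mxE.
set v := derive1 f t.
have [->|v0] := eqVneq (enorm v) 0; first exact: L0.
have vgt0 : 0 < enorm v by rewrite lt0r v0 enorm_ge0.
suff : enorm v * enorm v <= enorm v * L by rewrite ler_pM2l.
rewrite -expr2 sqr_enorm.
have dfi i : derivable (fun s => f s 0 i) t 1.
  by have /derivable_mxP := df; exact.
have vE i : v 0 i = 'D_1 (fun s => f s 0 i) t.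
  by rewrite /v derive1E (derive_mx df) mxE.
pose phi : R -> R := \sum_i (v 0 i *: (fun s => f s 0 i)).
have dphi : derivable phi t 1.
  by apply: derivable_sum => i; apply: derivableZ.
have -> : \sum_i v 0 i ^+ 2 = 'D_1 phi t.
  rewrite derive_sum; last by move=> i; apply: derivableZ.
  by apply: eq_bigr => i _; rewrite deriveZ// vE.
have cvgphi := dphi; apply: (cvgr_to_le cvgphi).
near=> h; have h0 : h != 0 by near: h; exact: nbhs_dnbhs_neq.
rewrite /= -[h%:A]/(h * 1) mulr1.
have -> : phi (h + t) - phi t = \sum_i v 0 i * (f (h + t) - f t) 0 i.
  rewrite /phi !fct_sumE -sumrB; apply: eq_bigr => i _.
  by rewrite !mxE mulrBr.
apply: le_trans (ler_norm _) _; rewrite normrM normfV.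
rewrite mulrC ler_pdivrMr ?normr_gt0// -mulrA.
apply: (@le_trans _ _ (enorm v * enorm (f (h + t) - f t))); last first.
  rewrite ler_pM2l//; have := lipf (h + t) t.
  by rewrite addrK.
rewrite ler_norml dot_le_enorm andbT lerNl -sumrN -(enormN v).
apply: le_trans (dot_le_enorm _ _); apply: ler_sum => i _.
by rewrite !mxE mulNr.
Unshelve. all: by end_near. Qed.

End lipschitz_paths.

Section branching_pattern.
Context {R : realType} (d : nat) (a : 'rV[R]_d) (Q : 'M[R]_d) (l : R) (k : nat).
Hypotheses (QQ : Q *m Q^T = 1%:M) (l0 : 0 < l).

(** The merging scale at height t, in units of the side of the cube: 0 on both
    faces, where each particle sits at its own endpoint, and 2^(-k) at mid
    height. *)
Definition spread (t : R) : R := 2 / 2 ^+ k * Num.min t (1 - t).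

(** The same point of the cube is approached at both faces; particles merge on
    the way up to mid height and separate again above it. *)
Definition branching_path (b : nat -> bool) (t : R) : 'rV[R]_(d + 1) :=
  square_embedding a Q t (\row_i (l * branch k (channel i b) (spread t))).

(** Slope at most l * (2 / 2 ^+ k) in each of the d horizontal directions, and
    slope 1 upwards. *)
Definition branching_speed : R :=
  Num.sqrt (d%:R * (l * (2 / 2 ^+ k)) ^+ 2 + 1).

Lemma branching_speed_gt0 : 0 < branching_speed.
Proof.
by rewrite sqrtr_gt0 ltr_wpDl// mulr_ge0// sqr_ge0.
Qed.

Lemma spread_lipschitz s t : `|spread s - spread t| <= 2 / 2 ^+ k * `|s - t|.
Proof.
have c0 : 0 <= 2 / 2 ^+ k :> R by rewrite divr_ge0 ?exprn_ge0.
rewrite /spread -mulrBr normrM (ger0_norm c0) ler_wpM2l// ler_norml.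
have := ler_norm (s - t); have := ler_norm (t - s); rewrite (distrC t) => h1 h2.
by case: (leP s (1 - s)) => ?; case: (leP t (1 - t)) => ?; apply/andP; split; lra.
Qed.

Lemma branching_path_lipschitz b s t :
  enorm (branching_path b s - branching_path b t) <= branching_speed * `|s - t|.
Proof.
rewrite -(@ler_pXn2r _ 2) ?nnegrE ?mulr_ge0 ?enorm_ge0 ?(ltW branching_speed_gt0)//.
have -> : (branching_speed * `|s - t|) ^+ 2 =
    (d%:R * (l * (2 / 2 ^+ k)) ^+ 2 + 1) * `|s - t| ^+ 2.
  rewrite exprMn sqr_sqrtr//; apply: addr_ge0 => //.
  by apply: mulr_ge0 => //; exact: sqr_ge0.
rewrite /branching_path /square_embedding opp_row_mx add_row_mx sqr_enorm_row_mx.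
rewrite [leRHS]mulrDl mul1r; apply: lerD; last first.
  by rewrite sqr_enorm big_ord1 !mxE real_normK ?num_real.
rewrite opprD addrACA subrr add0r -mulmxBl enorm_isometry// sqr_enorm.
rewrite -mulrA -[d in d%:R]card_ord -sum1_card natr_sum mulr_suml.
apply: ler_sum => i _; rewrite mul1r !mxE -mulrBr -exprMn -mulrA.
have c0 : 0 <= l * (2 / 2 ^+ k * `|s - t|).
  by rewrite !mulr_ge0 ?invr_ge0 ?exprn_ge0 ?(ltW l0).
rewrite -[leLHS]real_normK ?num_real// ler_pXn2r ?nnegrE//.
rewrite normrM (gtr0_norm l0) ler_pM2l//.
by apply: le_trans (branch_lipschitz _ _ _ _) _; exact: spread_lipschitz.
Qed.

Lemma branching_path_end b (t : R) : Num.min t (1 - t) = 0 ->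
  branching_path b t =
  square_embedding a Q t (\row_i (l * digit_value (channel i b))).
Proof.
move=> t01; congr square_embedding; apply/rowP => i.
by rewrite !mxE /spread t01 mulr0 branch0.
Qed.

Lemma branching_path_coarse b b' N t : (k <= N)%N ->
  (forall n, (n < N * d)%N -> b n = b' n) -> (2 ^+ N)^-1 <= spread t ->
  branching_path b t = branching_path b' t.
Proof.
move=> kN bb Nt; congr square_embedding; apply/rowP => i; rewrite !mxE.
by congr (_ * _); apply: branch_coarse kN _ Nt; exact: channel_eq.
Qed.

End branching_pattern.

Section branching_measurability.
Context {R : realType} dT (T : measurableType dT).
Variables (d : nat) (a : 'rV[R]_d) (Q : 'M[R]_d) (l : R) (k : nat).

Lemma measurable_square_embedding (D : set T) (c : T -> R)
    (y : T -> borel 'rV[R]_d) :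
  measurable_fun D c -> measurable_fun D y ->
  measurable_fun D (fun p => square_embedding a Q (c p) (y p) : borel 'rV[R]_(d + 1)).
Proof.
move=> mc my; apply: measurable_fun_rV => i; rewrite /square_embedding.
case: (splitP i) => j ij.
  have -> : i = lshift 1 j by apply: val_inj.
  rewrite (_ : (fun x => _) = (fun p => a 0 j + \sum_s (y p : 'rV[R]_d) 0 s * Q s j)).
    apply: measurable_funD => //; apply: measurable_sum => s.
    by apply: measurable_funM => //; exact: measurable_coord_fun.
  by apply/funext => p; rewrite row_mxEl !mxE.
have -> : i = rshift d j by apply: val_inj.
rewrite (_ : (fun x => _) = c)//.
by apply/funext => p; rewrite row_mxEr mxE.
Qed.

Lemma measurable_branching_path (D : set T) (bit : T -> nat -> bool) (t : T -> R) :
  (forall n, measurable_fun D (bit^~ n)) -> measurable_fun D t ->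
  measurable_fun D (fun p => branching_path a Q l k (bit p) (t p) : borel 'rV[R]_(d + 1)).
Proof.
move=> mb mt; apply: measurable_square_embedding => //.
apply: measurable_fun_rV => i.
rewrite (_ : (fun x => _) =
  (fun p => l * branch k (channel i (bit p)) (spread k (t p)))); last first.
  by apply/funext => p; rewrite mxE.
apply: measurable_funM => //; apply: measurable_branch => //.
  by move=> n; exact: mb.
apply: measurable_funM => //; apply: measurable_minr => //.
exact: measurable_funB.
Qed.

End branching_measurability.

(** * Energy of the branching pattern *)

Section lower_integral.
Local Open Scope ereal_scope.
Context d (T : measurableType d) {R : realType} (mu : {measure set T -> \bar R}).

(** The cost density is defined by an outer measure, and its measurability is
    unclear. The integral of a nonnegative function is a supremum over simple
    functions below it, hence monotone in any case. *)
Lemma le_integral_nonmeasurable (D : set T) (f g : T -> \bar R) :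
  (forall x, D x -> 0 <= f x) -> (forall x, D x -> f x <= g x) ->
  \int[mu]_(x in D) f x <= \int[mu]_(x in D) g x.
Proof.
move=> f0 fg; rewrite !ge0_integralE//; last first.
  by move=> x Dx; rewrite (le_trans (f0 x Dx))// fg.
apply: le_ereal_sup => _ [h /= hf <-]; exists h => //= x.
apply: le_trans (hf x) _; rewrite /patch; case: ifPn => // /set_mem; exact: fg.
Qed.

End lower_integral.

Section tonelli_time.
Local Open Scope ereal_scope.
Context d (T : measurableType d) {R : realType}.
Variable P : {finite_measure set T -> \bar R}.
Notation lambda := (@lebesgue_measure R).

Lemma integral_time_function (G : R -> \bar R) :
  measurable_fun setT G -> (forall t, 0 <= G t) ->
  \int[P \x lambda]_(z in [set: T] `*` `[0%R, 1%R]) G z.2 =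
  (\int[lambda]_(t in `[0%R, 1%R]) G t) * P setT.
Proof.
move=> mG G0; rewrite integral_mkcond.
have -> : ((fun z : T * R => G z.2) \_ ([set: T] `*` `[0%R, 1%R])) =
    (fun z => (G \_ `[0%R, 1%R]) z.2).
  apply/funext => -[p t]; rewrite /patch /=.
  suff -> : ((p, t) \in [set: T] `*` `[0%R, 1%R]%classic) =
            (t \in `[0%R, 1%R]%classic) by [].
  by apply/idP/idP; rewrite !inE /=; [case|split].
rewrite fubini_tonelli1//=; last first.
- by move=> z; rewrite /patch; case: ifPn.
- apply: measurableT_comp => //.
  apply/(measurable_restrictT _ _).1; first exact: measurable_itv.
  exact: measurable_funTS.
rewrite /fubini_F /= integral_cst//; congr (_ * _).
by rewrite [RHS]integral_mkcond.
Qed.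

End tonelli_time.

Section branching_energy.
Context {R : realType} {T : completeMetricType R}.
Variable P : {finite_measure set (borel T) -> \bar R}.
Variables (d : nat) (a : 'rV[R]_d) (Q : 'M[R]_d) (l : R) (k : nat).
Variable bit : borel T -> nat -> bool.
Hypotheses (d0 : (0 < d)%N) (QQ : Q *m Q^T = 1%:M) (l0 : 0 < l).
Hypothesis PT : P setT = hausdorff d (@cube R d l).
Hypothesis bitP : fair_bits P bit.

Let A : set 'rV[R]_d := [set a + u *m Q | u in cube l].
Let chi p t := branching_path a Q l k (bit p) t.

Lemma branching_irrigation_pattern : irrigation_pattern P chi.
Proof.
split.
  apply: measurable_funTS; apply: measurable_branching_path; last first.
    exact: measurable_snd.
  move=> n; apply: (measurableT_comp (measurable_bit bitP n)).
  exact: measurable_fst.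
apply: aeW => p; apply: lipschitz_path_ac (branching_speed_gt0 d l k).
exact: branching_path_lipschitz.
Qed.

Lemma branching_admissible : admissible P A chi.
Proof.
have H (c : R) (B : set (borel 'rV[R]_(d + 1))) : Num.min c (1 - c) = 0 ->
    measurable B ->
    P ((fun p => chi p c) @^-1` B) = hausdorff d (B `&` at_height A c).
  move=> c01 mB; rewrite hausdorff_at_height//.
  rewrite -(uniform_map_distribution d0 l0 PT bitP); last first.
    rewrite -[X in measurable X]setTI.
    by apply: (@measurable_square_embedding _ _ _ _ a Q setT (fun=> c) id) => //.
  congr (P _); apply/seteqP; split => p; rewrite /preimage /= /chi branching_path_end//.
move=> B mB; split; apply: H => //.
  by rewrite subr0 min_l.
by rewrite subrr min_r.
Qed.

(** At height t the particle p is together with all particles that share its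
    first N d tosses. *)
Lemma branching_multiplicity p t N : 0 <= t <= 1 -> (k <= N)%N ->
  (2 ^+ N)^-1 <= spread k t ->
  ((fine (P setT) / 2 ^+ (N * d))%:E <= multiplicity P chi (chi p t))%E.
Proof.
move=> t01 kN Nt; have [mZ <-] := bitP (bit p) (N * d).
rewrite /multiplicity -(measurable_mu_extE P mZ).
apply: le_mu_ext => q /= qp; exists t => //=.
apply: (branching_path_coarse a Q l kN _ Nt) => n; exact: qp.
Qed.

End branching_energy.

Section endpoint_weight.
Context {R : realType}.
Notation lambda := (@lebesgue_measure R).

Lemma expR_chord (theta x : R) : 0 <= theta <= 1 ->
  expR (theta * x) <= 1 + theta * (expR x - 1).
Proof.
move=> /andP[t0 t1]; have := convex_expR (Itv01 t0 t1) x 0.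
rewrite !convRE/= expR0 /unstable.onem mulr0 addr0 mulr1; lra.
Qed.

(** At distance about 2^(-j) from the ends the bundles are thinner by the factor
    2^(-j d), which raises the cost by the left-hand side. By convexity of the
    exponential function, theta can be taken out at the price of the growth
    (3/2)^j, which is integrable over these times. *)
Lemma power_growth (d j : nat) (eps theta : R) : 0 <= eps -> theta <= 1 ->
  2 * d%:R * eps <= theta ->
  (2 ^+ (j * d)) `^ eps <= 1 + theta * (3 / 2) ^+ j.
Proof.
move=> e0 t1 dt; have t0 : 0 <= theta by apply: le_trans dt; rewrite !mulr_ge0.
have ln23 : ln (2 : R) <= 2 * ln (3 / 2).
  have -> : 2 * ln (3 / 2) = ln ((3 / 2) ^+ 2) :> R by rewrite lnXn ?mulr_natl.
  by rewrite ler_ln ?posrE//; lra.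
have ln320 : 0 <= ln (3 / 2 : R) by apply: ln_ge0; lra.
rewrite /powR gt_eqF ?exprn_gt0// lnXn//.
apply: (@le_trans _ _ (expR (theta * (ln ((3 / 2) ^+ j))))).
  rewrite ler_expR lnXn//.
  have -> : ln 2 *+ (j * d) = j%:R * d%:R * ln 2 :> R by rewrite -[LHS]mulr_natl natrM.
  have -> : ln (3 / 2) *+ j = j%:R * ln (3 / 2) :> R by rewrite -[LHS]mulr_natl.
  have jd : 0 <= eps * (j%:R * d%:R) by rewrite !mulr_ge0.
  have jl : 0 <= j%:R * ln (3 / 2 : R) by rewrite mulr_ge0.
  have := ler_wpM2l jd ln23; have := ler_wpM2r jl dt; nra.
apply: le_trans (expR_chord _ _) _; first by rewrite t0.
by rewrite lnK ?posrE ?exprn_gt0// lerD2l ler_wpM2l// gerBl.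
Qed.

Definition near_ends (j : nat) : set R := [set t | Num.min t (1 - t) <= (2 ^+ j)^-1].

Lemma measurable_near_ends j : measurable (near_ends j).
Proof.
rewrite -[X in measurable X]setTI.
have mm : measurable_fun setT (fun t : R => Num.min t (1 - t)).
  by apply: measurable_minr => //; exact: measurable_funB.
have := mm measurableT `]-oo, (2 ^+ j)^-1]%classic (measurable_itv _).
by congr (measurable (_ `&` _)); apply/seteqP; split => t; rewrite /near_ends /= in_itv/=.
Qed.

(** A stand-in for the distance to the ends to the power -log2(3/2), whose
    integral is a geometric series. *)
Definition endpoint_weight (t : R) : \bar R :=
  (\sum_(j <oo) (((3 / 2 : R) ^+ j)%:E * (\1_(near_ends j) t)%:E))%E.

Let term_ge0 (j : nat) (t : R) : (0 <= ((3 / 2 : R) ^+ j)%:E * (\1_(near_ends j) t)%:E)%E.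
Proof. by rewrite -EFinM lee_fin mulr_ge0// exprn_ge0// divr_ge0. Qed.

Let measurable_term (D : set R) j :
  measurable_fun D (fun t => (((3 / 2 : R) ^+ j)%:E * (\1_(near_ends j) t)%:E)%E).
Proof.
apply: measurable_funeM; apply/measurable_EFinP; apply: measurable_indic.
exact: measurable_near_ends.
Qed.

Lemma endpoint_weight_ge0 t : (0 <= endpoint_weight t)%E.
Proof. by apply: nneseries_ge0 => j _ _; exact: term_ge0. Qed.

Lemma measurable_endpoint_weight : measurable_fun setT endpoint_weight.
Proof.
apply: ge0_emeasurable_sum => j *; [exact: term_ge0|exact: measurable_term].
Qed.

Lemma endpoint_weight_ge j t : near_ends j t ->
  (((3 / 2 : R) ^+ j)%:E <= endpoint_weight t)%E.
Proof.
move=> jt; rewrite /endpoint_weight (nneseries_split 0 j.+1)//.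
rewrite add0n big_mkord big_ord_recr/= indicE mem_set// mule1.
rewrite addeAC leeDr// adde_ge0//; first exact: sume_ge0.
by apply: nneseries_ge0 => n _ _; exact: term_ge0.
Qed.

(** At the ends themselves bundles may have mass 0 and infinite cost, which the
    weight has to dominate. *)
Lemma endpoint_weight_ends t : Num.min t (1 - t) = 0 -> endpoint_weight t = +oo%E.
Proof.
move=> t0; apply/eqP; rewrite -leye_eq.
suff H (n : nat) : (n%:R%:E <= endpoint_weight t)%E.
  case E : (endpoint_weight t) H => [r| |] H //.
    have := H (Num.bound r); rewrite lee_fin leNgt archi_boundP//.
    by rewrite -lee_fin -E endpoint_weight_ge0.
  by have := endpoint_weight_ge0 t; rewrite E.
apply: (@le_trans _ _ (((3 / 2 : R) ^+ n.*2)%:E)); last first.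
  by apply: endpoint_weight_ge; rewrite /near_ends /= t0 invr_ge0 exprn_ge0.
rewrite lee_fin -muln2 mulnC exprM.
apply: (@le_trans _ _ (2 ^+ n)); first by rewrite -natrX ler_nat ltnW// ltn_expl.
by rewrite lerXn2r// ?nnegrE; lra.
Qed.

(** The set [near_ends j] has length at most 2 / 2^j within [0, 1], and 2 *
    (3/4)^j sums up to 8. *)
Lemma integral_endpoint_weight :
  (\int[lambda]_(t in `[0%R, 1%R]) endpoint_weight t <= 8%:E)%E.
Proof.
have m01 : measurable (`[0, 1]%classic : set R) by [].
rewrite integral_nneseries//; last by move=> j; exact: measurable_term.
have termE (j : nat) : (\int[lambda]_(t in `[0%R, 1%R]) (((3 / 2 : R) ^+ j)%:E *
    (\1_(near_ends j) t)%:E) <= (2 * (3 / 4) ^+ j)%:E)%E.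
  rewrite ge0_integralZl//; last first.
    by apply/measurable_EFinP; apply: measurable_indic; exact: measurable_near_ends.
  rewrite integral_indic//; last exact: measurable_near_ends.
  have Ej : (lambda (near_ends j `&` `[0%R, 1%R]%classic) <= (2 * (2 ^+ j)^-1)%:E)%E.
    apply: (@le_trans _ _ (lambda (`[0, (2 ^+ j)^-1]%classic `|`
        `[1 - (2 ^+ j)^-1, 1]%classic : set R))).
      apply: le_measure; rewrite ?inE.
      + by apply: measurableI => //; exact: measurable_near_ends.
      + by apply: measurableU; exact: measurable_itv.
      + move=> t []; rewrite /near_ends /= !in_itv/= ge_min => /orP[tj|tj] /andP[t0 t1].
          by left; rewrite t0.
        by right; rewrite t1 andbT lerBlDr -lerBlDl.
    have e1 : (lambda (`[0%R, ((2 ^+ j)^-1)%R]%classic : set R) <= (2 ^+ j)^-1%:E)%E.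
      by rewrite lebesgue_measure_itv/= lte_fin invr_gt0 exprn_gt0//= oppr0 adde0.
    have e2 : (lambda (`[(1 - (2 ^+ j)^-1)%R, 1%R]%classic : set R) <= (2 ^+ j)^-1%:E)%E.
      rewrite lebesgue_measure_itv/= lte_fin gtrBl invr_gt0 exprn_gt0//=.
      by rewrite -EFinB lee_fin opprB addrC subrK.
    apply: le_trans (measureU2 _ _ _) _; [exact: measurable_itv|exact: measurable_itv|].
    apply: le_trans (leeD e1 e2) _.
    by rewrite -EFinD lee_fin mulr_natl mulr2n.
  apply: le_trans (lee_wpmul2l _ Ej) _; first by rewrite lee_fin exprn_ge0// divr_ge0.
  rewrite -EFinM lee_fin mulrCA ler_pM2l// -exprVn -exprMn.
  by rewrite (_ : 3 / 2 * 2^-1 = 3 / 4 :> R)//; field.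
apply: le_trans (lee_nneseries _ _) _.
- by move=> j _ _; apply: integral_ge0 => t _; exact: term_ge0.
- by move=> j _; exact: termE.
apply: lime_le.
  by apply: is_cvg_nneseries => j _ _; rewrite lee_fin mulr_ge0// exprn_ge0// divr_ge0.
apply: nearW => n; rewrite sumEFin lee_fin.
suff -> : \sum_(0 <= j < n) 2 * (3 / 4) ^+ j = 8 * (1 - (3 / 4) ^+ n) :> R.
  have : 0 <= (3 / 4) ^+ n :> R by rewrite exprn_ge0// divr_ge0.
  lra.
elim: n => [|n ih]; first by rewrite big_geq// expr0 subrr mulr0.
by rewrite big_nat_recr//= ih exprS; field.
Qed.

End endpoint_weight.

Section branching_energy_bound.
Context {R : realType} {T : completeMetricType R}.
Variable P : {finite_measure set (borel T) -> \bar R}.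
Variables (d : nat) (a : 'rV[R]_d) (Q : 'M[R]_d) (l : R) (k : nat).
Variable bit : borel T -> nat -> bool.
Hypotheses (d0 : (0 < d)%N) (QQ : Q *m Q^T = 1%:M) (l0 : 0 < l).
Hypothesis PT : P setT = hausdorff d (@cube R d l).
Hypothesis bitP : fair_bits P bit.
Hypothesis M0 : 0 < fine (P setT).

Let A : set 'rV[R]_d := [set a + u *m Q | u in cube l].
Let chi p t := branching_path a Q l k (bit p) t.
Let M := fine (P setT).

Variables (eps theta : R).
Hypotheses (eps0 : 0 <= eps) (theta0 : 0 < theta) (theta1 : theta <= 1).
Hypothesis eps_theta : 2 * d%:R * eps <= theta.

Let K := (M / 2 ^+ (k * d)) `^ (- eps).

Let two0 n : 0 < 2 ^+ n :> R. Proof. by rewrite exprn_gt0. Qed.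

Lemma cost_density_le (chi' : borel T -> R -> 'rV[R]_(d + 1)) x c : 0 < c ->
  (c%:E <= multiplicity P chi' x)%E ->
  (cost_density P eps chi' x <= (c `^ (- eps))%:E)%E.
Proof.
move=> c0 cm; have m0 : (0 < multiplicity P chi' x)%E.
  by apply: lt_le_trans cm; rewrite lte_fin.
rewrite /cost_density m0.
have mM : (multiplicity P chi' x <= P setT)%E.
  rewrite -(measurable_mu_extE P measurableT); exact: le_mu_ext.
have mfin : multiplicity P chi' x \is a fin_num.
  rewrite ge0_fin_numE ?ltW// (le_lt_trans mM)// -ge0_fin_numE//.
  exact: fin_num_measure.
rewrite -(fineK mfin) poweR_EFin lee_fin.
rewrite -(fineK mfin) lee_fin in cm.
rewrite !powRN lef_pV2 ?posrE ?powR_gt0//; last exact: lt_le_trans cm.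
by rewrite ge0_ler_powR// nnegrE ltW// (lt_le_trans c0).
Qed.

(** Take the least j with 2^(-j) <= 2 s, where s is the distance of t to the
    ends. *)
Lemma branching_scale (t : R) : 0 < Num.min t (1 - t) -> t <= 1 ->
  exists j, near_ends j t /\ (2 ^+ (k + j))^-1 <= spread k t.
Proof.
move=> s0 t1; set s := Num.min t (1 - t) in s0 *.
have s12 : 2 * s <= 1 by rewrite /s; case: (leP t (1 - t)) => ?; lra.
have ex : exists j, (2 ^+ j)^-1 <= 2 * s.
  exists (Num.bound (2 * s)^-1); rewrite invf_ple ?posrE ?mulr_gt0//.
  rewrite ltW// (lt_trans (archi_boundP _)) ?invr_ge0 ?mulr_ge0 1?ltW//.
  by rewrite -natrX ltr_nat ltn_expl.
have [j hj minj] := ex_minnP ex; exists j; split; last first.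
  by rewrite /spread -/s exprD invfM [leRHS]mulrAC [leLHS]mulrC ler_pM2r ?invr_gt0.
rewrite /near_ends /= -/s; case: j hj minj => [|j] hj minj.
  by rewrite expr0 invr1; lra.
rewrite leNgt; apply/negP => hs.
have : (2 ^+ j)^-1 <= 2 * s.
  by rewrite (@invr_two_split R j); lra.
by move=> /minj; rewrite ltnn.
Qed.

(** The speed is at most [branching_speed]; the multiplicity is at least M /
    2^((k + j) d), with 2^(-j) comparable to the distance of t to the ends. *)
Lemma branching_cost_le p t : 0 <= t <= 1 ->
  (cost_density P eps chi (chi p t) * (enorm (derive1 (chi p) t))%:E <=
   (branching_speed d l k * K)%:E * (1 + theta%:E * endpoint_weight t))%E.
Proof.
move=> /andP[t0 t1].
have K0 : 0 < K by rewrite powR_gt0// divr_gt0.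
have L0 : 0 < branching_speed d l k by exact: branching_speed_gt0.
have s0 : 0 <= Num.min t (1 - t) by rewrite le_min t0 subr_ge0.
have [st|st] := eqVneq (Num.min t (1 - t)) 0.
  rewrite endpoint_weight_ends// gt0_muley ?lte_fin// addey//.
  by rewrite gt0_muley ?leey// lte_fin mulr_gt0.
have {s0 st} s0 : 0 < Num.min t (1 - t) by rewrite lt0r st.
have [j [jt jspread]] := branching_scale s0 t1.
pose c := M / 2 ^+ ((k + j) * d).
have c0 : 0 < c by rewrite divr_gt0.
have cm : (c%:E <= multiplicity P chi (chi p t))%E.
  by apply: branching_multiplicity => //; rewrite ?t0 ?leq_addr.
have cE : c `^ (- eps) = K * (2 ^+ (j * d)) `^ eps.
  have x0 : 0 <= M / 2 ^+ (k * d) by rewrite divr_ge0// ?ltW.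
  have y0 : 0 <= (2 ^+ (j * d) : R) by rewrite ltW.
  rewrite /c mulnDl exprD invfM mulrA powRM// ?invr_ge0//; congr (_ * _).
  by rewrite -(powR_inv1 y0) -powRrM mulN1r opprK.
apply: (@le_trans _ _ ((K * (1 + theta * (3 / 2) ^+ j))%:E *
    (branching_speed d l k)%:E)%E).
  apply: lee_pmul.
  - rewrite /cost_density; case: ifPn => // _; exact: poweR_ge0.
  - by rewrite lee_fin enorm_ge0.
  - apply: le_trans (cost_density_le c0 cm) _.
    by rewrite lee_fin cE ler_pM2l// power_growth.
  - rewrite lee_fin; apply: lipschitz_path_speed; last exact: ltW.
    exact: branching_path_lipschitz.
rewrite -EFinM (_ : _ * _ * _ = branching_speed d l k * K *
  (1 + theta * (3 / 2) ^+ j)); last by ring.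
rewrite EFinM; apply: lee_wpmul2l; first by rewrite lee_fin ltW// mulr_gt0.
rewrite EFinD leeD2l// EFinM; apply: lee_wpmul2l; first by rewrite lee_fin ltW.
exact: endpoint_weight_ge.
Qed.

Lemma branching_energy_le :
  (energy P A eps chi <=
   (M * branching_speed d l k * K * (1 + 8 * theta))%:E)%E.
Proof.
have K0 : 0 < K by rewrite powR_gt0// divr_gt0.
have L0 : 0 < branching_speed d l k by exact: branching_speed_gt0.
have Kc : (0 <= (branching_speed d l k * K)%:E)%E.
  by rewrite lee_fin mulr_ge0 ?ltW.
have w0 t : (0 <= 1 + theta%:E * endpoint_weight t)%E.
  by rewrite adde_ge0 ?mule_ge0 ?lee_fin ?endpoint_weight_ge0 ?ltW.
have mw : measurable_fun setT (fun t => (1 + theta%:E * endpoint_weight t)%E).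
  apply: emeasurable_funD => //; apply: measurable_funeM.
  exact: measurable_endpoint_weight.
rewrite /energy asboolT; last exact: branching_admissible.
apply: (@le_trans _ _ (\int[P \x @lebesgue_measure R]_(z in space_time)
    ((branching_speed d l k * K)%:E * (1 + theta%:E * endpoint_weight z.2)))%E).
  apply: le_integral_nonmeasurable => -[p t] [_ /=]; rewrite in_itv/= => t01.
    rewrite mule_ge0 ?lee_fin ?enorm_ge0// /cost_density.
    by case: ifPn => // _; exact: poweR_ge0.
  exact: branching_cost_le.
rewrite (integral_time_function P (G := fun t =>
  (branching_speed d l k * K)%:E * (1 + theta%:E * endpoint_weight t))%E); last first.
- by move=> t; rewrite mule_ge0.
- exact: measurable_funeM.
rewrite -(@fineK _ (P setT)) ?fin_num_measure//.
rewrite ge0_integralZl//; last exact: measurable_funTS.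
rewrite muleAC -EFinM (_ : M * _ * K * _ =
  branching_speed d l k * K * fine (P setT) * (1 + 8 * theta)); last first.
  by rewrite -/M; ring.
rewrite [leRHS]EFinM; apply: lee_wpmul2l.
  by rewrite lee_fin !mulr_ge0// ltW.
rewrite ge0_integralD//; last 2 first.
- by move=> t _; rewrite mule_ge0 ?endpoint_weight_ge0// lee_fin ltW.
- by apply: measurable_funTS; apply: measurable_funeM; exact: measurable_endpoint_weight.
rewrite integral_cst//= lebesgue_measure_itv/= lte_fin ltr01 oppr0 adde0 mule1.
rewrite EFinD leeD2l// mulrC EFinM.
rewrite ge0_integralZl//; last 3 first.
- by apply: measurable_funTS; exact: measurable_endpoint_weight.
- by move=> t _; exact: endpoint_weight_ge0.
- by rewrite lee_fin ltW.
by apply: lee_wpmul2l; [rewrite lee_fin ltW|exact: integral_endpoint_weight].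
Qed.

Lemma min_energy_le_branching :
  (min_energy P A eps <=
   (M * branching_speed d l k * K * (1 + 8 * theta))%:E)%E.
Proof.
apply: le_trans branching_energy_le; apply: ereal_inf_lbound.
by exists chi => //; exact: branching_irrigation_pattern.
Qed.

End branching_energy_bound.

(** * Joint measurability of the speed *)

Section rational_difference_quotients.
Context {R : realType}.
Implicit Types y : R -> R.

Definition difference_quotient y (t h : R) : R := (y (t + h) - y t) / h.

Definition small_increment (j : nat) (h : R) : Prop := 0 < `|h| < j.+1%:R^-1.

(** The Cauchy criterion for the difference quotients with rational increments.
    For continuous functions it is equivalent to differentiability, and it
    consists of countably many conditions, each of them measurable in particle
    and time. *)
Definition rational_derivable y (t : R) : Prop :=
  forall k, exists j, forall q q' : rat,
    small_increment j (ratr q) -> small_increment j (ratr q') ->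
    `|difference_quotient y t (ratr q) - difference_quotient y t (ratr q')|
      <= k.+1%:R^-1.

Lemma derivable_rational y t : derivable y t 1 -> rational_derivable y t.
Proof.
move=> /cvg_ex[l dl] k.
have k0 : 0 < (k.+1%:R^-1 / 2 : R) by rewrite divr_gt0 ?invr_gt0.
move/cvgrPdist_le : dl => /(_ _ k0)[/= r r0 rP].
have [j] := ltr_add_invr r0; rewrite add0r => jr; exists j.
have H h : small_increment j h -> `|l - difference_quotient y t h| <= k.+1%:R^-1 / 2.
  move=> /andP[h0 hj]; have := rP h; rewrite /ball_ /= sub0r normrN.
  move=> /(_ (lt_trans hj jr)); rewrite -normr_gt0 => /(_ h0).
  by rewrite /difference_quotient -[h%:A]/(h * 1) mulr1 (addrC h) -[_ *: _]/(_ * _) mulrC.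
move=> q q' /H Hq /H Hq'.
rewrite -(subrKA l) (le_trans (ler_normD _ _))//.
by rewrite [leRHS]splitr lerD// distrC.
Qed.

Lemma rational_derivable_real y t k j : continuous y ->
  (forall q q' : rat,
    small_increment j (ratr q) -> small_increment j (ratr q') ->
    `|difference_quotient y t (ratr q) - difference_quotient y t (ratr q')|
      <= k.+1%:R^-1) ->
  forall h h' : R, small_increment j h -> small_increment j h' ->
    `|difference_quotient y t h - difference_quotient y t h'| <= k.+1%:R^-1.
Proof.
move=> cy H.
have cD h : h != 0 -> difference_quotient y t x @[x --> h] --> difference_quotient y t h.
  move=> h0; apply: cvgM; last by apply: cvgV => //; exact: cvg_id.
  apply: cvgB; last exact: cvg_cst.
  by apply: continuous_cvg; [exact: cy|apply: cvgD; [exact: cvg_cst|exact: cvg_id]].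
have dense (h : R) (e : R) : small_increment j h -> 0 < e ->
    exists q : rat, small_increment j (ratr q) /\
      `|difference_quotient y t h - difference_quotient y t (ratr q)| < e.
  move=> hj e0; have [h0 hj'] := andP hj; rewrite normr_gt0 in h0.
  have near_e : \forall x \near h, `|difference_quotient y t h - difference_quotient y t x| < e.
    exact: ((cvgrPdist_lt _ _).1 (cD h h0)).
  have near_j : \forall x \near h, small_increment j x.
    have : `|x| @[x --> h] --> `|h| by apply: norm_continuous.
    move=> cn; near=> x; apply/andP; split.
      by near: x; apply: (cvgr_gt _ cn); rewrite normr_gt0.
    by near: x; apply: (cvgr_lt _ cn).
  have [r /= r0 rP] := filterI near_e near_j.
  have hr : h - r < h + r by rewrite ltrD2l gtrN.
  have [q] := rat_in_itvoo hr; rewrite in_itv/= => /andP[q1 q2].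
  exists q; have [|? ?] := rP (ratr q); last by split.
  by rewrite /ball_ /= ltr_norml; apply/andP; split; lra.
move=> h h' hj hj'; apply/ler_addgt0Pr => e e0.
have e20 : 0 < e / 2 by rewrite divr_gt0.
have [q [qj hq]] := dense h _ hj e20; have [q' [qj' hq']] := dense h' _ hj' e20.
have aux (x1 x2 x3 x4 K e' : R) : `|x2 - x3| <= K -> `|x1 - x2| < e' / 2 ->
    `|x4 - x3| < e' / 2 -> `|x1 - x4| <= K + e'.
  rewrite !ltr_norml !ler_norml.
  by move=> /andP[? ?] /andP[? ?] /andP[? ?]; apply/andP; split; lra.
exact: aux (H q q' qj qj') hq hq'.
Unshelve. all: by end_near. Qed.

Lemma rational_derivable_derivable y t : continuous y ->
  rational_derivable y t -> derivable y t 1.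
Proof.
move=> cy ry; apply: cauchy_cvg; apply/cauchyP => /= e e0.
have [k] := ltr_add_invr e0; rewrite add0r => ke.
have [j /(rational_derivable_real cy) H] := ry k.
pose h0 : R := (j.+1%:R^-1) / 2.
have h00 : small_increment j h0.
  rewrite /small_increment gtr0_norm ?divr_gt0 ?invr_gt0//=.
  by rewrite ltr_pdivrMr// ltr_pMr ?invr_gt0// ltr1n.
exists (difference_quotient y t h0).
suff : \forall h \near (0 : R)^',
    ball (difference_quotient y t h0) e (h^-1 *: (y (h *: 1 + t) - y t)) by [].
near=> h.
have hj : small_increment j h.
  apply/andP; split.
    by rewrite normr_gt0; near: h; exact: nbhs_dnbhs_neq.
  near: h; apply: dnbhs0_lt; by rewrite invr_gt0.
have := H h0 h h00 hj; rewrite /ball /=.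
rewrite [in X in X -> _]/(difference_quotient y t h) => /le_lt_trans /(_ ke).
by rewrite -[h%:A]/(h * 1) mulr1 (addrC h) -[_ *: _]/(_ * _) mulrC.
Unshelve. all: by end_near. Qed.

End rational_difference_quotients.

Section measurable_speed.
Context {R : realType} dT (T : measurableType dT) (m : nat).
Variables (chi : T -> R -> 'rV[R]_m) (G : set T).
Hypothesis mchi : measurable_fun ([set: T] `*` `[0%R, 1%R]%classic : set (T * measurableTypeR R))
  (fun z : T * measurableTypeR R => chi z.1 z.2 : borel 'rV[R]_m).
Hypothesis mG : measurable G.
Hypothesis acG : forall p, G p -> absolutely_continuous_path (chi p).

Let coord i p (s : R) : R := chi p (clamp s) 0 i.

Let measurable_clamp : measurable_fun setT (@clamp R).
Proof.
by apply: measurable_maxr => //; apply: measurable_minr.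
Qed.

Let measurable_coord i (h : R) :
  measurable_fun setT (fun z : T * measurableTypeR R => coord i z.1 (z.2 + h)).
Proof.
apply: (measurable_coord_fun
  (f := fun z : T * measurableTypeR R => chi z.1 (clamp (z.2 + h))) i).
have -> : (fun z : T * measurableTypeR R => chi z.1 (clamp (z.2 + h)) : borel 'rV[R]_m) =
  (fun z : T * measurableTypeR R => chi z.1 z.2 : borel 'rV[R]_m) \o
  (fun z : T * measurableTypeR R => (z.1, clamp (z.2 + h) : measurableTypeR R)) by [].
apply: (measurable_comp _ _ mchi).
- by apply: measurableX => //; exact: measurable_itv.
- by move=> _ [z _ <-]; split => //=; rewrite in_itv/= clamp01.
apply: measurable_fun_pair; first exact: measurable_fst.
by apply: (measurableT_comp measurable_clamp); exact: measurable_funD.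
Qed.

Let quotient i h (z : T * measurableTypeR R) := difference_quotient (coord i z.1) z.2 h.

Let measurable_quotient i h : measurable_fun setT (quotient i h).
Proof.
apply: measurable_funM => //; apply: measurable_funB; first exact: measurable_coord.
have := measurable_coord i 0; congr measurable_fun.
by apply/funext => z; rewrite addr0.
Qed.

Let derivable_set i : set (T * measurableTypeR R) :=
  [set z | rational_derivable (coord i z.1) z.2].

Let measurable_derivable_set i : measurable (derivable_set i).
Proof.
have -> : derivable_set i = \bigcap_k \bigcup_j
    \bigcap_(q in [set: rat]) \bigcap_(q' in [set: rat])
    [set z | small_increment j (ratr q : R) -> small_increment j (ratr q' : R) ->
      `|quotient i (ratr q) z - quotient i (ratr q') z| <= k.+1%:R^-1].
  apply/seteqP; split => [z zd k _|z zd k].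
    by have [j H] := zd k; exists j => // q _ q' _; exact: H.
  have [j _ H] := zd k I; exists j => q q'; exact: H.
apply: bigcapT_measurable => k; apply: bigcupT_measurable => j.
have bigcap_rat (F : rat -> set (T * measurableTypeR R)) :
    (forall q, measurable (F q)) -> measurable (\bigcap_(q in [set: rat]) F q).
  move=> mF; rewrite -[X in measurable X]setCK setC_bigcap; apply: measurableC.
  by apply: bigcupT_measurable_rat => q; exact: measurableC.
apply: (bigcap_rat _) => q; apply: (bigcap_rat _) => q'.
have [sq|sq] := pselect (small_increment j (ratr q : R)); last first.
  rewrite (_ : mkset _ = setT)//.
  by apply/seteqP; split => // z _ /= h; exfalso; exact: sq.
have [sq'|sq'] := pselect (small_increment j (ratr q' : R)); last first.
  rewrite (_ : mkset _ = setT)//.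
  by apply/seteqP; split => // z _ /= _ h; exfalso; exact: sq'.
have mf : measurable_fun setT (fun z => `|quotient i (ratr q) z - quotient i (ratr q') z|).
  by apply: measurableT_comp => //; exact: measurable_funB.
have := mf measurableT `]-oo, k.+1%:R^-1]%classic (measurable_itv _).
rewrite setTI; congr measurable; apply/seteqP; split => z /=; rewrite in_itv/=.
  by move=> H _ _.
by apply.
Qed.

Definition speed_domain : set (T * measurableTypeR R) :=
  [set z | [/\ G z.1, 0 < z.2 < 1 &
    forall i, rational_derivable (fun s => chi z.1 (clamp s) 0 i) z.2]].

Lemma measurable_speed_domain : measurable speed_domain.
Proof.
have -> : speed_domain = (G `*` `]0%R, 1%R[) `&`
    \bigcap_(i in [set: 'I_m]) derivable_set i.
  apply/seteqP; split => [z [Gz z01 dz]|z [[/= Gz z01] dz]].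
    split; first by split => //=; rewrite in_itv.
    by move=> i _; exact: dz.
  split; [exact: Gz|by move: z01; rewrite in_itv|].
  by move=> i; exact: dz.
apply: measurableI; first by apply: measurableX => //; exact: measurable_itv.
apply: fin_bigcap_measurable => // ; exact: finite_finset.
Qed.

Lemma coord_continuous_path i p : G p -> continuous (coord i p).
Proof.
by move=> /acG ac; exact: (ac_clamp_continuous (path_coord_ac ac i)).
Qed.

Lemma speed_domain_derivable z : speed_domain z -> coord_derivable (chi z.1) z.2.
Proof.
move=> [Gz _ dz] i; apply: rational_derivable_derivable; last exact: dz.
exact: coord_continuous_path.
Qed.

Lemma derivable_speed_domain p t : G p -> 0 < t < 1 -> coord_derivable (chi p) t ->
  speed_domain (p, t).
Proof.
by move=> Gp t01 dp; split => //= i; apply: derivable_rational; exact: dp.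
Qed.

(** The speed, set to 0 outside a measurable set that contains almost every time
    in [0, 1] of each path in G. *)
Definition path_speed (z : T * measurableTypeR R) : R :=
  if z \in speed_domain then enorm (derive1 (chi z.1) z.2) else 0.

Lemma path_speed_ge0 z : 0 <= path_speed z.
Proof. by rewrite /path_speed; case: ifPn => // _; exact: enorm_ge0. Qed.

(** On [speed_domain] the derivative is the limit of the difference quotients
    with increments 1 / (n + 1). *)
Lemma measurable_path_speed : measurable_fun setT path_speed.
Proof.
have mD := measurable_speed_domain.
pose F (z : T * measurableTypeR R) : R :=
  Num.sqrt (\sum_i (derive1 (coord i z.1) z.2) ^+ 2).
have -> : path_speed = F \_ speed_domain.
  apply/funext => z; rewrite /path_speed /patch; case: ifPn => // /set_mem zD.
  rewrite derive1_clamp_coord; last 2 first.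
  - by have [] := zD.
  - exact: speed_domain_derivable.
  by rewrite /enorm; congr Num.sqrt; apply: eq_bigr => i _; rewrite mxE.
suff mF : measurable_fun speed_domain F by exact: ((measurable_restrictT F mD).1 mF).
have msqrt : measurable_fun setT (Num.sqrt : R -> R).
  by apply: measurable_realfun.continuous_measurable_fun; exact: sqrt_continuous.
apply: (measurableT_comp msqrt).
apply: measurable_sum => i; apply: measurable_funX.
apply: (measurable_fun_cvg (h := fun n => quotient i (n.+1%:R^-1))).
  by move=> n; apply: measurable_funTS; exact: measurable_quotient.
move=> z zD; have dz : derivable (coord i z.1) z.2 1.
  by have := speed_domain_derivable zD; apply.
have dl : h^-1 *: (coord i z.1 (h *: 1 + z.2) - coord i z.1 z.2) @[h --> (0 : R)^'] -->
    derive1 (coord i z.1) z.2 by rewrite derive1E; exact: dz.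
apply/cvgrPdist_le => e e0; move/cvgrPdist_le : dl => /(_ _ e0)[/= r r0 rP].
have [j] := ltr_add_invr r0; rewrite add0r => jr; exists j => // n /= jn.
have n0 : 0 < n.+1%:R^-1 :> R by rewrite invr_gt0.
have := rP n.+1%:R^-1; rewrite /ball_ /= sub0r normrN gtr0_norm//.
have nr : n.+1%:R^-1 < r.
  by apply: le_lt_trans jr; rewrite lef_pV2 ?posrE// ler_nat ltnS.
move=> /(_ nr); rewrite gt_eqF// => /(_ isT).
rewrite /quotient /difference_quotient -[_%:A]/(_ * 1) mulr1 (addrC z.2).
by rewrite -[_ *: _]/(_ * _) mulrC.
Qed.

End measurable_speed.

(** * Path lengths and multiplicities of a general pattern *)

(** The path is cut at a point at horizontal distance at least r from its start
    and at height s. The first leg has length x, at least the chord; the second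
    leg has length y and still has to climb 1 - s. *)
Lemma detour_length {R : realType} (r s x y : R) : 0 <= r <= 1 -> 0 <= x -> 0 <= y ->
  r ^+ 2 + s ^+ 2 <= x ^+ 2 -> `|1 - s| <= y -> 1 + r ^+ 2 / 3 <= x + y.
Proof.
move=> /andP[r0 r1] x0 y0 rsx; rewrite ler_norml => /andP[sy1 sy2].
rewrite leNgt; apply/negP => h.
have r2 : r ^+ 2 <= 1 by rewrite expr_le1.
have xs : x - r ^+ 2 / 3 < s by lra.
have x43 : x < 4 / 3 by have := sqr_ge0 r; lra.
have [neg|pos] := leP 0 (x - r ^+ 2 / 3); last first.
  have : x ^+ 2 < (r ^+ 2 / 3) ^+ 2 by rewrite ltrXn2r ?nnegrE//; nra.
  by have := sqr_ge0 s; have := sqr_ge0 r; nra.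
have : (x - r ^+ 2 / 3) ^+ 2 < s ^+ 2 by rewrite ltrXn2r ?nnegrE//; lra.
have := sqr_ge0 r; move: (r ^+ 2) (s ^+ 2) r2 rsx xs h neg => u v *.
nra.
Qed.

Definition last_coord {R : realType} d (z : 'rV[R]_(d + 1)) : R :=
  z 0 (rshift d ord0).

Section pattern_lengths.
Context {R : realType} {T : completeMetricType R}.
Variable P : {finite_measure set (borel T) -> \bar R}.
Variables (d : nat) (A : set 'rV[R]_d).
Variable chi : borel T -> R -> 'rV[R]_(d + 1).
Hypothesis pchi : irrigation_pattern P chi.
Hypothesis achi : admissible P A chi.
Notation lambda := (@lebesgue_measure R).

Let measurable_chi (c : R) : 0 <= c <= 1 ->
  measurable_fun setT (fun p => chi p c : borel 'rV[R]_(d + 1)).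
Proof.
move=> c01; have [mchi _] := pchi.
have -> : (fun p => chi p c : borel 'rV[R]_(d + 1)) =
  (fun z : borel T * measurableTypeR R => chi z.1 z.2 : borel 'rV[R]_(d + 1)) \o
  (fun p => (p, c : measurableTypeR R)) by [].
apply: (measurable_comp _ _ mchi).
- by apply: measurableX => //; exact: measurable_itv.
- by move=> _ [p _ <-]; split => //=; rewrite in_itv.
- exact: measurable_fun_pair.
Qed.

Let endpoints_null (c : R) : c = 0 \/ c = 1 ->
  measurable [set p | last_coord (chi p c) != c] /\
  P [set p | last_coord (chi p c) != c] = 0%E.
Proof.
move=> c01; have c01' : 0 <= c <= 1 by case: c01 => ->; rewrite ?lexx ?ler01.
pose B : set (borel 'rV[R]_(d + 1)) := [set z | last_coord z != c].
have mB : measurable B.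
  have := coord_measurable (R := R) (rshift d (ord0 : 'I_1)) measurableT
    (measurableC (measurable_set1 c)).
  rewrite setTI; congr measurable; apply/seteqP; split => z /= h.
    by apply/eqP.
  by move/eqP: h.
have mpre : measurable ((fun p => chi p c) @^-1` B).
  by rewrite -[X in measurable X]setTI; exact: measurable_chi.
split; first exact: mpre.
have B0 : B `&` at_height A c = set0.
  apply/seteqP; split => // z [/= Bz [v _ vz]]; move: Bz.
  by rewrite /B /= /last_coord -vz row_mxEr mxE eqxx.
have [h0 h1] := achi mB; case: c01 => cE; subst c.
  by have := h0; rewrite B0 hausdorff0.
by have := h1; rewrite B0 hausdorff0.
Qed.

(** The prescribed irrigating and irrigated measures do not charge points off
    the heights 0 and 1, so that almost all paths connect the two faces. *)
Lemma pattern_good_set : exists G : set (borel T),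
  [/\ measurable G, P (~` G) = 0%E,
      forall p, G p -> absolutely_continuous_path (chi p) &
      forall p, G p -> last_coord (chi p 0) = 0 /\ last_coord (chi p 1) = 1].
Proof.
have [_ [N [mN PN NP]]] := pchi.
have [m0 P0] := endpoints_null (or_introl erefl).
have [m1 P1] := endpoints_null (or_intror erefl).
exists (~` (N `|` ([set p | last_coord (chi p 0) != 0] `|`
  [set p | last_coord (chi p 1) != 1]))); split.
- by apply: measurableC; apply: measurableU => //; exact: measurableU.
- rewrite setCK; apply/eqP; rewrite eq_le measure_ge0 andbT.
  apply: le_trans (measureU2 _ _ _) _ => //; first exact: measurableU.
  have PN0 : (P N <= 0)%E by rewrite le_eqVlt; apply/orP; left; apply/eqP; exact: PN.
  rewrite -[leRHS]adde0; apply: leeD => //.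
  have P00 : (P [set p | (last_coord (chi p 0) != 0)%R] <= 0)%E by rewrite P0.
  have P10 : (P [set p | (last_coord (chi p 1) != 1)%R] <= 0)%E by rewrite P1.
  apply: le_trans (measureU2 _ _ _) _ => //.
  by rewrite -[leRHS]adde0; apply: leeD.
- move=> p Np; apply: contrapT => h; apply: Np; left; exact: NP.
- move=> p Np; have [l0 l1] : ~ (last_coord (chi p 0%R) != 0%R) /\
      ~ (last_coord (chi p 1%R) != 1%R).
    by split => h; apply: Np; right; [left|right].
  by split; apply: contrapT => /eqP.
Qed.

Section good_paths.
Variable G : set (borel T).
Hypotheses (mG : measurable G) (PG : P (~` G) = 0%E).
Hypothesis acG : forall p, G p -> absolutely_continuous_path (chi p).
Hypothesis endG : forall p, G p -> last_coord (chi p 0) = 0 /\ last_coord (chi p 1) = 1.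

Let mchi := pchi.1.

Let speed := path_speed chi G.

Let mspeed : measurable_fun setT speed.
Proof. exact: measurable_path_speed. Qed.

Let mspeed_section p : measurable_fun setT (fun t : measurableTypeR R => speed (p, t)).
Proof. exact: measurableT_comp mspeed (measurable_pair1 p). Qed.

Definition particle_length p : \bar R := (\int[lambda]_t (speed (p, t))%:E)%E.

Lemma length_ge0 p : (0 <= particle_length p)%E.
Proof. by apply: integral_ge0 => t _; rewrite lee_fin path_speed_ge0. Qed.

Lemma measurable_length : measurable_fun setT particle_length.
Proof.
apply: (@measurable_fun_fubini_tonelli_F _ _ _ _ _ lambda (EFin \o speed)).
- by apply/measurable_EFinP.
- by move=> z; rewrite lee_fin path_speed_ge0.
Qed.

Let chord_le p a b : G p -> 0 <= a -> a <= b -> b <= 1 ->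
  ((enorm (chi p b - chi p a))%:E <= \int[lambda]_(t in `]a, b[) (speed (p, t))%:E)%E.
Proof.
move=> Gp a0 ab b1; apply: path_length_ge => //; first exact: acG.
- by apply: measurable_funTS; exact: mspeed_section.
- by move=> t; exact: path_speed_ge0.
- move=> t /andP[ta tb] dt; rewrite /speed /path_speed mem_set//.
  apply: derivable_speed_domain => //.
  by rewrite (le_lt_trans a0)//= (lt_le_trans tb).
Qed.

Let length_ge_sum p t : G p -> 0 <= t <= 1 ->
  ((enorm (chi p t - chi p 0) + enorm (chi p 1 - chi p t))%:E <= particle_length p)%E.
Proof.
move=> Gp /andP[t0 t1]; rewrite EFinD.
apply: le_trans (leeD (chord_le Gp (lexx 0) t0 t1) (chord_le Gp t0 t1 (lexx 1))) _.
rewrite -ge0_integral_setU//=.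
- apply: ge0_subset_integral => //.
  + exact: measurableU.
  + by apply/measurable_EFinP.
  + by move=> s _; rewrite lee_fin path_speed_ge0.
- by apply: measurable_funTS; apply/measurable_EFinP.
- by move=> s _; rewrite lee_fin path_speed_ge0.
- apply/disj_set2P/seteqP; split => // s [/=]; rewrite !in_itv/=.
  by move=> /andP[_ st] /andP[ts _]; have := lt_trans st ts; rewrite ltxx.
Qed.

Lemma length_ge1 p : G p -> (1 <= particle_length p)%E.
Proof.
move=> Gp; have [e0 e1] := endG Gp.
have := length_ge_sum Gp (t := 1); rewrite ler01 lexx => /(_ isT).
apply: le_trans; rewrite subrr enorm0 addr0 lee_fin.
apply: le_trans (coord_le_enorm _ (rshift d ord0)).
by rewrite !mxE -/(last_coord _) e1 -/(last_coord _) e0 subr0 normr1.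
Qed.

Lemma length_ge_detour p t r : G p -> 0 <= t <= 1 -> 0 <= r <= 1 ->
  r <= enorm (lsubmx (chi p t) - lsubmx (chi p 0)) ->
  ((1 + r ^+ 2 / 3)%:E <= particle_length p)%E.
Proof.
move=> Gp t01 r01 rt; have [e0 e1] := endG Gp; have /andP[r0 r1] := r01.
apply: le_trans (length_ge_sum Gp t01); rewrite lee_fin.
apply: (@detour_length _ _ (last_coord (chi p t))); rewrite ?enorm_ge0//.
  rewrite -[chi p t - chi p 0]hsubmxK sqr_enorm_row_mx lerD//.
    by rewrite linearB/= ler_pXn2r ?nnegrE ?enorm_ge0.
  rewrite sqr_enorm big_ord1 !mxE -/(last_coord _) -/(last_coord _).
  by rewrite e0 subr0.
apply: le_trans (coord_le_enorm _ (rshift d ord0)).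
by rewrite !mxE -/(last_coord (chi p 1)) e1.
Qed.

Definition total_length : \bar R := (\int[P]_p particle_length p)%E.

(** Only the integral of the speed has to be computed by Tonelli; the integrand
    of the energy is compared with it pointwise. *)
Lemma total_length_energy (kappa eps : R) : 0 <= kappa ->
  (forall x, (kappa%:E <= cost_density P eps chi x)%E) ->
  (kappa%:E * total_length <= energy P A eps chi)%E.
Proof.
move=> k0 kc; rewrite /energy asboolT//.
have -> : total_length = (\int[P \x lambda]_(z in space_time) (speed z)%:E)%E.
  rewrite integral_mkcond /total_length.
  have -> : ((fun z => (speed z)%:E) \_ space_time)%E = (fun z => (speed z)%:E).
    apply/funext => z; rewrite /patch; case: ifPn => // /negP zst.
    rewrite /speed /path_speed; case: ifPn => // /set_mem[_ z01 _].
    exfalso; apply: zst; rewrite inE; split => //=; rewrite in_itv/=.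
    by move: z01 => /andP[? ?]; rewrite !ltW.
  have mse : measurable_fun setT (fun z => (speed z)%:E) by exact/measurable_EFinP.
  have se0 z : (0 <= (speed z)%:E)%E by rewrite lee_fin path_speed_ge0.
  by rewrite (fubini_tonelli1 (fun z => (speed z)%:E) mse se0).
have mst : measurable (@space_time R T).
  by apply: measurableX => //; exact: measurable_itv.
rewrite -ge0_integralZl//; last 2 first.
- by apply: measurable_funTS; apply/measurable_EFinP.
- by move=> z _; rewrite lee_fin path_speed_ge0.
apply: le_integral_nonmeasurable => z _.
  by rewrite mule_ge0// lee_fin// path_speed_ge0.
apply: lee_pmul => //; rewrite ?lee_fin ?path_speed_ge0//.
by rewrite /speed /path_speed; case: ifPn => // _; exact: enorm_ge0.
Qed.

(** Defined by length, not by sideways motion, which makes it measurable; by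
    [length_ge_detour] it contains all good paths that move sideways by r or
    more. *)
Definition detour_set r : set (borel T) :=
  [set p | G p /\ ((1 + r ^+ 2 / 3)%:E <= particle_length p)%E].

Lemma measurable_detour_set r : measurable (detour_set r).
Proof.
have := measurable_length measurableT
  (emeasurable_itv `[(1 + r ^+ 2 / 3)%:E, +oo[).
rewrite setTI => m1; have := measurableI _ _ mG m1.
by congr measurable; apply/seteqP; split => p [Gp];
  rewrite /= in_itv/= andbT => H; split.
Qed.

Let PGT : P G = P setT.
Proof.
have PU : P (G `|` ~` G) = (P G + P (~` G))%E.
  by apply: measureU => //; [exact: measurableC|exact: setICr].
by rewrite -(setUv G) PU PG adde0.
Qed.

Lemma total_length_detour r : 0 <= r ->
  (P setT + (r ^+ 2 / 3)%:E * P (detour_set r) <= total_length)%E.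
Proof.
move=> r0; have mDr := measurable_detour_set r.
have c0 : (0 <= (r ^+ 2 / 3)%:E)%E by rewrite lee_fin divr_ge0// sqr_ge0.
have mI (B : set (borel T)) : measurable B ->
    measurable_fun setT (fun p => (\1_B p)%:E).
  by move=> mB; apply/measurable_EFinP; exact: measurable_indic.
apply: (@le_trans _ _ (\int[P]_p ((\1_G p)%:E +
    (r ^+ 2 / 3)%:E * (\1_(detour_set r) p)%:E))%E).
  rewrite ge0_integralD//; last 3 first.
  - exact: mI.
  - by move=> p _; rewrite mule_ge0// lee_fin.
  - by apply: measurable_funeM; exact: mI.
  rewrite ge0_integralZl//; last first.
    exact: mI.
  by rewrite !integral_indic// !setIT -PGT; exact: lexx.
apply: ge0_le_integral => //.
- by move=> p _; apply: adde_ge0; [|apply: mule_ge0 => //]; rewrite lee_fin.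
- apply: emeasurable_funD; first exact: mI.
  by apply: measurable_funeM; exact: mI.
- exact: measurable_length.
move=> p _; have [Gp|Gp] := pselect (G p); last first.
  rewrite !indicE !memNset//; last by move=> [].
  by rewrite mule0 adde0 length_ge0.
rewrite [\1_G p]indicE mem_set//.
have [Dp|Dp] := pselect (detour_set r p); last first.
  by rewrite indicE memNset// mule0 adde0 length_ge1.
rewrite indicE mem_set// mule1 -EFinD; exact: Dp.2.
Qed.

Lemma total_length_ge : (P setT <= total_length)%E.
Proof.
by have := total_length_detour (lexx 0); rewrite expr0n mul0r mul0e adde0.
Qed.

(** A good path through x is a detour or starts within horizontal distance r of
    x. The starting points are distributed like the Hausdorff measure on A. *)
Lemma multiplicity_le r x : 0 < r -> r <= 1 ->
  (multiplicity P chi x <=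
    P (detour_set r) + ((2 * r) ^+ d)%:E * hausdorff d (@cube R d 1))%E.
Proof.
move=> r0 r1.
pose B : set (borel 'rV[R]_(d + 1)) := [set z | enorm (lsubmx z - lsubmx x) < r].
have mB : measurable B.
  have mc i : measurable_fun setT (fun z : borel 'rV[R]_(d + 1) =>
      `|(lsubmx (z : 'rV[R]_(d + 1)) - lsubmx x) 0 i| ^+ 2).
    apply: measurable_funX; apply: measurableT_comp => //.
    rewrite (_ : (fun z => _) = (fun z : borel 'rV[R]_(d + 1) =>
      (z : 'rV[R]_(d + 1)) 0 (lshift 1 i) - x 0 (lshift 1 i))).
      by apply: measurable_funB => //; exact: coord_measurable.
    by apply/funext => z; rewrite !mxE.
  have ms : measurable_fun setT (fun z : borel 'rV[R]_(d + 1) =>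
      \sum_i `|(lsubmx (z : 'rV[R]_(d + 1)) - lsubmx x) 0 i| ^+ 2).
    exact: measurable_sum.
  have := ms measurableT `]-oo, r ^+ 2[%classic (measurable_itv _).
  rewrite setTI; congr measurable; apply/seteqP; split => z; rewrite /= in_itv/= /B/=;
    under eq_bigr do rewrite real_normK ?num_real//;
    by rewrite -sqr_enorm ltr_pXn2r ?nnegrE ?enorm_ge0// ltW.
have mpre : measurable ((fun p => chi p 0) @^-1` B).
  rewrite -[X in measurable X]setTI; apply: measurable_chi => //.
  by rewrite lexx ler01.
have mDr := measurable_detour_set r.
pose U := (~` G) `|` (detour_set r `|` (fun p => chi p 0) @^-1` B).
have mU : measurable U.
  by apply: measurableU; [exact: measurableC|exact: measurableU].
apply: (@le_trans _ _ (P U)).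
  rewrite /multiplicity -(measurable_mu_extE P mU); apply: le_mu_ext.
  move=> q [t /=]; rewrite in_itv/= => t01 qt.
  have [Gq|Gq] := pselect (G q); last by left.
  right; have [h|h] := ltP (enorm (lsubmx (chi q 0) - lsubmx x)) r.
    by right.
  left; split => //; apply: (length_ge_detour Gq t01); first by rewrite (ltW r0).
  by rewrite qt enormB.
apply: le_trans (measureU2 _ _ _) _; [exact: measurableC|exact: measurableU|].
have PG0 : (P (~` G) <= 0)%E by rewrite PG.
rewrite -[leRHS]add0e; apply: leeD => //.
apply: le_trans (measureU2 _ _ _) _ => //; apply: leeD => //.
have [irr _] := achi mB; rewrite /irrigating /pushforward in irr.
have := hausdorff_near_axis A 0 (lsubmx x) r0.
by rewrite -irr.
Qed.

End good_paths.

End pattern_lengths.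

(** * The lower bound *)

Lemma expR_le_double {R : realType} (x : R) : 0 <= x <= 1 / 2 -> expR x <= 1 + 2 * x.
Proof.
move=> /andP[x0 x1]; have h := expR_ge1Dx (- x).
have ex : expR x * expR (- x) = 1 by rewrite -expRD subrr expR0.
have := expR_gt0 x; move: (expR x) (expR (- x)) ex h => u v uv h u0.
nra.
Qed.

Section lower_bound.
Context {R : realType} {T : completeMetricType R}.
Variable P : {finite_measure set (borel T) -> \bar R}.
Variables (d : nat) (A : set 'rV[R]_d).
Let M := fine (P setT).
Hypothesis M0 : 0 < M.

Let PM : P setT = M%:E.
Proof. by rewrite fineK// fin_num_measure. Qed.

Lemma cost_density_ge m (chi : borel T -> R -> 'rV[R]_m) (eps c : R) x :
  0 <= eps -> 0 < c -> (multiplicity P chi x <= c%:E)%E ->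
  ((c `^ (- eps))%:E <= cost_density P eps chi x)%E.
Proof.
move=> eps0 c0 mc; rewrite /cost_density; case: ifPn => [m0|_]; last exact: leey.
have mfin : multiplicity P chi x \is a fin_num.
  by rewrite ge0_fin_numE ?ltW// (le_lt_trans mc)// ltry.
rewrite -(fineK mfin) poweR_EFin lee_fin.
rewrite -(fineK mfin) lee_fin in mc; rewrite -(fineK mfin) lte_fin in m0.
rewrite !powRN lef_pV2 ?posrE ?powR_gt0//.
by rewrite ge0_ler_powR// nnegrE ltW.
Qed.

Lemma multiplicity_le_mass m (chi : borel T -> R -> 'rV[R]_m) x :
  (multiplicity P chi x <= M%:E)%E.
Proof. by rewrite -PM -(measurable_mu_extE P measurableT); exact: le_mu_ext. Qed.

Lemma min_energy0_ge : (M%:E <= min_energy P A 0)%E.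
Proof.
apply: le_ereal_inf_tmp => _ [chi pchi <-].
have [achi|nachi] := pselect (admissible P A chi); last first.
  by rewrite /energy asboolF// leey.
have [G [mG PG acG endG]] := pattern_good_set pchi achi.
rewrite -PM; apply: le_trans (total_length_ge pchi mG PG acG endG) _.
rewrite -[leLHS]mul1e; apply: (total_length_energy pchi achi mG acG ler01) => x.
rewrite /cost_density; case: ifPn => _; last exact: leey.
by rewrite oppr0 poweRe0.
Qed.

(** The scales: q = eps^(1/8), detours of size q^2, kappa = |log eps| / 8. *)
Variables q : R.
Hypotheses (d0 : (0 < d)%N) (q0 : 0 < q).
Hypothesis H1 : hausdorff d (@cube R d 1) \is a fin_num.
Let cd := fine (hausdorff d (@cube R d 1)).
(** The multiplicity is at most 12 q^2 + (2 q^2)^d cd <= K q^2; a summand 24 in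
    place of 12 also makes q at most 1/24. *)
Let K := 24 + 2 ^+ d * cd.
Hypotheses (qK : q * K <= 1) (qM : q * M <= 1).

Let eps := q ^+ 8.
Let kappa := - ln q.

(** Suppose that the energy is less than claimed. The cost density is at least
    M^(-eps), which bounds the total length by M (1 + 4 eps kappa). So the
    detours of size q^2 have mass at most 12 q^2, and the multiplicity is at
    most K q^2 <= q everywhere. But then the cost density is at least q^(-eps)
    >= 1 + eps kappa, which refutes the assumption. *)
Lemma lower_bound_energy chi : irrigation_pattern P chi ->
  ((M * (1 + eps * kappa))%:E <= energy P A eps chi)%E.
Proof.
move=> pchi.
have [achi|nachi] := pselect (admissible P A chi); last first.
  by rewrite /energy asboolF// leey.
have [G [mG PG acG endG]] := pattern_good_set pchi achi.
pose L := total_length P chi G.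
have cd0 : 0 <= cd by rewrite fine_ge0// hausdorff_ge0.
have K24 : 24 <= K by rewrite lerDl mulr_ge0// exprn_ge0.
have K0 : 0 < K by lra.
have q24 : q <= 24^-1.
  rewrite -div1r ler_pdivlMr//; apply: le_trans qK.
  by rewrite ler_pM2l.
have q1 : q < 1 by lra.
have kappa0 : 0 < kappa by rewrite oppr_gt0 ln_lt0// q0.
have expk : expR kappa = q^-1 by rewrite expRN lnK// posrE.
have kq : kappa * q <= 1.
  by rewrite -ler_pdivlMr// div1r -expk (le_trans _ (expR_ge1Dx _))// lerDr.
have eps0 : 0 < eps by rewrite exprn_gt0.
have ek1 : eps * kappa <= 1 / 8.
  rewrite /eps exprSr -mulrA (mulrC q).
  apply: (@le_trans _ _ (q ^+ 7)).
    by rewrite ler_piMr// exprn_ge0// ltW.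
  rewrite (@le_trans _ _ (q ^+ 1))//; last by lra.
  by rewrite ler_wiXn2l// ltW.
rewrite leNgt; apply/negP => short.
have cheap : ((M `^ (- eps))%:E * L <= energy P A eps chi)%E.
  apply: (total_length_energy pchi achi mG acG (powR_ge0 _ _)) => x.
  apply: cost_density_ge => //; [exact: ltW|exact: multiplicity_le_mass].
have MeL : M `^ eps <= 1 + 2 * (eps * kappa).
  have : M `^ eps <= expR (eps * kappa).
    rewrite /powR gt_eqF// ler_expR ler_pM2l// /kappa -lnV ?posrE// ler_ln ?posrE ?invr_gt0//.
    by rewrite -div1r ler_pdivlMr// mulrC.
  move=> /le_trans; apply.
  by apply: expR_le_double; rewrite mulr_ge0 ?ltW//=; lra.
have LM : (L <= (M * (1 + 4 * (eps * kappa)))%:E)%E.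
  have Me0 : 0 < M `^ (- eps) by exact: powR_gt0.
  have : ((M `^ (- eps))%:E * L <= (M * (1 + eps * kappa))%:E)%E.
    exact: le_trans cheap (ltW short).
  rewrite -lee_pdivlMl// powRN invrK => /le_trans; apply.
  rewrite -EFinM lee_fin mulrCA ler_pM2l//.
  apply: le_trans (ler_wpM2r _ MeL) _; first by rewrite addr_ge0// mulr_ge0// ltW.
  have : 0 <= eps * kappa by rewrite mulr_ge0 ?ltW.
  by move: (eps * kappa) ek1 => t ? ?; nra.
have q20 : 0 < q ^+ 2 by rewrite exprn_gt0.
have q21 : q ^+ 2 <= 1 by rewrite expr_le1// ltW.
have PD : (P (detour_set chi G (q ^+ 2)) <= (12 * q ^+ 2)%:E)%E.
  have := total_length_detour pchi mG PG acG endG (ltW q20).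
  have Dfin : P (detour_set chi G (q ^+ 2)) \is a fin_num.
    by apply: fin_num_measure; exact: (measurable_detour_set pchi mG acG).
  move=> /le_trans /(_ LM); rewrite PM -(fineK Dfin) -EFinM -EFinD !lee_fin.
  set D := fine _; rewrite mulrDr mulr1 lerD2l.
  have -> : (q ^+ 2) ^+ 2 / 3 * D = q ^+ 4 * (D / 3) by rewrite -exprM; field.
  have -> : M * (4 * (eps * kappa)) = q ^+ 4 * (q ^+ 2 * 4 * ((q * M) * (kappa * q))).
    by rewrite /eps; ring.
  rewrite ler_pM2l ?exprn_gt0// => h.
  have : D / 3 <= q ^+ 2 * 4.
    apply: le_trans h _; rewrite -[leRHS]mulr1 ler_pM2l ?mulr_gt0//.
    by rewrite mulr_ile1// ?mulr_ge0// ltW.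
  lra.
have mle x : (multiplicity P chi x <= (K * q ^+ 2)%:E)%E.
  apply: le_trans (multiplicity_le pchi achi mG PG acG endG x q20 q21) _.
  rewrite -(fineK H1) -/cd -EFinM.
  apply: le_trans (leeD PD (lexx _)) _; rewrite -EFinD lee_fin /K exprMn.
  have qd : (q ^+ 2) ^+ d <= q ^+ 2.
    by rewrite -[leRHS]expr1 ler_wiXn2l// ltW.
  have : 2 ^+ d * (q ^+ 2) ^+ d * cd <= 2 ^+ d * cd * q ^+ 2.
    rewrite -mulrA -[leRHS]mulrA ler_pM2l ?exprn_gt0// mulrC.
    by rewrite ler_wpM2l.
  by rewrite mulrDl; lra.
have Kq0 : 0 < K * q ^+ 2 by rewrite mulr_gt0.
have better : ((1 + eps * kappa)%:E * L <= energy P A eps chi)%E.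
  apply: (total_length_energy pchi achi mG acG) => [|x].
    by rewrite addr_ge0// mulr_ge0// ltW.
  apply: le_trans (cost_density_ge (ltW eps0) Kq0 (mle x)).
  rewrite lee_fin /powR gt_eqF//.
  apply: le_trans (expR_ge1Dx _); rewrite lerD2l mulNr -mulrN ler_pM2l//.
  rewrite /kappa -lnV ?posrE// -lnV ?posrE// ler_ln ?posrE ?invr_gt0//.
  rewrite invfM expr2 invfM mulrA -[leLHS]mul1r ler_pM2r ?invr_gt0//.
  by rewrite -invfM -div1r ler_pdivlMr ?mulr_gt0// mul1r mulrC.
suff : ((M * (1 + eps * kappa))%:E <= energy P A eps chi)%E by rewrite leNgt short.
apply: (le_trans _ better); rewrite EFinM muleC; apply: lee_wpmul2l.
  by rewrite lee_fin addr_ge0// mulr_ge0// ltW.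
by rewrite -PM; exact: (total_length_ge pchi mG PG acG endG).
Qed.

Lemma lower_bound_min_energy :
  ((M * (1 + eps * kappa))%:E <= min_energy P A eps)%E.
Proof.
by apply: le_ereal_inf_tmp => _ [chi pchi <-]; exact: lower_bound_energy.
Qed.

End lower_bound.

(** * The upper bound *)

Lemma branching_speed_le {R : realType} d (l : R) k :
  branching_speed d l k <= 1 + 2 * d%:R * (l / 2 ^+ k) ^+ 2.
Proof.
have h : 0 <= 2 * d%:R * (l / 2 ^+ k) ^+ 2 by rewrite mulr_ge0// sqr_ge0.
rewrite /branching_speed -[leRHS]ger0_norm ?addr_ge0// -sqrtr_sqr.
apply: ler_wsqrtr; rewrite (_ : l * (2 / 2 ^+ k) = 2 * (l / 2 ^+ k)); last by ring.
move: (l / 2 ^+ k) h => w h; rewrite sqrrD expr1n mul1r addrC.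
rewrite -addrA lerD2l (_ : d%:R * _ = 2 * d%:R * w ^+ 2 *+ 2); last by ring.
by rewrite lerDl sqr_ge0.
Qed.

Lemma dyadic_scale {R : realType} (l w : R) : 0 < w ->
  exists k, l / 2 ^+ k <= w /\ (k = 0%N \/ w / 2 <= l / 2 ^+ k).
Proof.
move=> w0.
have ex : exists k, l / 2 ^+ k <= w.
  exists (Num.bound (`|l| / w)); rewrite ler_pdivrMr ?exprn_gt0//.
  apply: le_trans (ler_norm _) _; rewrite -ler_pdivrMl// mulrC.
  apply: le_trans (ltW (archi_boundP _)) _; first by rewrite divr_ge0 ?(ltW w0).
  by rewrite -natrX ler_nat ltnW// ltn_expl.
have [k kw kmin] := ex_minnP ex; exists k; split => //.
case: k kw kmin => [|k] kw kmin; [by left|right].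
have : ~~ (l / 2 ^+ k <= w) by apply/negP => /kmin; rewrite ltnn.
rewrite -ltNge => /ltW wk; rewrite exprS invfM mulrCA mulrC ler_pM2l//.
Qed.

Section upper_bound.
Context {R : realType} {T : completeMetricType R}.
Variable P : {finite_measure set (borel T) -> \bar R}.
Variables (d : nat) (a : 'rV[R]_d) (Q : 'M[R]_d) (l : R).
Hypotheses (d0 : (0 < d)%N) (QQ : Q *m Q^T = 1%:M) (l0 : 0 < l).
Hypothesis PT : P setT = hausdorff d (@cube R d l).
Hypothesis atomlessP : atomless P.
Let M := fine (P setT).
Hypothesis M0 : 0 < M.

Let A : set 'rV[R]_d := [set a + u *m Q | u in cube l].

(** At eps = 0 a thin bundle costs no more per particle than a thick one, and
    fine branching patterns are almost vertical. *)
Lemma min_energy0_le : (min_energy P A 0 <= M%:E)%E.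
Proof.
have [bit bitP] := atomless_bits atomlessP.
apply/lee_addgt0Pr => e e0.
pose D : R := 18 * d%:R + 8.
have D0 : 0 < D by rewrite /D ltr_wpDl// mulr_ge0.
pose t := Num.min 1 (e / (M * D)).
have t0 : 0 < t by rewrite lt_min ltr01 divr_gt0// mulr_gt0.
have t1 : t <= 1 by rewrite ge_min lexx.
have te : M * (D * t) <= e.
  by rewrite mulrA -ler_pdivlMl ?mulr_gt0// mulrC ge_min lexx orbT.
have [k [kt _]] := dyadic_scale l t0.
apply: le_trans (min_energy_le_branching a k d0 QQ l0 PT bitP M0 (lexx 0) t0 t1 _) _.
  by rewrite mulr0 ltW.
rewrite oppr0 powRr0 mulr1 -EFinD lee_fin -mulrA.
apply: le_trans (lerD (lexx M) te); rewrite -[leRHS]/(M + M * (D * t)).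
rewrite (_ : M + M * (D * t) = M * (1 + D * t)); last by ring.
rewrite ler_pM2l//.
have w0 : 0 <= l / 2 ^+ k by rewrite divr_ge0 ?ltW// exprn_gt0.
have wt : (l / 2 ^+ k) ^+ 2 <= t.
  rewrite expr2 -[leRHS]mul1r ler_pM//; exact: le_trans t1.
have sp : branching_speed d l k <= 1 + 2 * d%:R * t.
  by apply: le_trans (branching_speed_le _ _ _) _; rewrite lerD2l ler_wpM2l// mulr_ge0.
apply: le_trans (ler_wpM2r _ sp) _; first by rewrite addr_ge0// mulr_ge0// ltW.
rewrite /D; have : 0 <= (d%:R : R) by [].
move: (d%:R : R) => x x0; have : t * t <= t by rewrite ler_piMr// ltW.
move=> tt; have : x * (t * t) <= x * t by rewrite ler_wpM2l.
nra.
Qed.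

Variable q : R.
Hypotheses (q0 : 0 < q) (qd : 16 * d%:R * q <= 1).
Hypothesis H1 : ((q * 2 ^+ d)%:E <= hausdorff d (@cube R d 1))%E.
Hypothesis Mq : q ^+ (4 * d) <= M.

Let eps := q ^+ 8.
Let kappa := - ln q.

Let q16 : 16 * q <= 1.
Proof.
apply: le_trans qd; rewrite -mulrA ler_pM2l// ler_peMl ?ler1n//; exact: ltW.
Qed.

(** A bundle at mid height carries the measure of a cube of side at least q^4 /
    2, or all of M if the cube is not divided. *)
Lemma branch_mass_ge k : k = 0%N \/ q ^+ 4 / 2 <= l / 2 ^+ k ->
  q ^+ (4 * d).+1 <= M / 2 ^+ (k * d).
Proof.
have q1 : q <= 1 by move: q0 q16; lra.
case=> [->|qk].
  rewrite mul0n expr0 divr1; apply: le_trans Mq.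
  by rewrite exprS ler_piMl// exprn_ge0// ltW.
have ld0 : 0 < l ^+ d by rewrite exprn_gt0.
have q40 : 0 < q ^+ 4 by rewrite exprn_gt0.
have Mfin : hausdorff d (@cube R d l) \is a fin_num by rewrite -PT fin_num_measure.
have H1le : (q * 2 ^+ d) * l ^+ d <= M.
  rewrite -lee_fin fineK ?fin_num_measure// PT hausdorff_cube// muleC EFinM.
  by apply: lee_wpmul2r => //; rewrite lee_fin ltW.
apply: (@le_trans _ _ (q * 2 ^+ d * l ^+ d / 2 ^+ (k * d))); last first.
  by rewrite ler_pM2r// invr_gt0 exprn_gt0.
rewrite exprS -!mulrA ler_pM2l// exprM [2 ^+ (k * d)]exprM -expr_div_n -exprMn.
rewrite lerXn2r ?nnegrE ?mulr_ge0 ?invr_ge0 ?exprn_ge0 ?(ltW q0) ?(ltW l0)//.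
by rewrite -ler_pdivrMl// mulrC.
Qed.

(** The branching pattern with smallest side l / 2^k about q^4 = sqrt eps. With
    X = 2 d eps |log eps| the factors for slope, for the thickest bundles and
    for the ends are at most 1 + X, 1 + X and 1 + 8 X. *)
Lemma upper_bound_min_energy :
  (min_energy P A eps <= (M * (1 + 70 * d%:R * (eps * (8 * kappa))))%:E)%E.
Proof.
have [bit bitP] := atomless_bits atomlessP.
have q1 : q < 1 by move: q0 q16; lra.
have kappa0 : 0 < kappa by rewrite oppr_gt0 ln_lt0// q0.
have expk : expR kappa = q^-1 by rewrite expRN lnK// posrE.
have kq : kappa * q <= 1.
  by rewrite -ler_pdivlMr// div1r -expk (le_trans _ (expR_ge1Dx _))// lerDr.
have kappa8 : 1 <= 8 * kappa.
  have : 1 - kappa <= q by rewrite -[leRHS]lnK ?posrE// -[ln q]opprK expR_ge1Dx.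
  by move: q0 q16; lra.
have eps0 : 0 < eps by rewrite exprn_gt0.
pose X := 16 * d%:R * (eps * kappa).
have d1 : 1 <= d%:R :> R by rewrite ler1n.
have X0 : 0 < X by rewrite !mulr_gt0// ltr0n.
have X1 : X <= 1.
  apply: le_trans qd; rewrite /X ler_pM2l ?mulr_gt0 ?ltr0n//.
  have -> : eps * kappa = q * (q ^+ 6 * (kappa * q)) by rewrite /eps; ring.
  rewrite ler_piMr ?(ltW q0)// mulr_ile1 ?exprn_ge0 ?mulr_ge0 ?expr_le1//; exact: ltW.
pose theta := 2 * d%:R * eps.
have theta0 : 0 < theta by rewrite !mulr_gt0// ltr0n.
have thetaX : theta <= X.
  rewrite /theta /X (_ : 16 * _ * _ = 2 * d%:R * eps * (8 * kappa)); last by ring.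
  by rewrite ler_pMr.
have [k [kw wk]] := dyadic_scale l (exprn_gt0 4 q0).
apply: le_trans (min_energy_le_branching a k d0 QQ l0 PT bitP M0
  (ltW eps0) theta0 (le_trans thetaX X1) (lexx _)) _.
rewrite (_ : 70 * d%:R * (eps * (8 * kappa)) = 35 * X); last by rewrite /X; ring.
rewrite lee_fin -/M -!/theta -!mulrA ler_pM2l//.
have w0 : 0 <= l / 2 ^+ k by rewrite divr_ge0 ?ltW// exprn_gt0.
have sp : branching_speed d l k <= 1 + X.
  apply: le_trans (branching_speed_le _ _ _) _; rewrite lerD2l.
  apply: le_trans thetaX; rewrite /theta ler_pM2l ?mulr_gt0 ?ltr0n//.
  by rewrite /eps (exprM _ 4 2) lerXn2r ?nnegrE// exprn_ge0// ltW.
have Kle : (M / 2 ^+ (k * d)) `^ (- eps) <= 1 + X.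
  have Md0 : 0 < M / 2 ^+ (k * d) by rewrite divr_gt0// exprn_gt0.
  rewrite /powR gt_eqF//.
  apply: (@le_trans _ _ (expR (8 * d%:R * (eps * kappa)))).
    rewrite ler_expR mulNr -mulrN mulrCA ler_pM2l// /kappa mulrN lerN2.
    apply: (@le_trans _ _ (ln (q ^+ (4 * d).+1))).
      rewrite lnXn// -[leRHS]mulr_natl ler_wnM2r//.
        by rewrite ltW// ln_lt0// q0.
      by move: d1; rewrite -natr1 natrM; lra.
    by rewrite ler_ln ?posrE ?exprn_gt0//; exact: branch_mass_ge.
  rewrite (_ : X = 2 * (8 * d%:R * (eps * kappa))); last by rewrite /X; ring.
  by apply: expR_le_double; move: X0 X1; rewrite /X; lra.
have sp0 := branching_speed_gt0 d l k.
apply: (@le_trans _ _ ((1 + X) * ((1 + X) * (1 + 8 * X)))).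
  apply: ler_pM => //; first exact: ltW.
    by rewrite mulr_ge0 ?powR_ge0// addr_ge0// mulr_ge0// ltW.
  apply: ler_pM => //; first exact: powR_ge0.
    by rewrite addr_ge0// mulr_ge0// ltW.
  by rewrite lerD2l ler_pM2l.
by move: (X) X0 X1 => x x0 x1; nra.
Qed.

End upper_bound.

(** * Scaling of the excess energy *)

Lemma eighth_root {R : realType} (eps : R) : 0 < eps ->
  exists2 q, 0 < q & eps = q ^+ 8.
Proof.
move=> eps0; exists (eps `^ 8^-1); first exact: powR_gt0.
by rewrite -powR_mulrn ?powR_ge0// -powRrM mulVf// powRr1// ltW.
Qed.

Theorem theorem2p4p2 (R : realType) (n : nat) (hn : (2 <= n)%N) :
  exists C1 C2 C3 C4 : R,
    [/\ 0 < C1, 0 < C2, 0 < C3 & 0 < C4] /\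
    forall A : set 'rV[R]_(n.-1), hypersquare A ->
    forall (T : completeMetricType R)
      (P : {finite_measure set (borel T) -> \bar R}),
      reference_space P (hausdorff n.-1 A) ->
    forall eps : R,
      let area := fine (hausdorff n.-1 A) in
      0 < eps ->
      eps < Num.min (area `^ (2 / n.-1%:R)) (Num.min (area `^ (- C3)) C4) ->
      ((C1 * area * eps * `|ln eps|)%:E <= excess_energy P A eps)%E /\
      (excess_energy P A eps <= (C2 * area * eps * `|ln eps|)%:E)%E.
Proof.
have d0 : (0 < n.-1)%N by case: n hn => [|[]].
set d := n.-1 in d0 *.
have d1 : 1 <= d%:R :> R by rewrite ler1n.
pose c := fine (hausdorff d (@cube R d 1)).
have c0 : 0 <= c by rewrite fine_ge0// hausdorff_ge0.
pose K := 24 + 2 ^+ d * c.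
have K0 : 0 < K by rewrite ltr_wpDr// mulr_ge0// exprn_ge0.
(* A reference space forces 0 < c. The constants are chosen before one is given,
   so b is a positive default otherwise. *)
pose b := if 0 < c then c / 2 ^+ d else 1.
have b0 : 0 < b by rewrite /b; case: ifPn => // c1; rewrite divr_gt0// exprn_gt0.
pose q0 := Num.min K^-1 (Num.min b (16 * d%:R)^-1).
have q00 : 0 < q0 by rewrite !lt_min invr_gt0 K0 b0 invr_gt0 mulr_gt0// ltr0n.
(* 8 kappa = |log eps| turns the two bounds into C1 = 1/8 and C2 = 70 d. The
   condition eps < M^(-8) says that q M < 1. *)
exists (1 / 8), (70 * d%:R), 8, (q0 ^+ 8); split.
  by split; rewrite ?exprn_gt0 ?mulr_gt0 ?ltr0n.
move=> A [a [Q [l [l0 QQ AE]]]] T P [_ _ atomlessP PT Pgt0] eps area eps0.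
rewrite -/d in A a Q QQ AE PT Pgt0 area *.
rewrite !lt_min => /and3P[eps_area eps_area8 eps_q0].
have AE' : A = [set a + u *m Q | u in cube l] by exact: AE.
have HA : hausdorff d A = hausdorff d (@cube R d l) by rewrite AE' hausdorff_square.
have areaE : area = fine (P setT) by rewrite PT.
have M0 : 0 < fine (P setT).
  by rewrite fine_gt0// PT Pgt0/= -PT ltey_eq fin_num_measure.
(* P is finite and A has its positive mass; scaling passes both properties on to
   the unit cube. *)
have [Hfin Hgt0] : hausdorff d (@cube R d 1) \is a fin_num /\ 0 < c.
  have := Pgt0; have : P setT \is a fin_num by rewrite fin_num_measure.
  rewrite PT HA hausdorff_cube// /c; have := hausdorff_ge0 d (@cube R d 1).
  have ld0 : 0 < l ^+ d by rewrite exprn_gt0.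
  case: (hausdorff d (cube 1)) => [h| |] //= h0.
    by move=> _; rewrite -EFinM lte_fin pmulr_rgt0.
  by rewrite gt0_muley ?lte_fin.
have [q q_gt0 epsE] := eighth_root eps0.
have root_lt x : 0 <= x -> eps < x ^+ 8 -> q < x.
  by move=> x0; rewrite epsE ltr_pXn2r ?nnegrE// ltW.
have : q < q0 by exact: root_lt (ltW q00) eps_q0.
rewrite !lt_min => /and3P[qK qb qd].
have qK1 : q * K <= 1 by rewrite -ler_pdivlMr// div1r ltW.
have qd1 : 16 * d%:R * q <= 1.
  rewrite -ler_pdivlMl ?mulr_gt0 ?ltr0n// mulr1; exact: ltW.
have qM : q * fine (P setT) <= 1.
  rewrite -ler_pdivlMr// div1r ltW// root_lt ?invr_ge0 ?(ltW M0)//.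
  by rewrite exprVn -powR_mulrn ?(ltW M0)// -powRN -areaE.
have Mq : q ^+ (4 * d) <= fine (P setT).
  have dn0 : d%:R != 0 :> R by rewrite pnatr_eq0 -lt0n.
  have -> : fine (P setT) = (area `^ (2 / d%:R)) `^ (d%:R / 2).
    by rewrite -powRrM -areaE mulrA divfK// divff// powRr1// areaE ltW.
  have -> : q ^+ (4 * d) = eps `^ (d%:R / 2).
    rewrite epsE -!powR_mulrn ?(ltW q_gt0)// -powRrM natrM; congr (_ `^ _).
    by field.
  by rewrite ge0_ler_powR ?nnegrE ?powR_ge0 ?divr_ge0// ltW.
have Hq : ((q * 2 ^+ d)%:E <= hausdorff d (@cube R d 1))%E.
  rewrite -(fineK Hfin) lee_fin -ler_pdivlMr ?exprn_gt0//.
  by move: qb; rewrite /b Hgt0 => /ltW.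
have q1 : q < 1.
  by apply: le_lt_trans (lt_le_trans qd _); rewrite // invf_le1; lra.
have lnE : `|ln eps| = 8 * - ln q.
  have -> : ln eps = 8 * ln q by rewrite epsE lnXn// [RHS]mulr_natl.
  by rewrite normrM ger0_norm// ltr0_norm// ln_lt0// q_gt0.
have PTH : P setT = hausdorff d (@cube R d l) by rewrite PT.
have E0 : min_energy P A 0 = (fine (P setT))%:E.
  apply/eqP; rewrite eq_le min_energy0_ge// andbT AE'.
  exact: min_energy0_le.
rewrite /excess_energy E0 leeBrDr// leeBlDr// lnE areaE epsE; split.
  apply: le_trans (lower_bound_min_energy A M0 d0 q_gt0 Hfin qK1 qM).
  by rewrite -EFinD lee_fin le_eqVlt; apply/orP; left; apply/eqP; field.
rewrite AE'; apply: le_trans (upper_bound_min_energy a d0 QQ l0 PTH atomlessP M0 q_gt0 qd1 Hq Mq) _.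
by rewrite -EFinD lee_fin le_eqVlt; apply/orP; left; apply/eqP; ring.
Qed.
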